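(* Let $\mathcal D\subset\mathcal C$ be the characteristic distribution associated with a parabolic Monge-Ampère equation $\mathcal E_\omega$. Then $\mathcal E_\omega$ admits intermediate integrals if and only if: 1) $\mathcal D$ is integrable, or 2) $\mathcal D''$ is 4-dimensional and integrable. In the first case, intermediate integrals are all and only the functions of the form $f=\phi(f_1,f_2,f_3)$ with $\phi$ an arbitrary function of three real variables and $f_1,f_2,f_3$ independent first integrals of $\mathcal D$; in the second case, there exists (up to functional dependence) only one intermediate integral, given by the function $f$ such that $\mathcal D''=\{df=0\}$.
   Context: Everything is $C^\infty$ and local. $J^1(\tau)$ is the manifold of 1-jets of functions $z=z(x,y)$, with coordinates $(x,y,z,p,q)$, $p=z_x,q=z_y$; $U=dz-p\,dx-q\,dy$ and $\mathcal C=\{U=0\}$ is the contact distribution. A Monge-Ampère equation is $N(z_{xx}z_{yy}-z_{xy}^2)+Az_{xx}+Bz_{xy}+Cz_{yy}+D=0$ with coefficients smooth functions on $J^1(\tau)$, nowhere simultaneously zero; it is parabolic if $B^2-4AC+4ND=0$ identically. It is then written $\mathcal E_\omega$ with $$\omega=D\,dx\wedge dy+\tfrac B2dx\wedge dp+C\,dx\wedge dq-A\,dy\wedge dp-\tfrac B2 dy\wedge dq+N\,dp\wedge dq,$$ whose restriction to $\mathcal C$ is degenerate; the characteristic distribution is the 2-dimensional distribution $\mathcal D=\mathrm{Rad}(\omega|_{\mathcal C})\subset\mathcal C$. Solutions of $\mathcal E_\omega$ are 2-dimensional integral surfaces $\Sigma\subset J^1(\tau)$ of $\mathcal C$ with $\omega|_\Sigma=0$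 (graphs of first prolongations in the classical case). An intermediate integral of $\mathcal E_\omega$ is a function $f\in C^\infty(J^1(\tau))$ such that solutions of the first order equations $f=k$, $k\in\mathbb R$ (i.e. 2-dimensional integral surfaces of $\mathcal C$ contained in $\{f=k\}$), are also solutions of $\mathcal E_\omega$; here $f$ is assumed regular, i.e. $df$ and $U$ are linearly independent at each point. Accordingly, $\phi$ is such that $f$ is regular. For a distribution $\mathcal P$, $\mathcal P'=\mathcal P+[\mathcal P,\mathcal P]$; $\mathcal D''=(\mathcal D')'$. A first integral of $\mathcal D$ is a function $f$ with $W(f)=0$ for all $W\in\mathcal D$. Integrable means involutive. Regularity convention: $\mathcal D,\mathcal D',\mathcal D''$ have constant rank. *)

(* Defs.v *)
From HB Require Import structures.
From mathcomp Require Import all_boot all_order all_algebra.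
From mathcomp Require Import all_classical all_reals all_analysis.
Set Implicit Arguments.
Unset Strict Implicit.
Unset Printing Implicit Defensive.
Import Order.TTheory GRing.Theory Num.Theory.
Import numFieldNormedType.Exports.
Local Open Scope classical_set_scope.
Local Open Scope ring_scope.

Section SmoothFunctions.
Context {R : realType}.

Definition iter_derive {V W : normedModType R} (s : seq V) (f : V -> W) :
  V -> W := foldr (fun v g x => 'D_v g x) f s.

(* C^oo on the open set O: every iterated directional derivative of f,
   f itself included (s = [::]), is (Frechet) differentiable on O. *)
Definition smooth {V W : normedModType R} (O : set V) (f : V -> W) : Prop :=
  forall (s : seq V) (x : V), O x -> differentiable (iter_derive s f) x.

(* Around each point of O, g = phi o F with phi smooth on an open set. *)
Definition locally_function_of {V T : normedModType R}
    (O : set V) (F : V -> T) (g : V -> R) : Prop :=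
  forall m, O m -> exists (O' : set V) (Q : set T) (phi : T -> R),
    [/\ open O' /\ O' m, O' `<=` O, open Q, smooth Q phi
      & forall x, O' x -> Q (F x) /\ g x = phi (F x)].

End SmoothFunctions.

Section Distributions.
Context {R : realType} {n : nat}.
Local Notation pt := 'rV[R]_n.+1.

(* A (possibly non-constant rank) distribution on R^(n+1): at each point x,
   the set P x of its tangent vectors. *)
Definition distribution := pt -> set pt.

Definition has_rank (P : set pt) (r : nat) : Prop :=
  exists E : {vspace pt}, \dim E = r /\ forall v, v \in E <-> P v.

Definition constant_rank (O : set pt) (P : distribution) : Prop :=
  exists r, forall x, O x -> has_rank (P x) r.

Definition vector_field_in (O : set pt) (P : distribution) (X : pt -> pt) :
  Prop := smooth O X /\ forall x, O x -> P x (X x).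

Definition lie_bracket (X Y : pt -> pt) : pt -> pt :=
  fun x => 'd Y x (X x) - 'd X x (Y x).

Definition linear_span (S : set pt) : set pt :=
  [set v | exists (k : nat) (a : 'I_k -> R) (w : 'I_k -> pt),
     (forall i, S (w i)) /\ v = \sum_(i < k) a i *: w i].

(* Values at x of brackets of local sections, defined around x inside O. *)
Definition bracket_values (O : set pt) (P : distribution) (x : pt) : set pt :=
  [set v | exists (O' : set pt) (X Y : pt -> pt),
     [/\ open O' /\ O' x, O' `<=` O, vector_field_in O' P X,
         vector_field_in O' P Y & v = lie_bracket X Y x]].

(* P' = P + [P, P] on the open set O. *)
Definition derived (O : set pt) (P : distribution) : distribution :=
  fun x => linear_span (P x `|` bracket_values O P x).

Definition integrable_distribution (O : set pt) (P : distribution) : Prop :=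
  forall x, O x -> bracket_values O P x `<=` P x.

Definition first_integral (O : set pt) (P : distribution) (f : pt -> R) :
  Prop := smooth O f /\ forall x v, O x -> P x v -> 'd f x v = 0.

Definition independent {k : nat} (O : set pt) (F : 'I_k -> pt -> R) : Prop :=
  forall x, O x -> forall a : 'I_k -> R,
    (forall v, \sum_(i < k) a i * 'd (F i) x v = 0) -> forall i, a i = 0.

End Distributions.
Arguments distribution : clear implicits.

Section JetSpace.
Context {R : realType}.

(* The space of 1-jets is R^5 with coordinates (x, y, z, p, q). *)
Definition ix : 'I_5 := @Ordinal 5 0 isT.
Definition iy : 'I_5 := @Ordinal 5 1 isT.
Definition iz : 'I_5 := @Ordinal 5 2 isT.
Definition ip : 'I_5 := @Ordinal 5 3 isT.
Definition iq : 'I_5 := @Ordinal 5 4 isT.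

(* U = dz - p dx - q dy *)
Definition contact_form (m v : 'rV[R]_5) : R :=
  v 0 iz - m 0 ip * v 0 ix - m 0 iq * v 0 iy.

Definition contact : distribution R 4 := fun m => [set v | contact_form m v = 0].

(* wedge i j = d(x_i) /\ d(x_j) *)
Definition wedge (i j : 'I_5) (v w : 'rV[R]_5) : R :=
  v 0 i * w 0 j - v 0 j * w 0 i.

(* N (z_xx z_yy - z_xy^2) + A z_xx + B z_xy + C z_yy + D = 0 *)
Record monge_ampere := MongeAmpere {
  cN : 'rV[R]_5 -> R;
  cA : 'rV[R]_5 -> R;
  cB : 'rV[R]_5 -> R;
  cC : 'rV[R]_5 -> R;
  cD : 'rV[R]_5 -> R }.

Definition monge_ampere_on (O : set 'rV[R]_5) (E : monge_ampere) : Prop :=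
  [/\ smooth O (cN E), smooth O (cA E), smooth O (cB E),
      smooth O (cC E) & smooth O (cD E)] /\
  forall m, O m ->
    ~ [/\ cN E m = 0, cA E m = 0, cB E m = 0, cC E m = 0 & cD E m = 0].

Definition parabolic_on (O : set 'rV[R]_5) (E : monge_ampere) : Prop :=
  forall m, O m ->
    cB E m ^+ 2 - 4 * cA E m * cC E m + 4 * cN E m * cD E m = 0.

Definition omega (E : monge_ampere) (m v w : 'rV[R]_5) : R :=
  cD E m * wedge ix iy v w + cB E m / 2 * wedge ix ip v w
  + cC E m * wedge ix iq v w - cA E m * wedge iy ip v w
  - cB E m / 2 * wedge iy iq v w + cN E m * wedge ip iq v w.

(* Rad (omega restricted to the contact distribution) *)
Definition characteristic (E : monge_ampere) : distribution R 4 :=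
  fun m => [set v | contact m v /\ forall w, contact m w -> omega E m v w = 0].

(* Surfaces are parametrized: a smooth immersion s of an open subset S of R^2
   into O, tangent to the contact distribution. *)
Definition contact_integral_surface (O : set 'rV[R]_5)
    (S : set 'rV[R]_2) (s : 'rV[R]_2 -> 'rV[R]_5) : Prop :=
  [/\ open S, smooth S s, forall t, S t -> O (s t),
      forall t, S t -> injective ('d s t)
    & forall t u, S t -> contact (s t) ('d s t u)].

Definition monge_ampere_solution (O : set 'rV[R]_5) (E : monge_ampere)
    (S : set 'rV[R]_2) (s : 'rV[R]_2 -> 'rV[R]_5) : Prop :=
  contact_integral_surface O S s /\
  forall t u1 u2, S t -> omega E (s t) ('d s t u1) ('d s t u2) = 0.

Definition first_order_solution (O : set 'rV[R]_5) (f : 'rV[R]_5 -> R) (k : R)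
    (S : set 'rV[R]_2) (s : 'rV[R]_2 -> 'rV[R]_5) : Prop :=
  contact_integral_surface O S s /\ forall t, S t -> f (s t) = k.

Definition regular_function (O : set 'rV[R]_5) (f : 'rV[R]_5 -> R) : Prop :=
  forall m, O m -> forall a b : R,
    (forall v, a * 'd f m v + b * contact_form m v = 0) -> a = 0 /\ b = 0.

Definition intermediate_integral (O : set 'rV[R]_5) (E : monge_ampere)
    (f : 'rV[R]_5 -> R) : Prop :=
  [/\ smooth O f, regular_function O f
    & forall (k : R) S s,
        first_order_solution O f k S s -> monge_ampere_solution O E S s].

(* Existence is local: an intermediate integral around each point of O. *)
Definition admits_intermediate_integrals (O : set 'rV[R]_5)
    (E : monge_ampere) : Prop :=
  forall m, O m -> exists (O' : set 'rV[R]_5) (f : 'rV[R]_5 -> R),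
    [/\ open O', O' m, O' `<=` O & intermediate_integral O' E f].

End JetSpace.

(* Main.v *)
Require Import Defs.
From HB Require Import structures.
From mathcomp Require Import all_boot all_order all_algebra.
From mathcomp Require Import all_classical all_reals all_analysis.
From mathcomp Require Import ring lra.
Set Implicit Arguments.
Unset Strict Implicit.
Unset Printing Implicit Defensive.
Import Order.TTheory GRing.Theory Num.Theory.
Import numFieldNormedType.Exports.
Local Open Scope classical_set_scope.
Local Open Scope ring_scope.

(** Write C for the contact hyperplane U = 0 at a point. On C the form dU is
    symplectic, and omega is turned by dU into an endomorphism A of C with
    omega(v, w) = dU(A v, w). The coefficients of omega contain no multiple of
    dU, which means omega /\ dU = 0, and being parabolic means A^2 = 0. Since
    omega does not vanish, D = ker A = im A is then a Lagrangian plane of C: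
    it has rank 2, it is isotropic for dU and equal to its own dU-orthogonal
    ([has_rank_characteristic], [characteristic_isotropic],
    [characteristic_maximal]).

    The pivot is [intermediateP]: a regular f is an intermediate integral if
    and only if it is a first integral of D. Let X_f be the section of C
    defined by dU(X_f, v) = df(v) for v in C; a surface integral to C inside
    f = k has its tangent planes in the dU-orthogonal of X_f. If df vanishes
    on D, then X_f lies in D (D being its own orthogonal), and
    omega /\ dU = 0, contracted with X_f, shows that omega vanishes on the
    orthogonal of X_f, hence on each solution of f = k. Conversely, by the
    method of characteristics, each w in C with df(w) = 0 is tangent, together
    with X_f, to a solution of f = k ([characteristic_surface]). So
    omega(X_f, w) = 0 for all these w, that is A X_f = c X_f; A is nilpotent,
    so X_f lies in D, and df vanishes on the isotropic plane D.

    It remains to count first integrals. A first integral of D annihilates D'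
    and D'' as well. If D is involutive, Frobenius provides three independent
    first integrals, at least one of them is regular, and the functions
    constant along D are, locally, the functions of these three. If D is not
    involutive, then D' is contained in C because D is isotropic, whereas D''
    is not: otherwise each bracket of sections of D would be dU-orthogonal to
    D, hence in D ([derived2_not_contact]). So the constant ranks satisfy
    2 < rank D' < rank D'', and an intermediate integral f, with D'' inside
    ker df, forces D'' = ker df to be 4-dimensional and involutive. Conversely,
    Frobenius applied to a 4-dimensional involutive D'' gives f with
    D'' = ker df; it is regular because D'' is not contained in C, and every
    first integral of D has its differential proportional to df.

    All the analysis behind this (flows depending smoothly on initial data,
    the inverse function theorem, functional dependence, Frobenius) is derived
    from a single construction, the time-one map of a vector field Z near a
    zero of Z, as a limit of Euler polygons. Two facts about it suffice. First,
    its differential is the time-one map of the tangent field (x, v) |->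
    (Z x, dZ_x v), which yields smoothness by induction on the order
    ([time1_tangent], [time1_Cn]). Secondly, if |dw(Z)| <= C |w| along the
    flow, then w remains zero where it starts at zero ([time1_invariant]); each
    of these theorems follows by choosing an auxiliary field and such a
    function w. *)

(** * Smooth maps between normed modules *)

Section SmoothCalculus.
Context {R : realType}.
Implicit Types U V W : normedModType R.

(** The truncation at order [k] of [smooth]: the product and chain rules are
    proved by induction on the order. *)
Fixpoint Cn (k : nat) V W (O : set V) (f : V -> W) : Prop :=
  (forall x, O x -> differentiable f x) /\
  (if k is k'.+1 then forall v, Cn k' O ('D_v f) else True).

Lemma Cn_diff k V W (O : set V) (f : V -> W) x :
  Cn k O f -> O x -> differentiable f x.
Proof. by case: k => [|k] [+ _]; apply. Qed.

Lemma smoothP V W (O : set V) (f : V -> W) :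
  smooth O f <-> forall k, Cn k O f.
Proof.
split=> [sf k|sf s x Ox].
  elim: k f sf => [|k IH] f sf /=; split=> //.
  - by move=> x; exact: (sf [::]).
  - by move=> x; exact: (sf [::]).
  move=> v; apply: IH => s x Ox.
  by have := sf (rcons s v) x Ox; rewrite /iter_derive foldr_rcons.
elim/last_ind: s f sf => [|s v IH] f sf; first exact: Cn_diff (sf 0) Ox.
rewrite /iter_derive foldr_rcons; apply: IH => k.
by have [_ /(_ v)] := sf k.+1.
Qed.

(** Differentials depend on germs only. This is needed because iterated
    derivatives are equal to their usual expressions only on the open set
    where the functions are smooth. *)
Lemma near_eq_diff V W (f g : V -> W) x :
  (\near x, f x = g x) -> differentiable f x ->
  differentiable g x /\ ('d g x : V -> W) = 'd f x.
Proof.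
move=> fg df.
have fx : f x = g x := nbhs_singleton fg.
have E : g \o shift x = cst (g x) + ('d f x : V -> W) +o_ 0 id.
  apply/eqaddoP => _/posnumP[e].
  have /eqaddoP/(_ e%:num)/(_ [gt0 of e%:num]) := diff_locally df.
  apply: filter_app.
  have fg0 : \forall h \near (0 : V), f (h + x) = g (h + x).
    by move: fg; rewrite (near_shift 0) /=; apply: filterS => h /=; rewrite subr0.
  move: fg0; apply: filterS => h fgh.
  rewrite !fctE /= /cst -fx; apply: le_trans.
  by rewrite -fgh.
have Ed := diff_unique (diff_continuous df) E.
split=> //; apply/diff_locallyP; rewrite Ed; split=> //.
exact: diff_continuous.
Qed.

Lemma Cn_ext k V W (O : set V) (f g : V -> W) : open O ->
  (forall x, O x -> f x = g x) -> Cn k O f -> Cn k O g.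
Proof.
move=> oO; elim: k f g => [|k IH] f g fg /= [df Df];
  have nfg x : O x -> \near x, f x = g x by
    move=> Ox; near=> y; apply: fg; near: y; exact: open_nbhs_nbhs.
  by split=> // x Ox; apply: (near_eq_diff (nfg x Ox) (df x Ox)).1.
split; first by move=> x Ox; apply: (near_eq_diff (nfg x Ox) (df x Ox)).1.
move=> v; apply: IH (Df v) => x Ox; apply: near_eq_derive; exact: nfg.
Unshelve. all: by end_near. Qed.

Lemma CnW k V W (O : set V) (f : V -> W) : Cn k.+1 O f -> Cn k O f.
Proof.
elim: k f => [|k IH] f [df Df]; first by split.
by split=> // v; apply: IH; exact: Df.
Qed.

Lemma Cn_cst k V W (O : set V) (c : W) : Cn k O (fun=> c).
Proof.
elim: k c => [|k IH] c /=; split=> //; try by move=> x _; exact: differentiable_cst.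
move=> v; rewrite (_ : 'D_v _ = fun=> 0); first exact: IH.
by apply/funext => x; rewrite derive_cst.
Qed.

Lemma Cn_linear k V W (O : set V) (L : {linear V -> W}) :
  continuous L -> Cn k O L.
Proof.
move=> cL; have dL x : differentiable L x by exact: linear_differentiable.
case: k => [|k]; split=> // v.
rewrite (_ : 'D_v _ = fun=> L v); first exact: Cn_cst.
by apply/funext => x; rewrite deriveE// diff_lin.
Qed.

Lemma CnD k V W (O : set V) (f g : V -> W) : open O ->
  Cn k O f -> Cn k O g -> Cn k O (fun x => f x + g x).
Proof.
move=> oO; elim: k f g => [|k IH] f g [df Df] [dg Dg]; split=> //;
  try by move=> x Ox; apply: differentiableD; [exact: df|exact: dg].
move=> v; apply: Cn_ext (IH _ _ (Df v) (Dg v)) => // x Ox.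
by rewrite [RHS](@deriveD _ _ _ f g)//; apply: diff_derivable; [exact: df|exact: dg].
Qed.

Lemma Cn_linear_comp k U V W (O : set U) (f : U -> V) (L : {linear V -> W}) :
  open O -> continuous L -> Cn k O f -> Cn k O (fun x => L (f x)).
Proof.
move=> oO cL; have dL x : differentiable L x by exact: linear_differentiable.
elim: k f => [|k IH] f [df Df]; split=> //;
  try by move=> x Ox; apply: (@differentiable_comp _ _ _ _ f L) => //; exact: df.
move=> v; apply: Cn_ext (IH _ (Df v)) => // x Ox.
rewrite [RHS](@deriveE _ _ _ (L \o f)); last first.
  by apply: differentiable_comp => //; exact: df.
by rewrite diff_comp//= ?diff_lin// ?deriveE//; exact: df.
Qed.

(** Registering the scaling as bilinear makes the general rule for the
    differential of a bilinear map apply to products [f x *: g x]. *)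
Lemma scale_is_bilinear V : bilinear_for
    (GRing.Scale.Law.clone _ _ *:%R _) (GRing.Scale.Law.clone _ _ *:%R _)
    (@GRing.scale R V).
Proof.
split=> [u'|u] a x y /=.
- by rewrite scalerDl scalerA.
- by rewrite scalerDr !scalerA mulrC.
Qed.
HB.instance Definition _ V :=
  bilinear_isBilinear.Build R R V V _ _ (@GRing.scale R V) (scale_is_bilinear V).

Lemma is_diff_scale V W (f : V -> R) (g : V -> W) x :
  differentiable f x -> differentiable g x ->
  is_diff x (fun y => f y *: g y) (fun v => 'd f x v *: g x + f x *: 'd g x v).
Proof.
move=> df dg.
have c : continuous (fun p : R * W => p.1 *: p.2) by exact: scale_continuous.
have dp := differentiable_pair df dg.
have ds := @differentiable_bilin _ _ _ _ (@GRing.scale R W) (f x, g x) c.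
have E : (fun y => f y *: g y) = (fun p : R * W => p.1 *: p.2) \o (fun y => (f y, g y)) by [].
rewrite E; apply: DiffDef; first exact: differentiable_comp.
rewrite diff_comp// (@diff_bilin _ _ _ _ (@GRing.scale R W))// diff_pair//.
by apply/funext => v /=; rewrite addrC.
Qed.

Lemma CnZ k V W (O : set V) (f : V -> R) (g : V -> W) : open O ->
  Cn k O f -> Cn k O g -> Cn k O (fun x => f x *: g x).
Proof.
move=> oO; elim: k f g => [|k IH] f g Cf Cg.
  have [[df _] [dg _]] := (Cf, Cg); split=> // x Ox.
  by have := is_diff_scale (df x Ox) (dg x Ox); case.
have [[df Df] [dg Dg]] := (Cf, Cg).
have H x (Ox : O x) := is_diff_scale (df x Ox) (dg x Ox).
split; first by move=> x /H[].
move=> v.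
apply: (@Cn_ext _ _ _ _ (fun x => 'D_v f x *: g x + f x *: 'D_v g x)) => //.
  move=> x Ox; rewrite [RHS]deriveE; last by case: (H x Ox).
  by case: (H x Ox) => _ ->; rewrite (deriveE _ (df x Ox)) (deriveE _ (dg x Ox)).
by apply: CnD => //; apply: IH; first [exact: Df|exact: Dg|exact: CnW].
Qed.

Lemma Cn_sum k V W (O : set V) (I : Type) (r : seq I) (P : pred I) (f : I -> V -> W) : open O ->
  (forall i, Cn k O (f i)) -> Cn k O (fun x => \sum_(i <- r | P i) f i x).
Proof.
move=> oO Cf; elim: r => [|i r IH].
  by apply: Cn_ext (Cn_cst k O 0) => // x _; rewrite big_nil.
case Pi: (P i).
  by apply: Cn_ext (CnD oO (Cf i) IH) => // x _; rewrite big_cons Pi.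
by apply: Cn_ext IH => // x _; rewrite big_cons Pi.
Qed.

Lemma cvg_sumr (T : Type) (F : set_system T) {FF : Filter F} V (I : Type)
    (r : seq I) (f : I -> T -> V) (a : I -> V) :
  (forall i, f i x @[x --> F] --> a i) ->
  (\sum_(i <- r) f i x) @[x --> F] --> \sum_(i <- r) a i.
Proof.
move=> fa; elim: r => [|i r IH].
  by rewrite big_nil; under eq_fun do rewrite big_nil; exact: cvg_cst.
rewrite big_cons; under eq_fun do rewrite big_cons.
exact: cvgD.
Qed.

(** Coordinates with values in [R], taken continuous: this covers row vectors,
    matrices, [R] and products alike, and the state spaces of all the auxiliary
    flows below are such products. *)
Definition findim V := exists (n : nat) (e : 'I_n -> V) (c : 'I_n -> {linear V -> R}),
  (forall i, continuous (c i)) /\ (forall v, v = \sum_i c i v *: e i).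

Lemma findim_linear_continuous V W (L : {linear V -> W}) : findim V -> continuous L.
Proof.
move=> [n [e [c [cc ce]]]].
have -> : (L : V -> W) = fun v => \sum_i c i v *: L (e i).
  by apply/funext => v; rewrite {1}(ce v) linear_sum; apply: eq_bigr => i _; rewrite linearZ.
move=> x; apply: cvg_sumr => i; apply: cvgZr_tmp.
exact: cc.
Qed.

Lemma diff_coords V W n (e : 'I_n -> V) (c : 'I_n -> {linear V -> R}) (f : V -> W) x v :
  (forall v, v = \sum_i c i v *: e i) -> differentiable f x ->
  'd f x v = \sum_i c i v *: 'D_(e i) f x.
Proof.
move=> ce df; rewrite {1}(ce v) linear_sum; apply: eq_bigr => i _.
by rewrite linearZ deriveE.
Qed.

Lemma Cn_comp k U V W (O : set U) (Q : set V) (f : U -> V) (g : V -> W) :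
  findim V -> open O -> (forall x, O x -> Q (f x)) ->
  Cn k O f -> Cn k Q g -> Cn k O (fun x => g (f x)).
Proof.
move=> [n [e [c [cc ce]]]] oO OQ; elim: k g => [|k IH] g Cf Cg.
  split=> // x Ox; apply: (@differentiable_comp _ _ _ _ f g).
    exact: Cn_diff Cf Ox.
  exact: Cn_diff Cg (OQ _ Ox).
have dfx x (Ox : O x) := Cn_diff Cf Ox.
have dgx x (Ox : O x) := Cn_diff Cg (OQ _ Ox).
split; first by move=> x Ox; apply: (@differentiable_comp _ _ _ _ f g); auto.
move=> v; apply: (@Cn_ext _ _ _ _ (fun x => \sum_i c i ('D_v f x) *: 'D_(e i) g (f x))) => //.
  move=> x Ox; rewrite [RHS](@deriveE _ _ _ (g \o f)); last first.
    by apply: differentiable_comp; auto.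
  rewrite diff_comp//=; [|by auto|by auto].
  by rewrite (diff_coords _ ce (dgx x Ox)) deriveE//; exact: dfx.
apply: Cn_sum => [//|i]; apply: CnZ => //.
  have CDf : Cn k O ('D_v f) by case: Cf => _ Df; exact: Df.
  have := @Cn_linear_comp k U V R O ('D_v f) (c i) oO (cc i) CDf.
  exact.
by apply: (IH ('D_(e i) g)); [exact: CnW|case: Cg => _ Dg; exact: Dg].
Qed.

End SmoothCalculus.

(** * Finite-dimensional spaces and the mean value inequality *)

Section FiniteDimension.
Context {R : realType}.
Implicit Types U V W : normedModType R.

Lemma findim_R : findim (R : normedModType R).
Proof.
exists 1%N, (fun=> 1), (fun=> idfun); split; first by move=> _ x.
by move=> v; rewrite big_ord1 /= -[RHS]/(v * 1) mulr1.
Qed.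

(** A named constant for the coordinate maps, to carry their linear structure. *)
Definition rv_coord n (i : 'I_n) (v : 'rV[R]_n) : R := v 0 i.
Lemma rv_coord_linear n (i : 'I_n) : linear (rv_coord i).
Proof. by move=> a u v; rewrite /rv_coord !mxE. Qed.
HB.instance Definition _ n (i : 'I_n) :=
  GRing.isLinear.Build _ _ _ _ (rv_coord i) (@rv_coord_linear n i).

Lemma findim_rV n : findim ('rV[R]_n : normedModType R).
Proof.
exists n, (fun i => delta_mx 0 i), (fun i => rv_coord i).
split; first by move=> i; exact: coord_continuous.
by move=> v; exact: row_sum_delta.
Qed.

Lemma findim_mx m n : findim ('M[R]_(m, n) : normedModType R).
Proof.
pose c (k : 'I_(m * n)) : {linear 'M[R]_(m, n) -> R} := rv_coord k \o mxvec.
exists (m * n)%N, (fun k => vec_mx (delta_mx 0 k)), c.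
split.
  move=> k; case/mxvec_indexP: k => i j.
  have -> : (c (mxvec_index i j) : _ -> _) = (fun M : 'M[R]_(m, n) => M i j).
    by apply/funext => M; rewrite /c /= /rv_coord mxvecE.
  exact: coord_continuous.
move=> M; apply: (can_inj mxvecK); rewrite linear_sum [LHS]row_sum_delta.
by apply: eq_bigr => k _; rewrite linearZ /= vec_mxK.
Qed.

Lemma findim_prod V W : findim V -> findim W -> findim (V * W)%type.
Proof.
move=> [n [e [c [cc ce]]]] [m [e' [c' [cc' ce']]]].
exists (n + m)%N, (fun k : 'I_(n + m) => match fintype.split k return (V * W)%type with
  inl i => (e i, 0) | inr j => (0, e' j) end).
exists (fun k : 'I_(n + m) => match fintype.split k return {linear (V * W)%type -> R} with
  inl i => c i \o fst | inr j => c' j \o snd end).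
split.
  move=> k; case: (fintype.split k) => i x; apply: continuous_comp.
  - exact: cvg_fst.
  - exact: cc.
  - exact: cvg_snd.
  - exact: cc'.
move=> [v w]; rewrite big_split_ord /=.
under eq_bigr => i _ do rewrite (unsplitK (inl i)) /=.
under [X in _ + X]eq_bigr => i _ do rewrite (unsplitK (inr i)) /=.
rewrite {1}(ce v) {1}(ce' w).
have -> : \sum_i c i v *: ((e i, 0) : V * W) = (\sum_i c i v *: e i, 0).
  rewrite [LHS]surjective_pairing !raddf_sum; congr (_, _).
  by rewrite big1 // => i _; rewrite /= scaler0.
have -> : \sum_i c' i w *: ((0, e' i) : V * W) = (0, \sum_i c' i w *: e' i).
  rewrite [LHS]surjective_pairing !raddf_sum; congr (_, _).
  by rewrite big1 // => i _; rewrite /= scaler0.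
rewrite -[RHS]/(_ + _, _ + _).
by congr (_, _); rewrite /= ?addr0 ?add0r.
Qed.

Lemma compact_norm_bound (T : topologicalType) V (K : set T) (f : T -> V) :
  compact K -> (forall x, K x -> {for x, continuous f}) ->
  exists2 M, 0 < M & forall x, K x -> `|f x| <= M.
Proof.
move=> cK cf.
have : compact (f @` K).
  by apply: continuous_compact => //; apply: continuous_in_subspaceT => x /set_mem /cf.
move=> /compact_bounded [M [Mr bM]].
exists (`|M| + 1); first by rewrite ltr_wpDl.
move=> x Kx; apply: (bM (`|M| + 1)); last by exists x.
by rewrite (le_lt_trans (ler_norm _)) // ltrDl.
Qed.

Lemma coord_bounds V n (c : 'I_n -> {linear V -> R}) : (forall i, continuous (c i)) ->
  exists k : 'I_n -> R, forall i, 0 < k i /\ forall x, `|c i x| <= k i * `|x|.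
Proof.
move=> cc.
have /choice[k kP] : forall i, exists k : R, 0 < k /\ forall x, `|c i x| <= k * `|x|.
  by move=> i; have [k k0 kP] := linear_lipschitz (cc i); exists k.
by exists k.
Qed.

Lemma findim_ball_compact V (r : R) : findim V -> compact [set x : V | `|x| <= r].
Proof.
move=> [n [e [c [cc ce]]]].
have [k kP] := coord_bounds cc.
pose A := [set a : 'rV[R]_n | forall i, a ord0 i \in `[(- (k i * `|r|)), k i * `|r|]].
pose F := fun a : 'rV[R]_n => \sum_i a 0 i *: e i.
have cA : compact (F @` A).
  apply: continuous_compact.
    apply: continuous_subspaceT => x; apply: (@cvg_sumr _ _ (nbhs x) (nbhs_filter x)) => i.
    by apply: cvgZr_tmp; exact: coord_continuous.
  apply: (@rV_compact R n (fun i => `[(- (k i * `|r|)), k i * `|r|]%classic)) => i.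
  exact: segment_compact.
apply: subclosed_compact cA _.
  have -> : [set x : V | `|x| <= r] = (@Num.norm _ V) @^-1` [set y | y <= r] by [].
  by apply: preimage_closed (@closed_le _ r) => x _; exact: norm_continuous.
move=> x /= xr; exists (\row_i c i x); last first.
  by rewrite [RHS]ce; apply: eq_bigr => i _; rewrite mxE.
move=> i; rewrite mxE in_itv /= -ler_norml.
apply: (le_trans ((kP i).2 x)); rewrite ler_pM2l ?(kP i).1//.
by rewrite (le_trans xr)// ler_norm.
Qed.

Lemma linear_is_diff (V W : normedModType R) (L : {linear V -> W}) x :
  findim V -> is_diff x L L.
Proof.
move=> fV; have cL := @findim_linear_continuous _ _ _ L fV.
by apply: DiffDef; [exact: linear_differentiable|exact: diff_lin].
Qed.

Lemma mean_value_direction (V : normedModType R) (f : V -> R) x v :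
  (forall t : R, 0 <= t <= 1 -> differentiable f (x + t *: v)) ->
  exists2 t : R, 0 <= t <= 1 & f (x + v) - f x = 'd f (x + t *: v) v.
Proof.
move=> df.
pose g := fun t : R => f (x + t *: v).
have dg (t : R) : 0 <= t <= 1 -> is_derive t 1 g ('d f (x + t *: v) v).
  move=> t01.
  have d1 : is_diff t (fun t : R => x + t *: v) (fun t => t *: v).
    have -> : (fun t : R => x + t *: v) = cst x + ( *:%R^~ v) by [].
    by apply: is_diff_eq; rewrite add0r.
  have d2 : is_diff (x + t *: v) f ('d f (x + t *: v)).
    by apply: differentiableP; exact: df.
  have d4 : is_diff t g ('d f (x + t *: v) \o (fun t => t *: v)).
    exact: (is_diff_comp d1 d2).
  apply: DeriveDef; first by apply: diff_derivable; exact: ex_diff.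
  by rewrite deriveE; [rewrite diff_val /= scale1r|exact: ex_diff].
have [t t01 E] : exists2 t, t \in `[0, 1]%R &
    g 1 - g 0 = 'd f (x + t *: v) v * (1 - 0).
  apply: (@MVT_segment R g (fun t => 'd f (x + t *: v) v)); first exact: ler01.
    by move=> t; rewrite in_itv /= => /andP[t0 t1]; apply: dg; rewrite !ltW.
  apply: continuous_in_subspaceT => t /set_mem /=; rewrite in_itv /= => t01.
  apply: differentiable_continuous; apply/derivable1_diffP.
  by have [] := dg t t01.
exists t; first by move: t01; rewrite in_itv.
by move: E; rewrite subr0 mulr1 /g scale1r scale0r addr0.
Qed.

(** The mean value theorem holds for each coordinate, at a point depending on
    it. Recombining the coordinates costs a constant [C] that depends only on
    the target space, so the estimate remains uniform in [f]. *)
Lemma mean_value_inequality W : findim W ->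
  exists2 C, 0 < C & forall V (f : V -> W) x v M,
    (forall t : R, 0 <= t <= 1 -> differentiable f (x + t *: v)) ->
    (forall t : R, 0 <= t <= 1 -> `|'d f (x + t *: v) v| <= M) ->
    `|f (x + v) - f x| <= C * M.
Proof.
move=> fW; have [n [e [c [cc ce]]]] := fW.
have [k kP] := coord_bounds cc.
exists (\sum_i k i * `|e i| + 1).
  rewrite ltr_wpDl// sumr_ge0// => i _.
  by rewrite mulr_ge0// ltW// (kP i).1.
move=> V f x v M df Mf.
have M0 : 0 <= M by apply: le_trans (Mf 0 _); rewrite // lexx ler01.
have ci i : `|c i (f (x + v) - f x)| <= k i * M.
  have dc (t : R) : 0 <= t <= 1 -> is_diff (x + t *: v) (c i \o f) (c i \o 'd f (x + t *: v)).
    move=> t01; apply: is_diff_comp; first exact: differentiableP (df t t01).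
    exact: linear_is_diff.
  have [t t01 E] : exists2 t : R, 0 <= t <= 1 &
      (c i \o f) (x + v) - (c i \o f) x = 'd (c i \o f) (x + t *: v) v.
    by apply: mean_value_direction => t t01; case: (dc t t01).
  have -> : c i (f (x + v) - f x) = c i ('d f (x + t *: v) v).
    by rewrite linearB [LHS]E; case: (dc t t01) => _ ->.
  by rewrite (le_trans ((kP i).2 _))// ler_pM2l ?(kP i).1//; exact: Mf.
rewrite [X in `|X|]ce (le_trans (ler_norm_sum _ _ _))//.
rewrite mulrDl mul1r mulr_suml ler_wpDr//; apply: ler_sum => i _.
by rewrite normrZ mulrAC ler_wpM2r.
Qed.

Lemma is_diff_remainder V W (f : V -> W) x y : differentiable f x -> differentiable f y ->
  is_diff y (fun z => f z - 'd f x (z - x)) (fun u => 'd f y u - 'd f x u).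
Proof.
move=> dfx dfy.
have cd : continuous ('d f x) := diff_continuous dfx.
have d1 : is_diff y (fun z : V => z - x) id.
  rewrite (_ : (fun z : V => z - x) = id - cst x)//.
  by apply: is_diff_eq; rewrite subr0.
have d2 : is_diff (y - x) ('d f x : V -> W) ('d f x).
  by apply: DiffDef; [exact: linear_differentiable|exact: diff_lin].
exact: (is_diffB (differentiableP dfy) (is_diff_comp d1 d2)).
Qed.

End FiniteDimension.

(** * Uniform bounds on compact convex sets, and the tangent map *)

Section CompactBounds.
Context {R : realType}.
Implicit Types U V W : normedModType R.

Lemma Cn_continuous k V W (O : set V) (f : V -> W) x :
  Cn k O f -> O x -> {for x, continuous f}.
Proof. by move=> Cf Ox; apply: differentiable_continuous; exact: Cn_diff Cf Ox. Qed.

Lemma diff_bound V W (O K : set V) (f : V -> W) : findim V ->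
  Cn 1 O f -> K `<=` O -> compact K ->
  exists2 M, 0 < M & forall x v, K x -> `|'d f x v| <= M * `|v|.
Proof.
move=> [n [e [c [cc ce]]]] Cf KO cK.
have [k kP] := coord_bounds cc.
have /choice[m mP] : forall i, exists m : R, 0 < m /\ forall x, K x -> `|'D_(e i) f x| <= m.
  move=> i; have [|m m0 mP] := @compact_norm_bound _ _ _ K ('D_(e i) f) cK.
    by move=> x /KO Ox; case: Cf => _ /(_ (e i)) Df; exact: (@Cn_continuous 0 _ _ O _ x Df Ox).
  by exists m.
exists (\sum_i k i * m i + 1).
  rewrite ltr_wpDl// sumr_ge0// => i _.
  by rewrite mulr_ge0// ltW// ?(kP i).1 ?(mP i).1.
move=> x v Kx; rewrite (diff_coords _ ce (Cn_diff Cf (KO _ Kx))).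
rewrite (le_trans (ler_norm_sum _ _ _))// mulrDl mul1r mulr_suml ler_wpDr//.
apply: ler_sum => i _; rewrite normrZ mulrAC.
by apply: ler_pM => //; [exact: (kP i).2|exact: (mP i).2].
Qed.

Definition convex_set V (K : set V) := forall x y (t : R), K x -> K y ->
  0 <= t <= 1 -> K (x + t *: (y - x)).

Lemma open_setXT U V (O : set U) : open O -> open (O `*` [set: V]).
Proof.
move=> oO; have -> : O `*` [set: V] = fst @^-1` O by apply/seteqP; split=> x //= [].
by apply: open_comp => // x _; exact: cvg_fst.
Qed.

Lemma open_setX U V (A : set U) (B : set V) : open A -> open B -> open (A `*` B).
Proof.
move=> oA oB; have -> : A `*` B = (fst @^-1` A) `&` (snd @^-1` B) by [].
apply: openI; apply: open_comp => // x _; [exact: cvg_fst|exact: cvg_snd].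
Qed.

Lemma convex_setX U V (A : set U) (B : set V) :
  convex_set A -> convex_set B -> convex_set (A `*` B).
Proof.
by move=> cA cB [x y] [x' y'] t [/= Ax By] [/= Ax' By'] t01; split; [exact: cA|exact: cB].
Qed.

Lemma convex_norm_ball V (r : R) : convex_set [set v : V | `|v| <= r].
Proof.
move=> v v' t /= vM vM' /andP[t0 t1].
have -> : v + t *: (v' - v) = (1 - t) *: v + t *: v'.
  by rewrite scalerBr scalerBl scale1r addrA addrAC.
rewrite (le_trans (ler_normD _ _))// !normrZ !ger0_norm ?subr_ge0//.
have : t * `|v'| <= t * r by exact: ler_wpM2l.
have : (1 - t) * `|v| <= (1 - t) * r by rewrite ler_wpM2l ?subr_ge0.
lra.
Qed.

Lemma ball_norm_succ V (v : V) : ball 0 (`|v| + 1) v.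
Proof. by rewrite -ball_normE /= sub0r normrN ltrDl. Qed.

Lemma lipschitz_on_compact V W (O K : set V) (f : V -> W) :
  findim V -> findim W -> Cn 1 O f -> K `<=` O -> compact K -> convex_set K ->
  exists2 L, 0 < L & forall x y, K x -> K y -> `|f y - f x| <= L * `|y - x|.
Proof.
move=> fV fW Cf KO cK xK.
have [M M0 MP] := diff_bound fV Cf KO cK.
have [C C0 CP] := mean_value_inequality fW.
exists (C * M); first exact: mulr_gt0.
move=> x y Kx Ky; rewrite -[in f y](subrKC x y) -mulrA; apply: CP => t t01.
  by apply: Cn_diff Cf _; apply: KO; exact: xK.
by apply: MP; exact: xK.
Qed.

(** The joint map (x, v) |-> df_x v loses one order only: in coordinates it is
    a sum of products of the linear coordinates of v with partial derivatives. *)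
Lemma Cn_tangent k V W (O : set V) (f : V -> W) : findim V -> open O ->
  Cn k.+1 O f -> Cn k (O `*` [set: V]) (fun p => 'd f (p.1) p.2).
Proof.
move=> fV oO Cf; have [n [e [c [cc ce]]]] := fV.
have oOT : open (O `*` [set: V]) by exact: open_setXT.
apply: (@Cn_ext _ k _ _ _ (fun p => \sum_i c i p.2 *: 'D_(e i) f p.1)) => //.
  by move=> [x v] [/= Ox _]; rewrite (diff_coords _ ce (Cn_diff Cf Ox)).
apply: Cn_sum => // i; apply: CnZ => //.
  apply: (@Cn_linear _ k _ _ _ (c i \o snd)) => x.
  by apply: continuous_comp; [exact: cvg_snd|exact: cc].
apply: (@Cn_comp _ k _ _ _ (O `*` setT) O fst ('D_(e i) f)) => //.
- by move=> x [].
- by apply: (@Cn_linear _ k _ _ _ fst) => x; exact: cvg_fst.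
- by case: Cf => _ Df; exact: Df.
Qed.

Lemma Cn_pair k V W W' (O : set V) (f : V -> W) (g : V -> W') : open O ->
  Cn k O f -> Cn k O g -> Cn k O (fun x => (f x, g x)).
Proof.
move=> oO; elim: k f g => [|k IH] f g [df Df] [dg Dg]; split=> //;
  try by move=> x Ox; apply: differentiable_pair; [exact: df|exact: dg].
move=> v; apply: Cn_ext (IH _ _ (Df v) (Dg v)) => // x Ox.
have [dfx dgx] := (df x Ox, dg x Ox).
rewrite [RHS]deriveE; last exact: differentiable_pair.
by rewrite diff_pair//= !deriveE.
Qed.

Lemma smooth_tangent V W (O : set V) (f : V -> W) : findim V -> open O ->
  smooth O f -> smooth (O `*` [set: V]) (fun p => 'd f (p.1) p.2).
Proof. by move=> fV oO /smoothP sf; apply/smoothP => k; exact: Cn_tangent. Qed.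

End CompactBounds.

(** * Dyadic steps and the discrete Gronwall inequality *)

Section Gronwall.
Context {R : realType}.

(** Halving the steps makes the subdivisions nested. *)
Definition dyad (k : nat) : R := 2^-1 ^+ k.
Lemma dyad_gt0 k : 0 < dyad k. Proof. by rewrite exprn_gt0. Qed.
Lemma dyadS k : dyad k.+1 = dyad k / 2. Proof. by rewrite /dyad exprSr. Qed.
Lemma dyadM k : (2 ^ k)%N%:R * dyad k = 1.
Proof. by rewrite natrX /dyad -exprMn divff // expr1n. Qed.

Lemma cvg_dyad : dyad k @[k --> \oo] --> (0 : R).
Proof.
apply: cvg_expr; rewrite ger0_norm ?invr_ge0//.
by rewrite invf_lt1// ltr1n.
Qed.

Lemma euler_growth k j (L : R) : 0 <= L -> (j <= 2 ^ k)%N ->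
  (1 + dyad k * L) ^+ j <= expR L.
Proof.
move=> L0 jk; have h0 := ltW (dyad_gt0 k).
have hL : 0 <= dyad k * L by exact: mulr_ge0.
rewrite (@le_trans _ _ (expR (dyad k * L) ^+ j))//.
  by rewrite lerXn2r// ?nnegrE ?addr_ge0 ?expR_ge0// expR_ge1Dx.
have jh : j%:R * dyad k <= 1 by rewrite -[leRHS](dyadM k) ler_wpM2r// ler_nat.
by rewrite -expRM_natl ler_expR mulrA -[leRHS]mul1r ler_wpM2r.
Qed.

Lemma discrete_gronwall n (d : nat -> R) (a c : R) : 0 <= a -> 0 <= c ->
  (forall j, (j < n)%N -> d j.+1 <= (1 + a) * d j + c) ->
  forall j, (j <= n)%N -> d j <= (1 + a) ^+ j * (d 0%N + j%:R * c).
Proof.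
move=> a0 c0 dS; elim=> [|j IH] jn; first by rewrite expr0 !mul1r mul0r addr0.
apply: (le_trans (dS j jn)).
have a1 : 0 <= 1 + a by rewrite addr_ge0.
have /(ler_wpM2l a1) := IH (ltnW jn); rewrite mulrA -exprS => H.
have -> : (1 + a) ^+ j.+1 * (d 0%N + j.+1%:R * c) =
    (1 + a) ^+ j.+1 * (d 0%N + j%:R * c) + (1 + a) ^+ j.+1 * c.
  by rewrite -natr1; ring.
by rewrite lerD// ler_peMl// exprn_ege1// lerDl.
Qed.

End Gronwall.

(** * Euler polygons of a vector field *)

Section EulerFlow.
Context {R : realType}.
Implicit Types U V W : normedModType R.

Definition euler V (Z : V -> V) (h : R) (x : V) : V := x + h *: Z x.
Definition euler_iter V (Z : V -> V) (k j : nat) (x : V) : V :=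
  iter j (euler Z (dyad k)) x.
(** The flow of [Z] at time 1, as the limit of Euler polygons with [2 ^ k]
    steps. A flow at time t is obtained from it by rescaling the field. *)
Definition time1 V (Z : V -> V) (x : V) : V :=
  lim (euler_iter Z k (2 ^ k)%N x @[k --> \oo]).

(** All estimates on Euler polygons are uniform in the step because the
    polygons starting in [W] remain in a compact convex part [K] of the domain
    of [Z]: on [K] the field is bounded and Lipschitz. *)
Record flow_dom V (Z : V -> V) (O K W : set V) : Prop := FlowDom {
  fd_open : open O;
  fd_smooth : smooth O Z;
  fd_sub : K `<=` O;
  fd_compact : compact K;
  fd_convex : convex_set K;
  fd_openW : open W;
  fd_confined : forall k j x, (j <= 2 ^ k)%N -> W x -> K (euler_iter Z k j x) }.

(** Geometrically small increments are summable; [u] is compared with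
    [2 * C * dyad k], which bounds the tail of the increments. *)
Lemma dyadic_cauchy_cvg (u : nat -> R) (C : R) :
  (forall k, `|u k.+1 - u k| <= C * dyad k) -> cvg (u k @[k --> \oo]).
Proof.
move=> uC.
have C0 : 0 <= C by rewrite -(pmulr_lge0 _ (dyad_gt0 0)); apply: le_trans (uC 0%N).
have cd : (2 * C * dyad k) @[k --> \oo] --> (0 : R).
  rewrite -[X in _ --> X](mulr0 (2 * C)).
  by apply: cvgM; [exact: cvg_cst|exact: cvg_dyad].
have uk k : u k <= u 0%N + 2 * C * (1 - dyad k).
  elim: k => [|k IH]; first by rewrite /dyad expr0 subrr mulr0 addr0.
  have := uC k; rewrite ler_norml => /andP[_ H].
  by rewrite dyadS; lra.
(* The sequence u k - 2 * C * dyad k is nondecreasing and bounded. *)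
have -> : u = (fun k => (u k - 2 * C * dyad k) + 2 * C * dyad k).
  by apply/funext => k; rewrite subrK.
apply: is_cvgD; last by apply/cvg_ex; exists 0.
apply: nondecreasing_is_cvgn.
  apply/nondecreasing_seqP => k; have := uC k; rewrite ler_norml => /andP[H _].
  by rewrite dyadS; lra.
exists (u 0%N + 2 * C) => _ [k _ <-].
have h0 := ltW (@dyad_gt0 R k); have := uk k; rewrite mulrBr.
have := mulr_ge0 C0 h0; lra.
Qed.

Lemma dyadic_cauchy_cvgV V (u : nat -> V) (C : R) : findim V ->
  (forall k, `|u k.+1 - u k| <= C * dyad k) -> cvg (u k @[k --> \oo]).
Proof.
move=> [n [e [c [cc ce]]]] uC.
have /choice[l lP] : forall i, exists l : R, c i (u k) @[k --> \oo] --> l.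
  move=> i; have [a a0 aP] := linear_lipschitz (cc i).
  apply/cvg_ex; apply: (@dyadic_cauchy_cvg _ (a * C)) => k.
  by rewrite -linearB (le_trans (aP _))// -mulrA ler_pM2l.
apply/cvg_ex; exists (\sum_i l i *: e i).
under eq_fun do rewrite (ce (u _)).
by apply: (@cvg_sumr _ _ \oo) => i; apply: cvgZr_tmp; exact: lP.
Qed.

Lemma euler_iterS V (Z : V -> V) k j x :
  euler_iter Z k j.+1 x = euler_iter Z k j x + dyad k *: Z (euler_iter Z k j x).
Proof. by []. Qed.

Section Domain.
Variables (V : normedModType R) (Z : V -> V) (O K W : set V).
Hypotheses (fV : findim V) (D : flow_dom Z O K W).

Let CZ k : Cn k O Z. Proof. by have /smoothP := fd_smooth D; exact. Qed.
Let KO := fd_sub D.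
Let cK := fd_compact D.

Lemma field_lipschitz : exists2 L, 0 < L &
  forall x y, K x -> K y -> `|Z y - Z x| <= L * `|y - x|.
Proof. exact: lipschitz_on_compact fV fV (CZ 1) KO cK (fd_convex D). Qed.

Lemma field_bound : exists2 M, 0 < M & forall x, K x -> `|Z x| <= M.
Proof.
by apply: compact_norm_bound => // x /KO Ox; exact: (@Cn_continuous _ 0 _ _ O).
Qed.

Lemma euler_iter_lipschitz : exists2 C, 0 < C &
  forall k j x y, (j <= 2 ^ k)%N -> W x -> W y ->
  `|euler_iter Z k j y - euler_iter Z k j x| <= C * `|y - x|.
Proof.
have [L L0 LP] := field_lipschitz.
exists (expR L); first exact: expR_gt0.
move=> k j x y jk Wx Wy.
pose d i := `|euler_iter Z k i y - euler_iter Z k i x|.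
have h0 := ltW (@dyad_gt0 R k).
have := @discrete_gronwall R (2 ^ k)%N d (dyad k * L) 0.
have hL : 0 <= dyad k * L by rewrite mulr_ge0// ltW.
move=> /(_ hL (lexx _)) H.
rewrite -/(d j) (le_trans (H _ _ jk))//.
  move=> i ik; rewrite addr0 /d !euler_iterS opprD addrACA -scalerBr.
  rewrite (le_trans (ler_normD _ _))// mulrDl mul1r lerD2l normrZ ger0_norm//.
  rewrite -mulrA ler_wpM2l// LP//; apply: (fd_confined D) => //; exact: ltnW.
by rewrite mulr0 addr0 /d /euler_iter /= ler_wpM2r// euler_growth// ltW.
Qed.

(** Halving the step changes one step of the polygon by a term of second order
    in the step; the [2 ^ k] terms accumulate, up to the Gronwall factor, to one
    of first order. *)
Lemma euler_cauchy : exists C, forall k x, W x ->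
  `|euler_iter Z k.+1 (2 ^ k.+1)%N x - euler_iter Z k (2 ^ k)%N x| <= C * dyad k.
Proof.
have [L L0 LP] := field_lipschitz.
have [M M0 MP] := field_bound.
exists (expR L * (L * M)) => k x Wx.
pose b i := euler_iter Z k.+1 i.*2 x.
pose a i := euler_iter Z k i x.
pose d i := `|b i - a i|.
have h0 := ltW (@dyad_gt0 R k).
have h1 := ltW (@dyad_gt0 R k.+1).
have hL : 0 <= dyad k * L by rewrite mulr_ge0// ltW.
have c0 : 0 <= dyad k ^+ 2 * (L * M) by rewrite !mulr_ge0// ?exprn_ge0// ltW.
have := @discrete_gronwall R (2 ^ k)%N d (dyad k * L) _ hL c0.
have -> : (2 ^ k.+1)%N = (2 ^ k).*2 by rewrite expnS mul2n.
move=> H; rewrite -/(b _) -/(a _) -/(d (2 ^ k)%N).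
apply: (le_trans (H _ _ (leqnn _))); last first.
  rewrite /d /b /a /euler_iter /= subrr normr0 add0r expr2.
  have -> : (2 ^ k)%:R * (dyad k * dyad k * (L * M)) = L * M * dyad k.
    by rewrite !mulrA dyadM; ring.
  rewrite mulrA ler_wpM2r// ler_wpM2r// ?euler_growth ?mulr_ge0// ltW//.
move=> i ik.
have Ki : K (a i) by apply: (fd_confined D) => //; exact: ltnW.
have i2 : (i.*2 < 2 ^ k.+1)%N by rewrite expnS mul2n ltn_double.
have Kb : K (b i) by apply: (fd_confined D) => //; exact: ltnW.
have Kb' : K (euler_iter Z k.+1 i.*2.+1 x) by apply: (fd_confined D).
pose b' := euler_iter Z k.+1 i.*2.+1 x.
have b'E : b' = b i + dyad k.+1 *: Z (b i) by [].
have bS : b i.+1 = b i + dyad k.+1 *: Z (b i) + dyad k.+1 *: Z b' by [].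
(* Two half steps from b i against one step from a i: the middle term
   propagates the former error, the last one is the new error. *)
have E : b i.+1 - a i.+1 = (b i - a i) + dyad k *: (Z (b i) - Z (a i))
     + dyad k.+1 *: (Z b' - Z (b i)).
  rewrite bS [a i.+1]euler_iterS -/(a i).
  have -> : dyad k *: (Z (b i) - Z (a i)) =
      dyad k.+1 *: Z (b i) + dyad k.+1 *: Z (b i) - dyad k *: Z (a i).
    by rewrite scalerBr -scalerDl dyadS -splitr.
  rewrite scalerBr; move: (_ *: _) (_ *: _) (_ *: _) => p q r.
  rewrite opprD !addrA [RHS](ACl (1*3*6*2*5*(4*7))) /=.
  by rewrite subrr addr0.
rewrite /d E (le_trans (ler_normD _ _))// lerD//.
  rewrite (le_trans (ler_normD _ _))// mulrDl mul1r lerD2l normrZ ger0_norm//.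
  by rewrite -mulrA ler_wpM2l// LP.
rewrite normrZ ger0_norm// dyadS expr2.
have : `|Z b' - Z (b i)| <= L * (dyad k * M).
  have bb : `|b' - b i| <= dyad k * M; last first.
    by apply: (le_trans (LP _ _ Kb Kb')); rewrite ler_pM2l.
  have -> : b' - b i = dyad k.+1 *: Z (b i) by rewrite addrC [b' in LHS]b'E addKr.
  rewrite normrZ ger0_norm//.
  by apply: ler_pM => //; [rewrite dyadS; lra|exact: MP].
move=> /(ler_wpM2l h0) H1.
by have := normr_ge0 (Z b' - Z (b i)); nra.
Qed.

End Domain.
End EulerFlow.

(** * The time-one map and its invariants *)

Section FlowLimit.
Context {R : realType}.
Implicit Types U V W : normedModType R.

Section Domain.
Variables (V : normedModType R) (Z : V -> V) (O K W : set V).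
Hypotheses (fV : findim V) (D : flow_dom Z O K W).

Lemma euler_cvg x : W x -> euler_iter Z k (2 ^ k)%N x @[k --> \oo] --> time1 Z x.
Proof.
move=> Wx; have [C CP] := euler_cauchy fV D.
by apply: (@dyadic_cauchy_cvgV _ _ _ C) => // k; exact: CP.
Qed.

Lemma time1_in x : W x -> K (time1 Z x).
Proof.
move=> Wx; apply: (@closed_cvg _ _ \oo _ (fun k => euler_iter Z k (2 ^ k)%N x) K) => //.
- by apply: compact_closed; [exact: norm_hausdorff|exact: fd_compact D].
- by apply: nearW => k; apply: (fd_confined D).
- exact: euler_cvg.
Qed.

(** Along the exact flow, |w|' <= C |w| would keep w at 0. For the polygons
    each step of length h adds an error of order h^2, so by Gronwall w is of
    order h at the end of the polygon, and vanishes in the limit. The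
    statement with an inequality, rather than dw(Z) = 0, is what allows
    invariants that hold only on the zero set of w. *)
Lemma time1_invariant V' (w : V -> V') (C : R) x : findim V' -> smooth O w ->
  0 <= C -> (forall y, K y -> `|'d w y (Z y)| <= C * `|w y|) ->
  W x -> w x = 0 -> w (time1 Z x) = 0.
Proof.
move=> fV' sw C0 CP Wx wx0.
have Cw k : Cn k O w by have /smoothP := sw; exact.
have KO := fd_sub D.
have [M M0 MP] := field_bound D.
have [B B0 BP] := mean_value_inequality fV'.
have fVV := findim_prod fV fV.
have CT : Cn 1 (O `*` [set: V]) (fun p : V * V => 'd w (p.1) p.2).
  by apply: Cn_tangent => //; exact: fd_open D.
pose KK := K `*` [set v : V | `|v| <= M].
have [L L0 LP] : exists2 L, 0 < L & forall p q, KK p -> KK q ->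
    `|'d w (q.1) q.2 - 'd w (p.1) p.2| <= L * `|q - p|.
  apply: (@lipschitz_on_compact _ _ _ (O `*` setT) KK
    (fun p : V * V => 'd w (p.1) p.2)) => //.
  - by move=> [y v] [/= Ky _]; split=> //; exact: KO.
  - apply: compact_setX; [exact: fd_compact D|exact: findim_ball_compact].
  - by apply: convex_setX; [exact: fd_convex D|exact: convex_norm_ball].
have step k j : (j < 2 ^ k)%N ->
    `|w (euler_iter Z k j.+1 x)| <= (1 + dyad k * C) * `|w (euler_iter Z k j x)|
       + dyad k ^+ 2 * (B * (L * M)).
  move=> jk; rewrite euler_iterS; set y := euler_iter Z k j x.
  have h0 := ltW (@dyad_gt0 R k).
  have Ky : K y by apply: (fd_confined D) => //; exact: ltnW.
  have Ky1 : K (y + dyad k *: Z y) by apply: (fd_confined D (j := j.+1)).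
  have Ks (t : R) : 0 <= t <= 1 -> K (y + t *: (dyad k *: Z y)).
    move=> t01; have := fd_convex D Ky Ky1 t01.
    by rewrite [_ + dyad k *: _ - _]addrC addKr.
  (* The remainder of the first-order expansion of w at y; its differential is
     small of the order of the step since dw is Lipschitz on compact sets. *)
  pose g z := w z - 'd w y (z - y).
  have dg (t : R) : 0 <= t <= 1 ->
     is_diff (y + t *: (dyad k *: Z y)) g (fun v => 'd w (y + t *: (dyad k *: Z y)) v - 'd w y v).
    by move=> /Ks Kt; apply: is_diff_remainder; apply: Cn_diff (Cw 0%N) (KO _ _).
  have Bg : `|g (y + dyad k *: Z y) - g y| <= B * (dyad k ^+ 2 * (L * M)).
    apply: BP => t t01; first by case: (dg t t01).
    case: (dg t t01) => _ ->.
    have Kt := Ks t t01; set q := y + t *: _ in Kt *.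
    have lz q' : 'd w q' (dyad k *: Z y) = dyad k *: 'd w q' (Z y) by rewrite linearZ.
    rewrite !lz -scalerBr normrZ ger0_norm// expr2 -mulrA ler_wpM2l//.
    have H := LP (y, Z y) (q, Z y) (conj Ky (MP y Ky)) (conj Kt (MP y Ky)).
    rewrite (le_trans H)// mulrCA ler_wpM2l ?(ltW L0)//.
    rewrite -[X in `|X|]/(_ - _, _ - _) /= subrr /q addrC addKr prod_normE /= normr0.
    rewrite ge_max mulr_ge0 ?(ltW M0)// andbT !normrZ.
    move: t01 => /andP[t0 t1]; rewrite !ger0_norm// -[leRHS]mul1r.
    by apply: ler_pM => //; [exact: mulr_ge0|apply: ler_wpM2l => //; exact: MP].
  have -> : w (y + dyad k *: Z y) =
     (g (y + dyad k *: Z y) - g y) + (w y + dyad k *: 'd w y (Z y)).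
    rewrite /g subrr linear0 subr0 [y + _ - y]addrC addKr linearZ /=.
    by rewrite addrA subrK subrK.
  rewrite (le_trans (ler_normD _ _))// addrC lerD//; last by rewrite mulrCA.
  rewrite (le_trans (ler_normD _ _))// mulrDl mul1r lerD2l normrZ ger0_norm//.
  by rewrite -mulrA ler_wpM2l// CP.
(* 2 ^ k steps, each with an error of order 4 ^- k. *)
pose A := expR C * (B * (L * M)).
have bound k : `|w (euler_iter Z k (2 ^ k)%N x)| <= A * dyad k.
  have h0 := ltW (@dyad_gt0 R k).
  have hC : 0 <= dyad k * C by exact: mulr_ge0.
  have c0 : 0 <= dyad k ^+ 2 * (B * (L * M)) by rewrite !mulr_ge0// ltW.
  have := @discrete_gronwall R (2 ^ k)%N (fun j => `|w (euler_iter Z k j x)|) _ _ hC c0 (step k).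
  move=> /(_ (2 ^ k)%N (leqnn _)) H; apply: (le_trans H).
  rewrite /euler_iter /= wx0 normr0 add0r expr2.
  have -> : (2 ^ k)%:R * (dyad k * dyad k * (B * (L * M))) = B * (L * M) * dyad k.
    by rewrite !mulrA dyadM; ring.
  rewrite /A -[leRHS]mulrA; apply: ler_wpM2r; last exact: euler_growth.
  by rewrite !mulr_ge0// ltW.
have c1 : w (euler_iter Z k (2 ^ k)%N x) @[k --> \oo] --> w (time1 Z x).
  apply: continuous_cvg; last exact: euler_cvg.
  exact: Cn_continuous (Cw 0%N) (KO _ (time1_in Wx)).
have c2 : w (euler_iter Z k (2 ^ k)%N x) @[k --> \oo] --> (0 : V').
  apply/cvgr0Pnorm_lt => e e0.
  have cA : (A * dyad k) @[k --> \oo] --> (0 : R).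
    by rewrite -[X in _ --> X](mulr0 A); apply: cvgM; [exact: cvg_cst|exact: cvg_dyad].
  near=> k; rewrite (le_lt_trans (bound k))// (le_lt_trans (ler_norm _))//.
  by near: k; exact: (cvgr0_norm_lt _ cA _ e0).
exact: (cvg_unique _ c1 c2).
Unshelve. all: by end_near. Qed.
End Domain.
End FlowLimit.

(** * Smoothness of the time-one map *)

Section FlowSmooth.
Context {R : realType}.
Implicit Types U V W : normedModType R.

(** The linearized system of [Z], as a field on the tangent bundle. *)
Definition tangent_field V (Z : V -> V) (p : V * V) : V * V :=
  (Z p.1, 'd Z (p.1) p.2).

Lemma smooth_tangent_field V (Z : V -> V) (O : set V) : findim V -> open O ->
  smooth O Z -> smooth (O `*` [set: V]) (tangent_field Z).
Proof.
move=> fV oO /smoothP sZ; apply/smoothP => k.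
apply: Cn_pair; [exact: open_setXT| |exact: Cn_tangent].
apply: (@Cn_comp _ k _ _ _ (O `*` setT) O fst Z) => //.
- exact: open_setXT.
- by move=> x [].
- by apply: (@Cn_linear _ k _ _ _ fst) => x; exact: cvg_fst.
Qed.

(** Differentiating an Euler step of [Z] gives an Euler step of the tangent
    field: the two constructions commute before passing to the limit. *)
Lemma euler_iter_tangent V (Z : V -> V) (O K W : set V) k j x :
  flow_dom Z O K W -> W x -> (j <= 2 ^ k)%N ->
  differentiable (euler_iter Z k j) x /\
  forall v, euler_iter (tangent_field Z) k j (x, v) =
            (euler_iter Z k j x, 'd (euler_iter Z k j) x v).
Proof.
move=> D Wx; elim: j => [|j IH] jk.
  have E : is_diff x (euler_iter Z k 0) id := is_diff_id x.
  by case: E => dE ->.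
have [dE TE] := IH (ltnW jk).
have Oj : O (euler_iter Z k j x) by apply: (fd_sub D); apply: (fd_confined D) => //; exact: ltnW.
have [sZ _] : Cn 0 O Z by have /smoothP := fd_smooth D; exact.
have dE' := differentiableP dE.
have dZ' := differentiableP (sZ _ Oj).
have E : is_diff x (euler_iter Z k j.+1) (fun v => 'd (euler_iter Z k j) x v
    + dyad k *: 'd Z (euler_iter Z k j x) ('d (euler_iter Z k j) x v)).
  exact: is_diffD dE' (is_diffZ (dyad k) (is_diff_comp dE' dZ')).
case: E => dE1 E1; split=> // v; rewrite E1.
by rewrite [LHS]/euler_iter iterS -/(euler_iter _ k j (x, v)) TE.
Qed.

(** The fibre part of a polygon of the tangent field solves a linear recursion,
    hence grows at most exponentially, and remains in a ball: the base domain
    need not be shrunk. *)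
Lemma tangent_flow_dom V (Z : V -> V) (O K W : set V) (rho : R) :
  findim V -> flow_dom Z O K W -> 0 < rho ->
  exists r, flow_dom (tangent_field Z) (O `*` [set: V])
     (K `*` [set v | `|v| <= r]) (W `*` ball 0 rho).
Proof.
move=> fV D r0.
have [M M0 MP] : exists2 M, 0 < M & forall x v, K x -> `|'d Z x v| <= M * `|v|.
  apply: (@diff_bound _ _ _ O) => //; [|exact: fd_sub D|exact: fd_compact D].
  by have /smoothP := fd_smooth D; exact.
exists (expR M * rho); split.
- by apply: open_setXT; exact: fd_open D.
- by apply: smooth_tangent_field => //; [exact: fd_open D|exact: fd_smooth D].
- by move=> [x v] [/= Kx _]; split=> //; exact: (fd_sub D).
- by apply: compact_setX; [exact: fd_compact D|exact: findim_ball_compact].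
- by apply: convex_setX; [exact: fd_convex D|exact: convex_norm_ball].
- apply: open_setX; [exact: fd_openW D|exact: ball_open].
move=> k j [x v] jk [/= Wx bv].
have h0 := ltW (@dyad_gt0 R k).
have fE i : (i <= 2 ^ k)%N ->
    (euler_iter (tangent_field Z) k i (x, v)).1 = euler_iter Z k i x.
  by move=> ik; have [_ ->] := euler_iter_tangent D Wx ik.
split; first by rewrite fE//; exact: (fd_confined D).
have hM : 0 <= dyad k * M by rewrite mulr_ge0// ltW.
pose d i := `|(euler_iter (tangent_field Z) k i (x, v)).2|.
have := @discrete_gronwall R (2 ^ k)%N d _ 0 hM (lexx _).
move=> H; rewrite /= -/(d j) (le_trans (H _ _ jk))//.
  move=> i ik; rewrite addr0 /d euler_iterS /=.
  rewrite (le_trans (ler_normD _ _))// mulrDl mul1r lerD2l normrZ ger0_norm//.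
  rewrite -mulrA ler_wpM2l// MP// fE//; last exact: ltnW.
  by apply: (fd_confined D) => //; exact: ltnW.
rewrite mulr0 addr0 /d /euler_iter /=.
move: bv; rewrite -ball_normE /= sub0r normrN => /ltW bv.
by apply: ler_pM; rewrite ?exprn_ge0 ?addr_ge0 ?euler_growth// ltW.
Qed.

(** The polygons of the tangent field converge, so the differentials of the
    polygons of [Z] converge. This limit is the differential of the limit
    because the polygons of the tangent field are Lipschitz uniformly in the
    step, which makes the Taylor remainders quadratic with a constant
    independent of the step. *)
Lemma time1_tangent V (Z : V -> V) (O K W : set V) x :
  findim V -> flow_dom Z O K W -> W x ->
  differentiable (time1 Z) x /\
  forall v, time1 (tangent_field Z) (x, v) = (time1 Z x, 'd (time1 Z) x v).
Proof.
move=> fV D Wx.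
have fVV := findim_prod fV fV.
pose E k := euler_iter Z k (2 ^ k)%N.
pose psi v := (time1 (tangent_field Z) (x, v)).2.
have dE k y : W y -> differentiable (E k) y.
  by move=> Wy; have [] := euler_iter_tangent D Wy (leqnn (2 ^ k)%N).
have TE k y v : W y ->
    euler_iter (tangent_field Z) k (2 ^ k)%N (y, v) = (E k y, 'd (E k) y v).
  by move=> Wy; have [] := euler_iter_tangent D Wy (leqnn (2 ^ k)%N).
have cT v : (E k x, 'd (E k) x v) @[k --> \oo] --> time1 (tangent_field Z) (x, v).
  have v1 : 0 < `|v| + 1 by rewrite ltr_wpDl.
  have [r Dr] := tangent_flow_dom fV D v1.
  under eq_fun do rewrite -TE//.
  apply: (euler_cvg fVV Dr); split=> //; exact: ball_norm_succ.
have cE : E k x @[k --> \oo] --> time1 Z x := euler_cvg fV D Wx.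
have T1 v : (time1 (tangent_field Z) (x, v)).1 = time1 Z x.
  have c1 : E k x @[k --> \oo] --> (time1 (tangent_field Z) (x, v)).1.
    exact: (cvg_comp _ _ (cT v) cvg_fst).
  exact: (cvg_unique _ c1 cE).
have cpsi v : 'd (E k) x v @[k --> \oo] --> psi v.
  exact: (cvg_comp _ _ (cT v) cvg_snd).
have psi_lin : linear psi.
  move=> a u v.
  have c1 : 'd (E k) x (a *: u + v) @[k --> \oo] --> a *: psi u + psi v.
    under eq_fun do rewrite linearP.
    by apply: cvgD => //; apply: cvgZl_tmp.
  exact: (cvg_unique _ (cpsi _) c1).
pose pL := GRing.isLinear.Build _ _ _ _ _ psi_lin.
pose Psi : {linear V -> V} := HB.pack psi pL.
have cPsi : continuous Psi by exact: findim_linear_continuous.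
have [r2 D2] := tangent_flow_dom fV D (ltr0n R 2).
have [L L0 LP] := euler_iter_lipschitz fVV D2.
have [B B0 BP] := mean_value_inequality fV.
have := fd_openW D; rewrite openE => /(_ x Wx) /nbhs_ballP[del /= del0 bW].
(* The Lipschitz estimate is available for v in a fixed ball only; it extends
   to all v by homogeneity. *)
have Dlip k y v : W y -> `|'d (E k) y v - 'd (E k) x v| <= L * `|y - x| * `|v|.
  move=> Wy; have [->|v0] := eqVneq v 0; first by rewrite !linear0 addr0 !normr0 mulr0.
  have nv0 : 0 < `|v| by rewrite normr_gt0.
  pose u := `|v|^-1 *: v.
  have vu : v = `|v| *: u by rewrite scalerA divff ?scale1r// gt_eqF.
  have u1 : `|u| = 1 by rewrite normrZ ger0_norm ?invr_ge0// mulVf// gt_eqF.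
  have ub : ball (0 : V) 2 u by rewrite -ball_normE /= sub0r normrN u1 ltr1n.
  have := LP k _ (x, u) (y, u) (leqnn _) (conj Wx ub) (conj Wy ub).
  rewrite !TE// => H.
  clearbody u.
  have lz q : 'd (E k) q (`|v| *: u) = `|v| *: 'd (E k) q u by rewrite linearZ.
  rewrite {1 2}vu !lz -scalerBr normrZ normr_id mulrC ler_pM2r//.
  have H1 : `|'d (E k) y u - 'd (E k) x u| <= `|(E k y, 'd (E k) y u) - (E k x, 'd (E k) x u)|.
    by rewrite [leRHS]prod_normE /= le_max lexx orbT.
  apply: (le_trans H1); apply: (le_trans H); rewrite ler_pM2l//.
  rewrite -[X in `|X|]/(_ - _, _ - _) prod_normE /= subrr normr0.
  by rewrite ge_max lexx normr_ge0.
(* A remainder quadratic in v, first for the polygons, then in the limit. *)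
have quad v : `|v| < del ->
    `|time1 Z (x + v) - time1 Z x - psi v| <= B * (L * `|v| * `|v|).
  move=> vd.
  have Wt (t : R) : 0 <= t <= 1 -> W (x + t *: v).
    move=> /andP[t0 t1]; apply: bW; rewrite -ball_normE /= opprD addNKr normrN normrZ.
    by rewrite ger0_norm// (le_lt_trans _ vd)// ler_piMl.
  have W1 : W (x + v) by have := Wt 1; rewrite scale1r; apply; rewrite lexx ler01.
  have ck : E k (x + v) - E k x - 'd (E k) x v @[k --> \oo] -->
      time1 Z (x + v) - time1 Z x - psi v.
    by apply: cvgB => //; apply: cvgB => //; exact: (euler_cvg fV D W1).
  have kb k : `|E k (x + v) - E k x - 'd (E k) x v| <= B * (L * `|v| * `|v|).
    pose g y := E k y - 'd (E k) x (y - x).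
    have -> : E k (x + v) - E k x - 'd (E k) x v = g (x + v) - g x.
      by rewrite /g subrr linear0 subr0 [x + v - x]addrC addKr addrAC.
    have dg y : W y -> is_diff y g (fun u => 'd (E k) y u - 'd (E k) x u).
      by move=> Wy; apply: is_diff_remainder; exact: dE.
    apply: BP => t t01; first by case: (dg _ (Wt t t01)).
    case: (dg _ (Wt t t01)) => _ ->.
    rewrite (le_trans (Dlip _ _ _ (Wt t t01)))// ler_wpM2r// ler_wpM2l ?(ltW L0)//.
    move: t01 => /andP[t0 t1].
    by rewrite addrC addKr normrZ ger0_norm// ler_piMl.
  have cn : `|E k (x + v) - E k x - 'd (E k) x v| @[k --> \oo] -->
      `|time1 Z (x + v) - time1 Z x - psi v| by exact: cvg_norm ck.
  by apply: (ler_cvg_to cn (cvg_cst _)); exact: nearW.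
have lit : time1 Z \o shift x = cst (time1 Z x) + Psi +o_ 0 id.
  apply/eqaddoP => _/posnumP[e].
  have e1 : 0 < e%:num / (B * L) by rewrite divr_gt0// mulr_gt0.
  have m0 : 0 < Num.min del (e%:num / (B * L)) by rewrite lt_min del0.
  near=> v.
  have vm : `|v| < Num.min del (e%:num / (B * L)).
    by near: v; apply: nbhs0_lt.
  move: vm; rewrite lt_min => /andP[vd ve].
  rewrite !fctE /= opprD addrA addrC [v + x]addrC.
  rewrite [- psi v + _]addrC (le_trans (quad _ vd))//.
  have -> : B * (L * `|v| * `|v|) = (`|v| * (B * L)) * `|v| by ring.
  by rewrite ler_wpM2r// -ler_pdivlMr ?mulr_gt0// ltW.
have Ed := diff_unique cPsi lit.
split; first by apply/diff_locallyP; rewrite Ed.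
by move=> v; rewrite Ed [LHS]surjective_pairing T1.
Unshelve. all: by end_near. Qed.

(** A directional derivative of the time-one map is a component of the time-one
    map of the tangent field, which is again an instance of the statement, over
    the same base set [W]. *)
Theorem time1_Cn k V (Z : V -> V) (O K W : set V) :
  findim V -> flow_dom Z O K W -> Cn k W (time1 Z).
Proof.
elim: k V Z O K W => [|k IH] V Z O K W fV D; split=> //.
- by move=> x Wx; have [] := time1_tangent fV D Wx.
- by move=> x Wx; have [] := time1_tangent fV D Wx.
move=> v; have v1 : 0 < `|v| + 1 by rewrite ltr_wpDl.
have [r Dr] := tangent_flow_dom fV D v1.
have fVV := findim_prod fV fV.
have CT := IH _ _ _ _ _ fVV Dr.
have oW := fd_openW D.
apply: (@Cn_ext _ k _ _ W (fun x => (time1 (tangent_field Z) (x, v)).2)) => //.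
  by move=> x Wx; have [dx ->] := time1_tangent fV D Wx; rewrite /= deriveE.
apply: (@Cn_linear_comp _ k _ _ _ W (fun x => time1 (tangent_field Z) (x, v)) snd) => //.
  by move=> p; exact: cvg_snd.
apply: (@Cn_comp _ k _ _ _ W (W `*` ball 0 (`|v| + 1)) (fun x => (x, v)) (time1 (tangent_field Z))) => //.
  by move=> x Wx; split=> //; exact: ball_norm_succ.
apply: Cn_pair => //; last exact: Cn_cst.
by apply: (@Cn_linear _ k _ _ _ idfun) => x.
Qed.

End FlowSmooth.

(** * Algebra of smooth maps *)

Section SmoothAlgebra.
Context {R : realType}.
Implicit Types U V W : normedModType R.

Lemma smooth_ext V W (O : set V) (f g : V -> W) : open O ->
  (forall x, O x -> f x = g x) -> smooth O f -> smooth O g.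
Proof. by move=> oO fg /smoothP sf; apply/smoothP => k; exact: Cn_ext fg (sf k). Qed.

Lemma smooth_sub V W (O O' : set V) (f : V -> W) :
  O' `<=` O -> smooth O f -> smooth O' f.
Proof. by move=> sO sf s x /sO; exact: sf. Qed.

Lemma smooth_diff V W (O : set V) (f : V -> W) x :
  smooth O f -> O x -> differentiable f x.
Proof. by move=> sf; exact: (sf [::]). Qed.

Lemma smooth_continuous V W (O : set V) (f : V -> W) x :
  smooth O f -> O x -> {for x, continuous f}.
Proof. by move=> sf Ox; apply: differentiable_continuous; exact: smooth_diff sf Ox. Qed.

Lemma smooth_derive V W (O : set V) (f : V -> W) v : smooth O f -> smooth O ('D_v f).
Proof. by move=> /smoothP sf; apply/smoothP => k; have [_ Df] := sf k.+1; exact: Df. Qed.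

Lemma smooth_cst V W (O : set V) (c : W) : smooth O (fun=> c).
Proof. by apply/smoothP => k; exact: Cn_cst. Qed.

Lemma smooth_linear V W (O : set V) (L : {linear V -> W}) : findim V -> smooth O L.
Proof. by move=> fV; apply/smoothP => k; apply: Cn_linear; exact: findim_linear_continuous. Qed.

Lemma smooth_linearP V W (O : set V) (f : V -> W) : findim V -> linear f -> smooth O f.
Proof.
move=> fV lf; pose L : {linear V -> W} := HB.pack f (GRing.isLinear.Build _ _ _ _ _ lf).
exact: (@smooth_linear _ _ O L).
Qed.

Lemma smooth_id V (O : set V) : findim V -> smooth O (fun x => x).
Proof. by move=> fV; exact: smooth_linearP. Qed.

Lemma diff_eq0_near V W (O : set V) (f : V -> W) (c : W) x u :
  open O -> O x -> (forall y, O y -> f y = c) -> 'd f x u = 0.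
Proof.
move=> oO Ox f0.
have n0 : \near x, (cst c : V -> W) x = f x.
  by near=> y; rewrite f0//; near: y; exact: open_nbhs_nbhs.
have [_ e] := near_eq_diff n0 (differentiable_cst c x).
by rewrite [LHS](congr1 (fun F => F u) e) [LHS](congr1 (fun F => F u) (diff_cst c x)).
Unshelve. all: by end_near. Qed.

Lemma smoothD V W (O : set V) (f g : V -> W) : open O ->
  smooth O f -> smooth O g -> smooth O (fun x => f x + g x).
Proof. by move=> oO /smoothP sf /smoothP sg; apply/smoothP => k; exact: CnD. Qed.

Lemma smoothZ V W (O : set V) (f : V -> R) (g : V -> W) : open O ->
  smooth O f -> smooth O g -> smooth O (fun x => f x *: g x).
Proof. by move=> oO /smoothP sf /smoothP sg; apply/smoothP => k; exact: CnZ. Qed.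

Lemma smoothM V (O : set V) (f g : V -> R) : open O ->
  smooth O f -> smooth O g -> smooth O (fun x => f x * g x).
Proof. exact: smoothZ. Qed.

Lemma smoothN V W (O : set V) (f : V -> W) : open O ->
  smooth O f -> smooth O (fun x => - f x).
Proof.
move=> oO sf; apply: (@smooth_ext _ _ _ (fun x => (-1 : R) *: f x)) => //.
  by move=> x _; rewrite scaleN1r.
by apply: smoothZ => //; exact: smooth_cst.
Qed.

Lemma smoothB V W (O : set V) (f g : V -> W) : open O ->
  smooth O f -> smooth O g -> smooth O (fun x => f x - g x).
Proof. by move=> oO sf sg; apply: smoothD => //; exact: smoothN. Qed.

Lemma smooth_sum V W (O : set V) (I : Type) (r : seq I) (P : pred I) (f : I -> V -> W) :
  open O -> (forall i, smooth O (f i)) -> smooth O (fun x => \sum_(i <- r | P i) f i x).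
Proof. by move=> oO sf; apply/smoothP => k; apply: Cn_sum => // i; have /smoothP := sf i; exact. Qed.

Lemma smooth_prod V (O : set V) (I : Type) (r : seq I) (P : pred I) (f : I -> V -> R) :
  open O -> (forall i, smooth O (f i)) -> smooth O (fun x => \prod_(i <- r | P i) f i x).
Proof.
move=> oO sf; elim: r => [|i r IH].
  apply: (@smooth_ext V R O (fun=> 1)); [by []| |exact: smooth_cst].
  by move=> x _; rewrite big_nil.
case Pi: (P i).
  by apply: (smooth_ext oO _ (smoothM oO (sf i) IH)) => x _; rewrite big_cons Pi.
by apply: (smooth_ext oO _ IH) => x _; rewrite big_cons Pi.
Qed.

Lemma smooth_comp U V W (O : set U) (Q : set V) (f : U -> V) (g : V -> W) :
  findim V -> open O -> (forall x, O x -> Q (f x)) ->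
  smooth O f -> smooth Q g -> smooth O (fun x => g (f x)).
Proof.
by move=> fV oO OQ /smoothP sf /smoothP sg; apply/smoothP => k; exact: (Cn_comp fV oO OQ).
Qed.

Lemma smooth_linear_comp U V W (O : set U) (f : U -> V) (L : {linear V -> W}) :
  findim V -> open O -> smooth O f -> smooth O (fun x => L (f x)).
Proof.
move=> fV oO sf; apply: (@smooth_comp _ _ _ _ setT f L) => //.
exact: smooth_linear.
Qed.

Lemma smooth_pair V W W' (O : set V) (f : V -> W) (g : V -> W') : open O ->
  smooth O f -> smooth O g -> smooth O (fun x => (f x, g x)).
Proof. by move=> oO /smoothP sf /smoothP sg; apply/smoothP => k; exact: Cn_pair. Qed.

Lemma smooth_inv V (O : set V) (f : V -> R) : open O ->
  (forall x, O x -> f x != 0) -> smooth O f -> smooth O (fun x => (f x)^-1).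
Proof.
move=> oO f0 sf; apply/smoothP => k; have /smoothP Cf := sf.
elim: k => [|k IH].
  by split=> // x Ox; apply: differentiableV; [exact: Cn_diff (Cf 0%N) Ox|exact: f0].
split; first by move=> x Ox; apply: differentiableV; [exact: Cn_diff (Cf 0%N) Ox|exact: f0].
move=> v; apply: (@Cn_ext _ k _ _ O (fun x => (f x)^-1 * ((f x)^-1 * (- 'D_v f x)))) => //.
  move=> x Ox; have dfx := Cn_diff (Cf 0%N) Ox.
  rewrite [RHS]deriveV ?f0//; last exact: diff_derivable.
  by rewrite expr2 invfM -[RHS]/(_ * _) mulrN mulrN mulNr mulrA.
apply: CnZ => //; apply: CnZ => //.
have /smoothP := smoothN oO (smooth_derive v sf); exact.
Qed.

Lemma smooth_mx V m n (O : set V) (M : V -> 'M[R]_(m, n)) : open O ->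
  (forall i j, smooth O (fun x => M x i j)) -> smooth O M.
Proof.
move=> oO sM.
apply: (@smooth_ext _ _ _ (fun x => \sum_i \sum_j M x i j *: delta_mx i j)) => //.
  by move=> x _; rewrite -matrix_sum_delta.
by apply: smooth_sum => // i; apply: smooth_sum => // j; apply: smoothZ => //; exact: smooth_cst.
Qed.

Lemma smooth_det V n (O : set V) (M : V -> 'M[R]_n) : open O ->
  (forall i j, smooth O (fun x => M x i j)) -> smooth O (fun x => \det (M x)).
Proof.
move=> oO sM; rewrite /determinant; apply: smooth_sum => // s.
by apply: smoothM => //; [exact: smooth_cst|exact: smooth_prod].
Qed.

(** Cramer's formula: the inverse is a quotient of polynomials in the entries. *)
Lemma smooth_invmx V n (O : set V) (M : V -> 'M[R]_n) : open O ->
  (forall x, O x -> M x \in unitmx) ->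
  (forall i j, smooth O (fun x => M x i j)) ->
  forall i j, smooth O (fun x => invmx (M x) i j).
Proof.
move=> oO uM sM i j.
apply: (@smooth_ext _ _ _ (fun x => (\det (M x))^-1 * ((-1) ^+ (j + i) *
    \det (row' j (col' i (M x)))))) => //.
  by move=> x Ox; rewrite /invmx uM// !mxE.
apply: smoothM => //.
  apply: smooth_inv => //; last exact: smooth_det.
  by move=> x Ox; have := uM x Ox; rewrite unitmxE unitfE.
apply: smoothM => //; first exact: smooth_cst.
apply: smooth_det => // a b.
by apply: (smooth_ext oO _ (sM (lift j a) (lift i b))) => x _; rewrite !mxE.
Qed.

(** * Flows near an equilibrium *)

(** Near a zero of the field, trajectories are slow, so they exist up to time 1
    on a whole neighbourhood. Each field used below is arranged to have a zero
    at the base point. *)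
Lemma equilibrium_flow_dom V (Z : V -> V) (O : set V) x0 : findim V -> open O ->
  O x0 -> smooth O Z -> Z x0 = 0 -> exists K W : set V, flow_dom Z O K W /\ W x0.
Proof.
move=> fV oO Ox0 sZ Z0.
have := oO; rewrite openE => /(_ x0 Ox0) /nbhs_ballP[r /= r0 br].
pose K := [set x : V | `|x - x0| <= r / 2].
have r2 : 0 < r / 2 by rewrite divr_gt0.
have KO : K `<=` O.
  move=> x Kx; apply: br; rewrite -ball_normE /= distrC (le_lt_trans Kx)//.
  by rewrite gtr_pMr// invf_lt1// ltr1n.
have cK : compact K.
  have -> : K = (fun v => x0 + v) @` [set v : V | `|v| <= r / 2].
    apply/seteqP; split => [x Kx|x [v vr <-]]; last by rewrite /K /= addrC addKr.
    by exists (x - x0) => //; rewrite addrC subrK.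
  apply: continuous_compact; last exact: findim_ball_compact.
  apply: continuous_subspaceT => v.
  by apply: cvgD; [exact: cvg_cst|exact: cvg_id].
have xK : convex_set K.
  move=> x y t Kx Ky t01; have := convex_norm_ball Kx Ky t01; rewrite /K /=.
  by rewrite opprB addrA subrK addrAC.
have [L L0 LP] : exists2 L, 0 < L & forall x y, K x -> K y -> `|Z y - Z x| <= L * `|y - x|.
  by apply: (@lipschitz_on_compact _ _ _ O) => //; have /smoothP := sZ; exact.
have eL := expR_gt0 L.
(* In unit time the distance to x0 grows at most by the factor exp L. *)
exists K, (ball x0 (r / 2 / expR L)); split; last by apply: ballxx; rewrite divr_gt0.
split=> //; first exact: ball_open.
move=> k j x jk bx.
have h0 := ltW (@dyad_gt0 R k).
have nx : `|x - x0| * expR L <= r / 2.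
  by rewrite -ler_pdivlMr// distrC ltW//; move: bx; rewrite -ball_normE.
have hL : 0 <= dyad k * L by rewrite mulr_ge0// ltW.
have Kx0 : K x0 by rewrite /K /= subrr normr0 ltW.
suff : `|euler_iter Z k j x - x0| <= (1 + dyad k * L) ^+ j * `|x - x0|.
  move=> H; rewrite /K /= (le_trans H)// (le_trans _ nx)// mulrC.
  by rewrite ler_wpM2l// euler_growth// ltW.
elim: j jk => [|j IH] jk; first by rewrite expr0 mul1r.
have Kj : K (euler_iter Z k j x).
  rewrite /K /= (le_trans (IH (ltnW jk)))// (le_trans _ nx)// mulrC.
  by apply: ler_wpM2l => //; apply: euler_growth; [exact: ltW|exact: ltnW].
rewrite euler_iterS addrAC (le_trans (ler_normD _ _))//.
have := LP _ _ Kx0 Kj; rewrite Z0 subr0 => H.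
rewrite normrZ ger0_norm// exprS -mulrA mulrDl mul1r lerD//; first exact: IH (ltnW jk).
rewrite -mulrA ler_wpM2l// (le_trans H)// ler_pM2l//; exact: IH (ltnW jk).
Qed.

Lemma time1_smooth V (Z : V -> V) (O K W : set V) :
  findim V -> flow_dom Z O K W -> smooth W (time1 Z).
Proof. by move=> fV D; apply/smoothP => k; exact: time1_Cn D. Qed.

Lemma time1_equilibrium V (Z : V -> V) x : Z x = 0 -> time1 Z x = x.
Proof.
move=> Zx; rewrite /time1.
have -> : (fun k => euler_iter Z k (2 ^ k)%N x) = fun=> x.
  apply/funext => k; elim: (2 ^ k)%N => [//|j IH].
  by rewrite euler_iterS IH Zx scaler0 addr0.
by apply: cvg_lim; [exact: norm_hausdorff|exact: cvg_cst].
Qed.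

Lemma time1_constant V V' (Z : V -> V) (O K W : set V) (w : V -> V') x :
  findim V -> findim V' -> flow_dom Z O K W -> smooth O w ->
  (forall y, K y -> 'd w y (Z y) = 0) -> W x -> w (time1 Z x) = w x.
Proof.
move=> fV fV' D sw w0 Wx; apply/eqP; rewrite -subr_eq0; apply/eqP.
pose u y := w y - w x.
have su : smooth O u by apply: smoothB => //; [exact: fd_open D|exact: smooth_cst].
apply: (@time1_invariant _ _ _ _ _ _ fV D _ u 0 x fV' su) => //; last by rewrite /u subrr.
move=> y Ky; rewrite mul0r.
have Oy := fd_sub D Ky.
have dw := differentiableP (smooth_diff sw Oy).
have E : is_diff y u ('d w y).
  have -> : u = w - cst (w x) by [].
  by apply: is_diff_eq; rewrite subr0.
by case: E => _ ->; rewrite w0// normr0.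
Qed.

End SmoothAlgebra.

(** * The inverse function theorem *)

Section InverseFunction.
Context {R : realType}.
Implicit Types U V W : normedModType R.

Lemma open_preimage_in U V (O : set U) (A : set V) (f : U -> V) : open O -> open A ->
  (forall x, O x -> {for x, continuous f}) -> open [set x | O x /\ A (f x)].
Proof.
move=> oO oA cf; rewrite openE => x [Ox Ax].
have nO : nbhs x O by exact: open_nbhs_nbhs.
have nA : nbhs x (f @^-1` A) by apply: (cf x Ox); exact: open_nbhs_nbhs.
by rewrite /interior /=; move: nO nA; exact: filterI.
Qed.

Lemma open_neq0 U V (O : set U) (f : U -> V) : open O ->
  (forall x, O x -> {for x, continuous f}) -> open [set x | O x /\ f x != 0].
Proof.
move=> oO cf; apply: (@open_preimage_in _ _ O [set v : V | v != 0] f) => //.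
have -> : [set v : V | v != 0] = ~` [set 0] by apply/seteqP; split=> v /= /eqP.
apply: closed_openC; apply: accessible_closed_set1; apply: hausdorff_accessible.
exact: norm_hausdorff.
Qed.

(** On linear coordinates whose velocity is constant along the flow, Euler
    polygons are exact. *)
Lemma time1_linear V V1 V2 (Z : V -> V) (O K : set V) (D : set V) (M : {linear V -> V1})
    (L : {linear V -> V2}) (g : V1 -> V2) x :
  findim V -> flow_dom Z O K D -> (forall s, K s -> M (Z s) = 0) ->
  (forall s, K s -> L (Z s) = g (M s)) -> D x ->
  M (time1 Z x) = M x /\ L (time1 Z x) = L x + g (M x).
Proof.
move=> fV FD MZ LZ Dx.
have ME k j : (j <= 2 ^ k)%N -> M (euler_iter Z k j x) = M x.
  elim: j => [//|j IH] jk; rewrite euler_iterS linearD IH ?(ltnW jk)//.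
  rewrite linearZ MZ; first by rewrite /= scaler0 addr0.
  by apply: (fd_confined FD) => //; exact: ltnW.
have LE k j : (j <= 2 ^ k)%N ->
    L (euler_iter Z k j x) = L x + (j%:R * dyad k) *: g (M x).
  elim: j => [|j IH] jk; first by rewrite mul0r scale0r addr0.
  rewrite euler_iterS linearD IH ?(ltnW jk)// linearZ LZ.
    rewrite ME ?(ltnW jk)// -natr1 mulrDl mul1r scalerDl /=.
    by rewrite addrA.
  by apply: (fd_confined FD) => //; exact: ltnW.
have cM := @findim_linear_continuous _ _ _ M fV.
have cL := @findim_linear_continuous _ _ _ L fV.
have cE := euler_cvg fV FD Dx.
split.
  have c1 : M (euler_iter Z k (2 ^ k)%N x) @[k --> \oo] --> M (time1 Z x).
    by apply: continuous_cvg => //; exact: cM.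
  have c2 : M (euler_iter Z k (2 ^ k)%N x) @[k --> \oo] --> M x.
    by under eq_fun do rewrite ME//; exact: cvg_cst.
  exact: (cvg_unique _ c1 c2).
have c1 : L (euler_iter Z k (2 ^ k)%N x) @[k --> \oo] --> L (time1 Z x).
  by apply: continuous_cvg => //; exact: cL.
have c2 : L (euler_iter Z k (2 ^ k)%N x) @[k --> \oo] --> L x + g (M x).
  by under eq_fun do rewrite LE// dyadM scale1r; exact: cvg_cst.
exact: (cvg_unique _ c1 c2).
Qed.

Lemma ball_convex V (m : V) (d : R) : convex_set (ball m d).
Proof.
move=> x y t; rewrite -ball_normE /= => xd yd t01.
have -> : m - (x + t *: (y - x)) = (m - x) + t *: ((m - y) - (m - x)).
  have -> : (m - y) - (m - x) = x - y by rewrite opprB addrC addrA subrK.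
  by rewrite opprD addrA -scalerN opprB.
pose M := Num.max `|m - x| `|m - y|.
have Md : M < d by rewrite gt_max xd.
apply: le_lt_trans Md; apply: (@convex_norm_ball _ _ M) => //=.
  by rewrite le_max lexx.
by rewrite le_max lexx orbT.
Qed.

Lemma diff_small V W (O : set V) (f : V -> W) m (e : R) : findim V -> open O -> O m ->
  smooth O f -> (forall v, 'd f m v = 0) -> 0 < e ->
  exists2 d, 0 < d & forall x, ball m d x -> O x /\ forall v, `|'d f x v| <= e * `|v|.
Proof.
move=> [n [b [c [cc ce]]]] oO Om sf f0 e0.
have [k kP] := coord_bounds cc.
pose S := \sum_i k i + 1.
have S0 : 0 < S by rewrite ltr_wpDl// sumr_ge0// => i _; rewrite ltW// (kP i).1.
have eS : 0 < e / S by rewrite divr_gt0.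
have nO : \near m, O m by exact: open_nbhs_nbhs.
have nD : \forall x \near m, forall i, `|'D_(b i) f x| < e / S.
  apply: filter_forall => i.
  have cD : {for m, continuous ('D_(b i) f)} := smooth_continuous (smooth_derive (b i) sf) Om.
  have c0 : 'D_(b i) f x @[x --> m] --> (0 : W).
    by rewrite -(f0 (b i)) -deriveE//; exact: smooth_diff sf Om.
  exact: (cvgr0_norm_lt _ c0).
have nOD : nbhs m (fun x => O x /\ forall i, `|'D_(b i) f x| < e / S).
  by move: nO nD; exact: filterI.
have /nbhs_ballP[d /= d0 dP] := nOD.
exists d => // x /dP[Ox Dx]; split=> // v.
rewrite (diff_coords _ ce (smooth_diff sf Ox)) (le_trans (ler_norm_sum _ _ _))//.
have E : e * `|v| = \sum_i (k i * `|v|) * (e / S) + `|v| * (e / S).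
  rewrite -!mulr_suml; move: (gt_eqF S0); rewrite /S; move: (\sum_i k i) => s s1.
  by field; rewrite s1.
rewrite E; apply: ler_wpDr; first by rewrite mulr_ge0// ltW.
apply: ler_sum => i _.
by rewrite normrZ; apply: ler_pM => //; [exact: (kP i).2|exact/ltW/Dx].
Qed.

Definition jacm n (H : 'rV[R]_n -> 'rV[R]_n) (x : 'rV[R]_n) : 'M[R]_n :=
  lin1_mx ('d H x).

(** The flow of x' = dH_x^-1 (y), y' = 0 follows the preimage under H of a
    segment, so that its end point is the preimage of the end of the segment:
    the inverse is smooth because the flow is. Uniqueness of the preimage comes
    from the contraction x |-> x - H x. A general invertible dH_m is reduced to
    the identity by composition with a linear map. *)
Theorem inverse_function n (H : 'rV[R]_n -> 'rV[R]_n) (O : set 'rV[R]_n) m :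
  open O -> O m -> smooth O H -> (forall v, 'd H m v = v) ->
  exists (Q : set 'rV[R]_n) (Psi : 'rV[R]_n -> 'rV[R]_n) (O' : set 'rV[R]_n),
    [/\ open Q /\ smooth Q Psi, (forall y, Q y -> O (Psi y) /\ H (Psi y) = y),
        open O' /\ O' m, O' `<=` O & forall x, O' x -> Q (H x) /\ Psi (H x) = x].
Proof.
move=> oO Om sH dHm.
have fV := @findim_rV R n.
have sJ i j : smooth O (fun x => jacm H x i j).
  apply: (@smooth_ext _ _ _ _ (fun x => rv_coord j ('D_(delta_mx 0 i) H x))) => //.
    by move=> x Ox; rewrite mxE /rv_coord deriveE//; exact: smooth_diff sH Ox.
  by apply: smooth_linear_comp => //; exact: smooth_derive.
have Jv x v : 'd H x v = v *m jacm H x by exact: (esym (mul_rV_lin1 ('d H x) v)).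
have sdet := smooth_det oO sJ.
pose O1 := [set x | O x /\ \det (jacm H x) != 0].
have oO1 : open O1 by apply: open_neq0 => // x Ox; exact: smooth_continuous sdet Ox.
have O1m : O1 m.
  split=> //=; have -> : jacm H m = 1%:M.
    by apply/row_matrixP => i; rewrite rowE -Jv dHm row1.
  by rewrite det1 oner_neq0.
have O1O : O1 `<=` O by move=> x [].
have sN i j : smooth O1 (fun x => invmx (jacm H x) i j).
  apply: smooth_invmx => // [x [_ /=]|a b]; first by rewrite unitmxE unitfE.
  exact: smooth_sub (sJ a b).
pose St := ('rV[R]_n * 'rV[R]_n * 'rV[R]_n)%type.
have fSt : findim St by exact: (findim_prod (findim_prod fV fV) fV).
(* The state is (x, y, c); the last component, of velocity - y, keeps track
   of the time: H x + c is constant along the flow. *)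
pose Z (s : St) : St := ((s.1.2 *m invmx (jacm H s.1.1), 0), - s.1.2).
pose OS : set St := (O1 `*` setT) `*` setT.
have oOS : open OS by do 2 apply: open_setXT.
have sfst2 : smooth OS (fun s : St => s.1.1) by apply: (smooth_linearP fSt).
have ssnd1 : smooth OS (fun s : St => s.1.2) by apply: (smooth_linearP fSt).
have sZ : smooth OS Z.
  apply: smooth_pair => //; last exact: smoothN.
  apply: smooth_pair => //; last exact: smooth_cst.
  apply: smooth_mx => // i j.
  apply: (@smooth_ext _ _ _ _ (fun s : St => \sum_k s.1.2 i k * invmx (jacm H s.1.1) k j)) => //.
    by move=> s _; rewrite mxE.
  apply: smooth_sum; first exact: oOS.
  move=> k; apply: smoothM; first exact: oOS.
    rewrite (ord1 i).
    exact: (@smooth_linear_comp _ _ _ _ OS (fun s : St => s.1.2) (rv_coord k) fV oOS ssnd1).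
  apply: (@smooth_comp _ _ _ _ OS O1 (fun s : St => s.1.1) (fun x => invmx (jacm H x) k j)
    fV oOS _ sfst2 (sN k j)).
  by move=> s [[]].
(* At these states H x + c = 0, and c = - y at time 1, so that H x = y there;
   for y = H m the state is a zero of the field. *)
pose s0 y : St := ((m, y - H m), - H m).
have Z0 : Z (s0 (H m)) = 0 by rewrite /Z /s0 /= subrr mul0mx oppr0.
have OSs0 : OS (s0 (H m)) by [].
have [K [D [FD Ds0]]] := equilibrium_flow_dom fSt oOS OSs0 sZ Z0.
pose Psi y := (time1 Z (s0 y)).1.1.
pose Q0 := s0 @^-1` D.
have ss0 A : open A -> smooth A s0.
  move=> oA; apply: smooth_pair => //; last exact: smooth_cst.
  apply: smooth_pair => //; first exact: smooth_cst.
  by apply: smoothB => //; [exact: smooth_id|exact: smooth_cst].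
have oQ0 : open Q0.
  apply: open_comp; last exact: fd_openW FD.
  by move=> y _; exact: (smooth_continuous (ss0 _ openT)).
have sPsi : smooth Q0 Psi.
  apply: (@smooth_comp _ _ _ _ Q0 setT (fun y => time1 Z (s0 y)) (fst \o fst)) => //.
    apply: (@smooth_comp _ _ _ _ Q0 D s0 (time1 Z)) => //; first exact: ss0.
    exact: time1_smooth FD.
  exact: smooth_linear.
have OPsi y : Q0 y -> O (Psi y).
  by move=> Qy; have /(fd_sub FD) [[/O1O]] := time1_in fSt FD Qy.
have HPsi y : Q0 y -> H (Psi y) = y.
  move=> Qy.
  pose w (s : St) := H s.1.1 + s.2.
  have sHf : smooth OS (fun s : St => H s.1.1).
    apply: (@smooth_comp _ _ _ _ OS O (fun s : St => s.1.1) H) => //.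
    by move=> s [[/O1O]].
  have sw : smooth OS w by apply: smoothD => //; exact: (@smooth_linear _ St _ OS snd fSt).
  have wc : w (time1 Z (s0 y)) = w (s0 y).
    apply: (time1_constant fSt _ FD sw) => // s /(fd_sub FD) [[[Ox dx] _] _].
    have dH := differentiableP (smooth_diff sH Ox).
    have d1 := linear_is_diff (fst \o fst : St -> _) s fSt.
    have d2 := linear_is_diff (snd : St -> _) s fSt.
    have E := is_diffD (is_diff_comp d1 dH) d2.
    case: E => _ E; rewrite [LHS](congr1 (fun F => F (Z s)) E).
    rewrite !fctE /= Jv mulmxKV ?subrr//.
    by rewrite unitmxE unitfE.
  have [_ c2] : (time1 Z (s0 y)).1.2 = (s0 y).1.2 /\
      (time1 Z (s0 y)).2 = (s0 y).2 + - (s0 y).1.2.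
    exact: (@time1_linear _ _ _ Z OS K D (snd \o fst) snd -%R (s0 y) fSt FD).
  move: wc; rewrite /w c2 /Psi /= subrr => /eqP.
  by rewrite addr_eq0 opprD !opprK addrC subrK => /eqP.
have PsiHm : Psi (H m) = m by rewrite /Psi time1_equilibrium.
have Q0m : Q0 (H m) by exact: Ds0.
clearbody Psi Q0.
have [C C0 CP] := mean_value_inequality fV.
(* Injectivity near m: the differential of x - H x is small there, which
   makes this map a contraction of ratio 1/2. *)
pose G x := x - H x.
have dG x : O x -> is_diff x G (fun v => v - 'd H x v).
  move=> Ox; have dH := differentiableP (smooth_diff sH Ox).
  exact: is_diffB (is_diff_id x) dH.
have sG : smooth O G by apply: smoothB => //; exact: smooth_id.
have dG0 v : 'd G m v = 0 by case: (dG m Om) => _ ->; rewrite dHm subrr.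
have e0 : 0 < (C * 2)^-1 by rewrite invr_gt0 mulr_gt0.
have [d d0 dP] := diff_small fV oO Om sG dG0 e0.
have inj (x y : 'rV[R]_n) : ball m d x -> ball m d y -> H x = H y -> x = y.
  move=> bx bY Hxy; apply/eqP; rewrite eq_sym -subr_eq0 -normr_eq0 eq_le normr_ge0 andbT.
  have bs (t : R) : 0 <= t <= 1 -> ball m d (x + t *: (y - x)).
    exact: (ball_convex bx bY).
  have : `|G (x + (y - x)) - G x| <= C * ((C * 2)^-1 * `|y - x|).
    apply: CP => t t01; have [Ot Dt] := dP _ (bs t t01).
      exact: smooth_diff sG Ot.
    exact: Dt.
  have -> : G (x + (y - x)) - G x = y - x.
    by rewrite subrKC /G Hxy opprB addrA subrK.
  have -> : C * ((C * 2)^-1 * `|y - x|) = `|y - x| / 2 by field; rewrite gt_eqF.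
  by have := normr_ge0 (y - x); lra.
pose B0 : set 'rV[R]_n := ball m d.
have oB0 : open B0 by exact: ball_open.
have B0m : B0 m by exact: ballxx.
pose Q : set 'rV[R]_n := [set y | Q0 y /\ B0 (Psi y)].
have oQ : open Q.
  apply: (@open_preimage_in _ _ Q0 B0 Psi oQ0 oB0).
  by move=> y Qy; exact: smooth_continuous sPsi Qy.
pose OO : set 'rV[R]_n := [set x | O x /\ Q (H x)].
have oOO : open OO.
  by apply: (@open_preimage_in _ _ O Q H oO oQ) => x Ox; exact: smooth_continuous sH Ox.
exists Q, Psi, (OO `&` B0); split.
- by split=> //; apply: smooth_sub sPsi => y [].
- by move=> y [Qy _]; split; [exact: OPsi|exact: HPsi].
- split; first exact: (openI oOO oB0).
  by split; [split; [|split; [|rewrite PsiHm]]|].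
- by move=> x [[]].
move=> x [[Ox [Q0x Bx]] bx]; split; first by split.
by apply: inj => //; rewrite HPsi.
Qed.

End InverseFunction.

(** * Functional dependence *)

Section FunctionalDependence.
Context {R : realType}.

(** Complete F by the coordinates along ker dF_m into a local
    diffeomorphism H. Read through H, the function g has zero derivative
    along ker dF_m: two points of the same fibre of F have images under H that
    differ by an element of this kernel, and g takes the same value at both. *)
Theorem functional_dependence n (T : normedModType R) (F : 'rV[R]_n -> T)
    (g : 'rV[R]_n -> R) (O : set 'rV[R]_n) :
  findim T -> open O -> smooth O F -> smooth O g ->
  (forall m, O m -> exists sigma : {linear T -> 'rV[R]_n}, forall t, 'd F m (sigma t) = t) ->
  (forall x v, O x -> 'd F x v = 0 -> 'd g x v = 0) ->
  locally_function_of O F g.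
Proof.
move=> fT oO sF sg surF dFg m Om.
have fV := @findim_rV R n.
have [sigma sigmaP] := surF m Om.
pose p : {linear 'rV[R]_n -> 'rV[R]_n} := sigma \o ('d F m).
have ps t : p (sigma t) = sigma t by rewrite /= sigmaP.
have pp v : p (p v) = p v by rewrite [p v in LHS]/= ps.
(* p is the projector onto the image of sigma along the kernel of dF_m: the
   component of H along the former is F, along the latter the identity. *)
pose H x := sigma (F x) + x - p x.
have dFx x (Ox : O x) := differentiableP (smooth_diff sF Ox).
have dH x : O x -> is_diff x H (fun v => sigma ('d F x v) + v - p v).
  move=> Ox; have dsF := is_diff_comp (dFx x Ox) (linear_is_diff sigma (F x) fT).
  exact: (is_diffB (is_diffD dsF (is_diff_id x)) (linear_is_diff p x fV)).
have sH : smooth O H.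
  apply: smoothB => //; last exact: smooth_linear.
  apply: smoothD => //; last exact: smooth_id.
  exact: smooth_linear_comp.
have dHm v : 'd H m v = v by case: (dH m Om) => _ ->; rewrite /= addrC addKr.
have [Q [Psi [N [[oQ sPsi] QP [oN Nm] NO NP]]]] := inverse_function oO Om sH dHm.
have QHm : Q (H m) by have [] := NP m Nm.
have := oQ; rewrite openE => /(_ _ QHm) /nbhs_ballP[r /= r0 bQ].
(* The affine section through H m of the projection along the kernel. *)
pose sec t := sigma t + (m - p m).
have ssec : smooth setT sec.
  by apply: smoothD; [exact: openT|exact: smooth_linear|exact: smooth_cst].
pose B := ball (H m) r.
have oB : open B by exact: ball_open.
pose QT := sec @^-1` B.
have oQT : open QT by apply: open_comp => // t _; exact: smooth_continuous ssec _.
pose phi t := g (Psi (sec t)).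
have sphi : smooth QT phi.
  apply: (@smooth_comp _ _ _ _ _ O (fun t => Psi (sec t)) g) => //.
    by move=> t Qt; have [] := QP (sec t) (bQ _ Qt).
  apply: (@smooth_comp _ _ _ _ _ Q sec Psi) => //; first by move=> t; exact: bQ.
  exact: smooth_sub ssec.
pose h y := g (Psi y).
have dPsi y : Q y -> is_diff y Psi ('d Psi y).
  by move=> Qy; apply: differentiableP; exact: smooth_diff sPsi Qy.
(* If w = dPsi_y (u) with u in the kernel, then dH (w) = u gives dF (w) = 0. *)
have dh y u : Q y -> 'd F m u = 0 -> differentiable h y /\ 'd h y u = 0.
  move=> Qy Fu; have [OPy HPy] := QP y Qy.
  have dg := differentiableP (smooth_diff sg OPy).
  have E : is_diff y h ('d g (Psi y) \o 'd Psi y) := is_diff_comp (dPsi y Qy) dg.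
  case: E => dhy ->; split; first exact: dhy.
  apply: (dFg (Psi y) _ OPy); rewrite [X in 'd F _ X]/=; set w := 'd Psi y u.
  have E1 : 'd (H \o Psi) y u = u.
    have : \near y, id y = (H \o Psi) y.
      near=> z; have Qz : Q z by near: z; exact: open_nbhs_nbhs.
      by have [_ /= ->] := QP z Qz.
    move=> /near_eq_diff[]; first exact: (@ex_diff _ _ _ _ _ _ _ (is_diff_id y)).
    by move=> _ ->; case: (is_diff_id y) => _ ->.
  have E2 : is_diff y (H \o Psi) (_ \o _) := is_diff_comp (dPsi y Qy) (dH _ OPy).
  have E3 : 'd (H \o Psi) y u = sigma ('d F (Psi y) w) + w - sigma ('d F m w).
    by case: E2 => _ ->.
  have dFmD a b c : 'd F m (a + b - c) = 'd F m a + 'd F m b - 'd F m c.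
    by rewrite linearB linearD.
  have E4 := etrans (esym (dFmD _ _ _)) (congr1 ('d F m) (etrans (esym E3) E1)).
  have E5 : 'd F (Psi y) w + 'd F m w - 'd F m w = 0.
    exact: etrans (esym (congr2 (fun a b => a + 'd F m w - b) (sigmaP _) (sigmaP _)))
      (etrans E4 Fu).
  exact: etrans (esym (addrK _ _)) E5.
(* H x and sec (F x) differ by an element of the kernel of dF_m. *)
have Hsec x : O x -> H x - sec (F x) = x - m - p (x - m).
  move=> Ox; rewrite /H /sec linearB -[sigma (F x) + x - _]addrA opprD addrACA.
  by rewrite subrr add0r opprD addrACA opprD.
pose O1 : set 'rV[R]_n := [set x | O x /\ B (H x)].
pose O2 : set 'rV[R]_n := [set x | O x /\ B (sec (F x))].
have oO1 : open O1.
  by apply: (@open_preimage_in _ _ _ O B H oO oB) => x Ox; exact: smooth_continuous sH Ox.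
have ssF : smooth O (fun x => sec (F x)).
  by apply: (@smooth_comp _ _ _ _ O setT F sec).
have oO2 : open O2.
  apply: (@open_preimage_in _ _ _ O B (fun x => sec (F x)) oO oB) => x Ox.
  exact: smooth_continuous ssF Ox.
have Bm : B (H m) by exact: ballxx.
have Bsm : B (sec (F m)).
  suff -> : sec (F m) = H m by [].
  have := Hsec m Om; rewrite (subrr m) linear0 subr0 => /eqP.
  by rewrite subr_eq0 => /eqP.
exists ((N `&` O1) `&` O2), QT, phi; split.
- by split; [exact: (openI (openI oN oO1) oO2)|split; split].
- by move=> x [[_ []]].
- exact: oQT.
- exact: sphi.
move=> x [[Nx [Ox BH]] [_ Bs]]; split=> //.
have [_ PHx] := NP x Nx.
have [C C0 CP] := mean_value_inequality (@findim_R R).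
pose u := H x - sec (F x).
have Fu : 'd F m u = 0 by rewrite /u Hsec// linearB /= sigmaP subrr.
have seg (t : R) : 0 <= t <= 1 -> B (sec (F x) + t *: u) by exact: ball_convex.
have : `|h (sec (F x) + u) - h (sec (F x))| <= C * 0.
  apply: CP => t t01; have [d1 d2] := dh _ u (bQ _ (seg t t01)) Fu => //.
  by rewrite d2 normr0.
rewrite mulr0 normr_le0 subr_eq0 /u addrC subrK /h PHx => /eqP ->.
by [].
Unshelve. all: by end_near. Qed.

End FunctionalDependence.

(** * Straightening an involutive field of projectors *)

Section Straightening.
Context {R : realType}.

Variables (n : nat).
Notation V := 'rV[R]_n.

Lemma smooth_mx_entry (W : normedModType R) p q (O : set W) (M : W -> 'M[R]_(p, q)) i j :
  open O -> smooth O M -> smooth O (fun x => M x i j).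
Proof.
move=> oO sM.
have -> : (fun x => M x i j) = (fun x => rv_coord (mxvec_index i j) (mxvec (M x))).
  by apply/funext => x; rewrite /rv_coord mxvecE.
exact: (@smooth_linear_comp _ _ _ _ O M (rv_coord (mxvec_index i j) \o mxvec) (@findim_mx R p q)).
Qed.

Lemma smooth_rowmul (O : set V) (M : V -> 'M[R]_n) : open O -> smooth O M ->
  smooth (O `*` [set: V]) (fun s : V * V => s.2 *m M s.1).
Proof.
move=> oO sM; have fVV := findim_prod (@findim_rV R n) (@findim_rV R n).
pose OS : set (V * V) := O `*` setT.
have oOS : open OS by exact: open_setXT.
have ssnd : smooth OS (snd : V * V -> V) by exact: (@smooth_linear _ _ _ _ snd fVV).
have sfst : smooth OS (fst : V * V -> V) by exact: (@smooth_linear _ _ _ _ fst fVV).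
apply: smooth_mx => // i j.
apply: (@smooth_ext _ _ _ _ (fun s : V * V => \sum_k s.2 i k * M s.1 k j)) => //.
  by move=> s _; rewrite mxE.
apply: smooth_sum => // k; apply: smoothM => //; first exact: smooth_mx_entry.
apply: (@smooth_comp _ _ _ _ OS O (fun s : V * V => s.1) (fun x => M x k j)) => //.
- exact: findim_rV.
- by move=> s [].
- exact: smooth_mx_entry.
Qed.

Lemma is_diff_rowmul (O : set V) (M : V -> 'M[R]_n) (x a : V) :
  open O -> O x -> smooth O M ->
  is_diff (x, a) (fun s : V * V => s.2 *m M s.1)
    (fun u => a *m 'd M x u.1 + u.2 *m M x).
Proof.
move=> oO Ox sM.
have fV := @findim_rV R n.
have fVV := findim_prod fV fV.
pose OS : set (V * V) := O `*` setT.
have oOS : open OS by exact: open_setXT.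
pose f := fun s : V * V => s.2 *m M s.1.
have sf : smooth OS f by exact: smooth_rowmul.
have df : differentiable f (x, a) by apply: smooth_diff sf _; split.
have dM : is_diff x M ('d M x) by apply: differentiableP; exact: smooth_diff sM Ox.
have E1 u : 'd f (x, a) (u, 0) = a *m 'd M x u.
  have i1 : is_diff x (fun y : V => (y, a)) (fun u => (u, 0)).
    by have := is_diff_pair (is_diff_id x) (is_diff_cst a x).
  have [_ e1] := is_diff_comp i1 (differentiableP df).
  have [_ e2] := is_diff_comp dM (linear_is_diff (mulmx a) (M x) (@findim_mx R n n)).
  exact: etrans (esym (congr1 (fun F => F u) e1)) (congr1 (fun F => F u) e2).
have E2 u : 'd f (x, a) (0, u) = u *m M x.
  have i1 : is_diff a (fun y : V => (x, y)) (fun u => (0, u)).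
    by have := is_diff_pair (is_diff_cst x a) (is_diff_id a).
  have [_ e1] := is_diff_comp i1 (differentiableP df).
  have [_ e2] := linear_is_diff (mulmxr (M x)) a fV.
  exact: etrans (esym (congr1 (fun F => F u) e1)) (congr1 (fun F => F u) e2).
apply: DiffDef; first exact: df.
apply/funext => -[u v].
have -> : (u, v) = (u, 0) + (0, v) by rewrite -[RHS]/(_ + _, _ + _) addr0 add0r.
by rewrite [LHS]linearD E1 E2 /= addr0 add0r.
Qed.

(** [M x] and [P] are projectors acting on row vectors on the right, with the
    same kernel; the image of [M x] is the plane of a distribution at x. The
    last hypothesis says that the fields x |-> a *m M x, which project on the
    constant a *m P, commute. Then F x is the point where the leaf of x meets
    the transversal m + ker P: it is reached by following the field of
    parameter a = (x - m) *m P backwards in unit time. At the base point a = 0,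
    which is an equilibrium. *)
Theorem straightening (O : set V) (m : V) (M : V -> 'M[R]_n) (P : 'M[R]_n) :
  open O -> O m -> smooth O M ->
  (forall x, O x -> M x *m P = P) -> (forall x, O x -> P *m M x = M x) ->
  (forall x a b, O x -> b *m 'd M x (a *m M x) = a *m 'd M x (b *m M x)) ->
  exists (N : set V) (F : V -> V),
    [/\ open N /\ N m, N `<=` O, smooth N F,
        forall x v, N x -> 'd F x (v *m M x) = 0
      & forall v, v *m P = 0 -> 'd F m v = v].
Proof.
move=> oO Om sM MP PM inv.
have fV := @findim_rV R n.
pose S := (V * V)%type.
have fS : findim S by exact: findim_prod.
pose OS : set S := O `*` setT.
have oOS : open OS by exact: open_setXT.
pose f (s : S) : V := s.2 *m M s.1.
have sfst : smooth OS (fst : S -> V) by exact: (@smooth_linear _ _ _ _ fst fS).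
have df (s : S) : O s.1 -> is_diff s f (fun u => s.2 *m 'd M (s.1) u.1 + u.2 *m M s.1).
  by case: s => x a Ox; exact: (is_diff_rowmul a oO Ox sM).
have sf : smooth OS f by exact: smooth_rowmul.
pose Z (s : S) : S := (- f s, 0).
have sZ : smooth OS Z.
  by apply: smooth_pair => //; [exact: smoothN|exact: smooth_cst].
have dZ (s : S) : O s.1 ->
    is_diff s Z (fun u => (- (s.2 *m 'd M (s.1) u.1 + u.2 *m M s.1), 0)).
  by move=> Os; have := is_diff_pair (is_diffN (df s Os)) (is_diff_cst 0 s).
have Z0 : Z (m, 0) = 0 by rewrite /Z /f /= mul0mx oppr0.
have OSm : OS (m, 0) by split.
have [K [D [FD Dm]]] := equilibrium_flow_dom fS oOS OSm sZ Z0.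
pose j (x : V) : S := (x, (x - m) *m P).
have dj x : is_diff x j (fun v => (v, v *m P)).
  have i1 : is_diff x (fun y : V => y - m) id.
    rewrite (_ : (fun y : V => y - m) = id - cst m)//.
    by apply: is_diff_eq; rewrite subr0.
  have i2 := is_diff_comp i1 (linear_is_diff (mulmxr P) (x - m) fV).
  exact: (is_diff_pair (is_diff_id x) i2).
have sj : smooth setT j.
  apply: smooth_pair; [exact: openT|exact: smooth_id|].
  apply: (@smooth_linear_comp _ _ _ _ setT (fun x => x - m) (mulmxr P)) => //; first exact: openT.
  by apply: smoothB; [exact: openT|exact: smooth_id|exact: smooth_cst].
pose N := j @^-1` D.
have oN : open N.
  apply: open_comp; last exact: fd_openW FD.
  by move=> y _; exact: (smooth_continuous sj).
have jm : j m = (m, 0) by rewrite /j subrr mul0mx.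
have Nm : N m by rewrite /N /= jm.
pose F x := (time1 Z (j x)).1.
have NO : N `<=` O.
  by move=> x Nx; have /(fd_sub FD) [] := fd_confined FD (leq0n (2 ^ 0)) Nx.
have sF : smooth N F.
  apply: (@smooth_linear_comp _ _ _ _ N (fun x => time1 Z (j x)) fst) => //.
  apply: (@smooth_comp _ _ _ _ N D j (time1 Z)) => //; first exact: smooth_sub sj.
  exact: time1_smooth FD.
have dF x v : N x -> 'd F x v = (time1 (tangent_field Z) (j x, (v, v *m P))).2.1.
  move=> Nx; have [d1 ->] := time1_tangent fS FD Nx.
  have [_ e] := is_diff_comp (is_diff_comp (dj x) (differentiableP d1))
     (linear_is_diff (fst : S -> V) (time1 Z (j x)) fS).
  exact: (congr1 (fun F => F v) e).
exists N, F; split => //.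
- move=> x v Nx; rewrite dF//.
  pose y0 := v *m M x; rewrite -/y0.
  have Ox := NO x Nx.
  have MM z : O z -> M z *m M z = M z.
    by move=> Oz; rewrite -{2}(PM z Oz) mulmxA MP// PM.
  have dMP z u : O z -> 'd M z u *m P = 0.
    move=> Oz; have [_ e] := is_diff_comp (differentiableP (smooth_diff sM Oz))
      (linear_is_diff (mulmxr P) (M z) (@findim_mx R n n)).
    exact: etrans (esym (congr1 (fun F => F u) e)) (diff_eq0_near u oO Oz MP).
  have dMM z u : O z -> 'd M z u *m M z = 0.
    by move=> Oz; rewrite -(PM z Oz) mulmxA dMP// mul0mx.
  pose u0 : S := (y0, y0 *m P).
  have rho0 : 0 < `|u0| + 1 by rewrite ltr_wpDl.
  have [r DT] := tangent_flow_dom fS FD rho0.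
  have fSS := findim_prod fS fS.
  pose s0 : S * S := (j x, u0).
  have Ds0 : (D `*` ball 0 (`|u0| + 1)) s0.
    by split=> //; exact: ball_norm_succ.
  rewrite -/s0.
  have KO (s : S * S) : (K `*` [set v | `|v| <= r]) s -> O s.1.1.
    by move=> [/= /(fd_sub FD) []].
  (* A variation of x tangent to the distribution remains so: w, its component
     along the kernel, satisfies a linear equation by commutation. Its image
     under P moves with constant velocity and vanishes at time 1, so the
     variation itself ends at 0. *)
  pose w (s : S * S) : V := s.2.1 - f (s.1.1, s.2.1).
  pose q (s : S * S) : S := (s.1.1, s.2.1).
  have lq : linear q by move=> a s t; rewrite /q /= -[RHS]/(_, _).
  pose qL : {linear (S * S)%type -> S} := HB.pack q (GRing.isLinear.Build _ _ _ _ _ lq).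
  have sw : smooth (OS `*` [set: S]) w.
    have oT : open (OS `*` [set: S]) by exact: open_setXT.
    apply: smoothB => //; first exact: (@smooth_linear _ _ _ _ (fst \o snd) fSS).
    apply: (@smooth_comp _ _ _ _ _ OS q f) => //; first by move=> s [[]].
    exact: (@smooth_linear _ _ _ _ qL fSS).
  have dw s : O s.1.1 -> is_diff s w (fun u => u.2.1 -
      (s.2.1 *m 'd M (s.1.1) u.1.1 + u.2.1 *m M s.1.1)).
    move=> Os.
    have i1 := is_diff_comp (linear_is_diff qL s fSS) (df (q s) Os).
    exact: (is_diffB (linear_is_diff (fst \o snd : S * S -> V) s fSS) i1).
  have [C C0 CP] : exists2 C, 0 < C & forall s u, K s -> `|'d f s u| <= C * `|u|.
    apply: (@diff_bound _ _ _ OS) => //; [|exact: fd_sub FD|exact: fd_compact FD].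
    by have /smoothP := sf; exact.
  have wf : w (time1 (tangent_field Z) s0) = 0.
    apply: (time1_invariant fSS DT fV sw (ltW C0)) => //; last first.
      by rewrite /w /s0 /u0 /f /= /y0 -mulmxA MM// subrr.
    move=> [[z a] [y b]] [/= Kz _].
    have Oz : O z by have [] := fd_sub FD Kz.
    have [_ e1] := dw ((z, a), (y, b)) Oz; rewrite e1.
    have [_ e2] := dZ (z, a) Oz.
    rewrite /tangent_field /= e2 /=.
    have -> : - (a *m 'd M z y + b *m M z) - (y *m 'd M z (- f (z, a)) +
        - (a *m 'd M z y + b *m M z) *m M z) = - (a *m 'd M z (w ((z, a), (y, b)))).
      have E1 : y *m 'd M z (- f (z, a)) = - (a *m 'd M z (y *m M z)).
        by rewrite linearN mulmxN /f /= inv.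
      have E2 : (- (a *m 'd M z y + b *m M z)) *m M z = - (b *m M z).
        by rewrite mulNmx mulmxDl -!mulmxA dMM// MM// mulmx0 add0r.
      have E3 : a *m 'd M z (w ((z, a), (y, b))) = a *m 'd M z y - a *m 'd M z (y *m M z).
        by rewrite /w /f [w' in 'd M z w']/= linearB mulmxBr.
      by rewrite E1 E2 E3 !opprD !opprK addrACA addNr addr0.
    rewrite normrN.
    have [_ e3] := df (z, a) Oz.
    have -> : a *m 'd M z (w (z, a, (y, b))) = 'd f (z, a) (w (z, a, (y, b)), 0).
      by rewrite e3 /= mul0mx addr0.
    apply: (le_trans (CP _ _ Kz)); rewrite ler_pM2l//.
    by rewrite prod_normE /= normr0 ge_max lexx normr_ge0.
  have TZ2 z a y b : O z -> 'd Z (z, a) (y, b) = (- (a *m 'd M z y + b *m M z), 0).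
    by move=> Oz; have [_ e] := dZ (z, a) Oz; exact: (congr1 (fun F => F (y, b)) e).
  have [_ e] : (time1 (tangent_field Z) s0).2.2 = s0.2.2 /\
      (time1 (tangent_field Z) s0).2.1 *m P = s0.2.1 *m P + - (s0.2.2 *m P).
    apply: (@time1_linear _ _ _ _ (tangent_field Z) _ _ _ (snd \o snd)
      (mulmxr P \o (fst \o snd)) (fun a => - (a *m P)) s0 fSS DT _ _ Ds0).
      by move=> [[z a] [y b]] /KO Oz; rewrite /= TZ2.
    move=> [[z a] [y b]] /KO Oz; rewrite /= TZ2//=.
    by rewrite mulNmx mulmxDl -!mulmxA dMP// MP// mulmx0 add0r.
  have PP : P *m P = P by rewrite -{2}(MP x Ox) mulmxA PM// MP.
  move: e wf; rewrite /w /f; set t := time1 _ _ => e wf.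
  have Ot : O t.1.1 by apply: KO; exact: (time1_in fSS DT Ds0).
  move/eqP: wf; rewrite subr_eq0 => /eqP ->.
  by rewrite /= -(PM _ Ot) mulmxA e /s0 /u0 /= -mulmxA PP subrr mul0mx.
move=> v vP; rewrite dF// jm vP time1_equilibrium//.
have [_ dZE] := dZ (m, 0) Om.
rewrite /tangent_field /= Z0; congr (_, _).
by rewrite dZE /= !mul0mx addr0 oppr0.
Qed.

End Straightening.

(** * The Frobenius theorem *)

Section Frobenius.
Context {R : realType} {n : nat}.
Notation V := 'rV[R]_n.+1.

(** Spanning by smooth sections: [has_rank] alone is a pointwise condition. *)
Definition extends_locally (O : set V) (P : Defs.distribution R n) (m : V) : Prop :=
  forall v, P m v -> exists (O' : set V) (X : V -> V),
    [/\ open O' /\ O' m, O' `<=` O, vector_field_in O' P X & X m = v].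

Lemma open_forall_ord r (A : 'I_r -> set V) : (forall i, open (A i)) ->
  open [set x | forall i, A i x].
Proof.
move=> oA; rewrite openE => x Ax; rewrite /interior /=.
have H : forall i, \forall y \near x, A i y.
  by move=> i; apply: open_nbhs_nbhs; split; [exact: oA|exact: Ax].
exact: (@filter_forall _ _ A (nbhs x) (nbhs_filter x) H).
Qed.

Lemma has_rank_combination (Q : set V) r k (c : 'rV[R]_k) (A : 'M[R]_(k, n.+1)) :
  has_rank Q r -> (forall i, Q (row i A)) -> Q (c *m A).
Proof.
move=> [E [_ EQ]] QA; apply/EQ; rewrite mulmx_sum_row.
by apply: memv_suml => i _; apply: memvZ; apply/EQ.
Qed.

Lemma free_rows r (A : 'M[R]_(r, n.+1)) : row_free A -> free [tuple row i A | i < r].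
Proof.
move=> fA; apply/freeP => k; under eq_bigr do rewrite -tnth_nth tnth_mktuple.
move=> k0 i.
have : (\row_i k i) *m A = 0.
  by rewrite mulmx_sum_row -[RHS]k0; apply: eq_bigr => j _; rewrite mxE.
rewrite -(mul0mx _ A) => /(row_free_inj fA) /rowP /(_ i).
by rewrite !mxE.
Qed.

Lemma has_rank_rowspace r (A : 'M[R]_(r, n.+1)) : row_free A ->
  has_rank [set v | exists c : 'rV[R]_r, v = c *m A] r.
Proof.
move=> fA; have fX := free_rows fA.
exists <<[tuple row i A | i < r]>>%VS; split.
  by move: fX; rewrite /free size_tuple => /eqP.
move=> v; split=> [vX|[c ->]].
  exists (\row_i coord [tuple row i A | i < r] i v).
  rewrite {1}(coord_span vX) mulmx_sum_row.
  by apply: eq_bigr => i _; rewrite mxE -tnth_nth tnth_mktuple.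
rewrite mulmx_sum_row; apply: memv_suml => i _; apply: memvZ; apply: memv_span.
by apply/mapP; exists i => //; rewrite mem_enum.
Qed.

Lemma has_rank_annihilator k r (J : 'M[R]_(k, n.+1)) : (k + r = n.+1)%N -> row_free J ->
  has_rank [set v : V | v *m J^T = 0] r.
Proof.
move=> krn fJ.
have rk : \rank (kermx J^T) = r.
  by rewrite mxrank_ker mxrank_tr (eqP fJ); apply/eqP; rewrite -(eqn_add2l k) subnKC -krn ?leq_addr.
move: (row_base (kermx J^T)) (row_base_free (kermx J^T)) (eq_row_base (kermx J^T)).
rewrite rk => B fB eqB; have [E [dE EP]] := has_rank_rowspace fB.
exists E; split=> // v; rewrite EP /=; split=> [[c ->]|vJ].
  apply/eqP; rewrite -sub_kermx; apply: submx_trans (submxMl c B) _.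
  by rewrite eqB.
by apply/submxP; rewrite eqB sub_kermx vJ.
Qed.

Lemma has_rank_rows (Q : set V) r (A : 'M[R]_(r, n.+1)) v :
  has_rank Q r -> (forall i, Q (row i A)) -> row_free A -> Q v ->
  exists c : 'rV[R]_r, v = c *m A.
Proof.
move=> [E [dE EQ]] QA fA /EQ vE.
pose X := [tuple row i A | i < r].
have fX : free X := free_rows fA.
have bX : basis_of E X.
  rewrite basisEfree fX dE size_tuple leqnn andbT /=.
  by apply/span_subvP => x /mapP[i _ ->]; apply/EQ.
exists (\row_i coord X i v); rewrite {1}(coord_basis bX vE) mulmx_sum_row.
by apply: eq_bigr => i _; rewrite mxE -tnth_nth tnth_mktuple.
Qed.

(** The sections through a basis of P m, as the rows of a matrix. *)
Lemma local_frame (O : set V) (P : Defs.distribution R n) m r :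
  has_rank (P m) r -> extends_locally O P m -> open O -> O m ->
  exists (O' : set V) (X : V -> 'M[R]_(r, n.+1)),
    [/\ open O' /\ O' m, O' `<=` O, smooth O' X,
        forall x i, O' x -> P x (row i (X x)) & row_free (X m)].
Proof.
move=> [E [<- EP]] Hext oO Om.
have /choice[OX OXP] : forall i : 'I_(\dim E), exists OX : set V * (V -> V),
    [/\ open OX.1 /\ OX.1 m, OX.1 `<=` O, vector_field_in OX.1 P OX.2
      & OX.2 m = (vbasis E)`_i].
  move=> i; have : P m (vbasis E)`_i.
    by apply/EP; apply: vbasis_mem; rewrite mem_nth// size_tuple.
  by move=> /Hext[N1 [X H]]; exists (N1, X).
pose N : set V := O `&` [set x | forall i, (OX i).1 x].
have oN : open N.
  by apply: openI => //; apply: open_forall_ord => i; have [[]] := OXP i.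
have Nm : N m by split=> // i; have [[]] := OXP i.
exists N, (fun x => \matrix_i (OX i).2 x); split.
- by [].
- by move=> x [].
- apply: smooth_mx => // i j.
  have [[op1 _] _ [s1 _] _] := OXP i.
  have := smooth_mx_entry 0 j op1 s1.
  have -> : (fun x => (\matrix_i0 (OX i0).2 x) i j) = (fun x => (OX i).2 x 0 j).
    by apply/funext => x; rewrite mxE.
  by apply: smooth_sub => x [_]; exact.
- move=> x i [_ Ox]; rewrite rowK.
  by have [_ _ [_ H] _] := OXP i; exact: H.
apply: inj_row_free => c; rewrite mulmx_sum_row => c0.
have fE := basis_free (vbasisP E).
apply/rowP => i.
have H : \sum_(j < \dim E) c 0 j *: (vbasis E)`_j = 0.
  rewrite -[RHS]c0; apply: eq_bigr => j _; rewrite rowK.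
  by have [_ _ _ ->] := OXP j.
have /freeP/(_ (fun i => c 0 i) H i) ci := fE.
by rewrite [RHS]mxE -[RHS]ci.
Qed.

Lemma smooth_mulmx (W : normedModType R) p q s (O : set W) (A : W -> 'M[R]_(p, q))
  (B : W -> 'M[R]_(q, s)) : open O -> smooth O A -> smooth O B ->
  smooth O (fun x => A x *m B x).
Proof.
move=> oO sA sB; apply: smooth_mx => // i j.
apply: (@smooth_ext _ _ _ _ (fun x => \sum_k A x i k * B x k j)) => //.
  by move=> x _; rewrite mxE.
by apply: smooth_sum => // k; apply: smoothM => //; exact: smooth_mx_entry.
Qed.

(** Normalizing a frame so that its projection along a fixed complement is
    constant produces commuting fields, to which [straightening] applies. *)
Lemma frobenius_straightening (O : set V) (P : Defs.distribution R n) m r :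
  open O -> O m -> (forall x, O x -> has_rank (P x) r) -> extends_locally O P m ->
  integrable_distribution O P ->
  exists (N : set V) (F : V -> V) (A : 'M[R]_n.+1),
    [/\ open N /\ N m, N `<=` O, smooth N F,
        forall x v, N x -> P x v -> 'd F x v = 0
      & \rank A = r /\ forall v, v *m A = 0 -> 'd F m v = v].
Proof.
move=> oO Om rkP Hext intP.
have [U0 [X [[op0 U0m] U0O sX PX fX]]] := local_frame (rkP m Om) Hext oO Om.
have /row_freeP[L XL] := fX.
have sG : smooth U0 (fun x => X x *m L).
  by apply: smooth_mulmx => //; exact: smooth_cst.
have sdet : smooth U0 (fun x => \det (X x *m L)).
  by apply: smooth_det => // i j; exact: smooth_mx_entry.
pose U1 : set V := [set x | U0 x /\ \det (X x *m L) != 0].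
have op1' : open U1 by apply: open_neq0 => // x Ox; exact: smooth_continuous sdet Ox.
have U1m : U1 m by split=> //=; rewrite XL det1 oner_neq0.
have U1U0 : U1 `<=` U0 by move=> x [].
have unitG x : U1 x -> X x *m L \in unitmx.
  by move=> [_ /=]; rewrite unitmxE unitfE.
(* The projector onto P x along the constant complement v *m L = 0. *)
pose M x := L *m (invmx (X x *m L) *m X x).
pose A := L *m X m.
have sM : smooth U1 M.
  apply: smooth_mulmx => //; first exact: smooth_cst.
  apply: smooth_mulmx => //; last exact: smooth_sub sX.
  apply: smooth_mx => //; apply: smooth_invmx => // i j.
  by apply: smooth_mx_entry => //; exact: smooth_sub sG.
have MA x : U1 x -> M x *m A = A.
  move=> Ox; rewrite /M /A !mulmxA -[L *m _ *m X x *m L]mulmxA.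
  by rewrite -[L *m _ *m (X x *m L)]mulmxA mulVmx ?unitG// mulmx1.
have AM x : U1 x -> A *m M x = M x.
  by move=> Ox; rewrite /M /A !mulmxA -[L *m X m *m L]mulmxA XL mulmx1.
have freeX x : U1 x -> row_free (X x).
  move=> Ox; apply/row_freeP; exists (L *m invmx (X x *m L)).
  by rewrite mulmxA mulmxV ?unitG.
have PM x v : U1 x -> P x v -> v *m M x = v.
  move=> Ox Pv.
  have [c ->] := has_rank_rows (rkP x (U0O _ (U1U0 _ Ox)))
    (fun i => PX x i (U1U0 _ Ox)) (freeX x Ox) Pv.
  by rewrite /M !mulmxA -[c *m X x *m L]mulmxA mulmxK ?unitG.
have secP b : vector_field_in U1 P (fun x => b *m M x).
  split.
    exact: (@smooth_linear_comp _ _ _ _ U1 M (mulmx b) (@findim_mx R _ _)).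
  move=> x Ox; rewrite /M !mulmxA.
  apply: has_rank_combination (rkP x (U0O _ (U1U0 _ Ox))) _ => i.
  exact: PX x i (U1U0 _ Ox).
have dsec (b : V) x u : U1 x -> 'd (fun x => b *m M x) x u = b *m 'd M x u.
  move=> Ox; have dM := differentiableP (smooth_diff sM Ox).
  have [_ e] := is_diff_comp dM (linear_is_diff (mulmx b) (M x) (@findim_mx R _ _)).
  exact: (congr1 (fun F => F u) e).
have dMA x u : U1 x -> 'd M x u *m A = 0.
  move=> Ox; have [_ e] := is_diff_comp (differentiableP (smooth_diff sM Ox))
    (linear_is_diff (mulmxr A) (M x) (@findim_mx R _ _)).
  exact: etrans (esym (congr1 (fun F => F u) e)) (diff_eq0_near u op1' Ox MA).
(* The difference is the bracket of two sections; by involution it lies in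
   P x, and its projection under A is the derivative of a constant. *)
have inv x a b : U1 x -> b *m 'd M x (a *m M x) = a *m 'd M x (b *m M x).
  move=> Ox; apply/eqP; rewrite -subr_eq0; apply/eqP.
  set u := _ - _.
  have Pu : P x u.
    apply: (intP x (U0O _ (U1U0 _ Ox))).
    exists U1, (fun x => a *m M x), (fun x => b *m M x); split=> //.
      by move=> y /U1U0 /U0O.
    exact: (congr2 (fun p q => p - q) (esym (dsec b x (a *m M x) Ox)) (esym (dsec a x (b *m M x) Ox))).
  rewrite -(PM x u Ox Pu) -(AM x Ox) mulmxA.
  by rewrite /u mulmxBl -!mulmxA !dMA// !mulmx0 subrr mul0mx.
have [N [F [[oN Nm] NU1 sF F0 Fm]]] := straightening op1' U1m sM MA AM inv.
exists N, F, A; split=> //.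
- by move=> x /NU1 /U1U0 /U0O.
- by move=> x v Nx Pv; rewrite -(PM x v (NU1 _ Nx) Pv) F0.
split=> //; rewrite /A mxrankMfree//.
apply/eqP; rewrite eqn_leq rank_leq_col /=.
have := mulmx_max_rank (X m) L; rewrite XL.
by have := mxrankM_maxr (X m) L; rewrite XL mxrank1.
Qed.

Lemma row_free_near (W : normedModType R) k p (O : set W) (J : W -> 'M[R]_(k, p)) m :
  open O -> O m -> smooth O J -> row_free (J m) ->
  exists N : set W, [/\ open N, N m, N `<=` O & forall x, N x -> row_free (J x)].
Proof.
move=> oO Om sJ /row_freeP[C JC].
have sdet : smooth O (fun x => \det (J x *m C)).
  apply: smooth_det => // i j; apply: smooth_mx_entry => //.
  by apply: smooth_mulmx => //; exact: smooth_cst.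
exists [set x | O x /\ \det (J x *m C) != 0]; split.
- by apply: open_neq0 => // x Ox; exact: smooth_continuous sdet Ox.
- by split=> //=; rewrite JC det1 oner_neq0.
- by move=> x [].
move=> x [Ox /= dx]; apply/row_freeP; exists (C *m invmx (J x *m C)).
by rewrite mulmxA mulmxV// unitmxE unitfE.
Qed.

(** The gradients as rows, in order to express independence by a rank. *)
Definition gradmx k (F : 'I_k -> V -> R) (x : V) : 'M[R]_(k, n.+1) :=
  \matrix_(i, j) 'D_(delta_mx 0 j) (F i) x.

Lemma diff_gradmx k (F : 'I_k -> V -> R) x v i : differentiable (F i) x ->
  'd (F i) x v = (v *m (gradmx F x)^T) 0 i.
Proof.
move=> dF; rewrite {1}(row_sum_delta v) linear_sum mxE; apply: eq_bigr => j _.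
by rewrite linearZ !mxE deriveE.
Qed.

Lemma row_free_gradmx k (F : 'I_k -> V -> R) x : (forall i, differentiable (F i) x) ->
  row_free (gradmx F x) <->
  (forall a : 'I_k -> R, (forall v, \sum_i a i * 'd (F i) x v = 0) -> forall i, a i = 0).
Proof.
move=> dF.
have E a v : \sum_i a i * 'd (F i) x v = (v *m ((\row_i a i) *m gradmx F x)^T) 0 0.
  rewrite trmx_mul mulmxA mxE; apply: eq_bigr => i _.
  by rewrite diff_gradmx// mulrC; congr (_ * _); rewrite !mxE.
split=> [fJ a a0 i|ind].
  have aJ : (\row_i a i) *m gradmx F x = 0.
    apply/rowP => j; rewrite [RHS]mxE -[RHS](a0 (delta_mx 0 j)) E -rowE.
    by rewrite [RHS]mxE [RHS]mxE.
  move: aJ; rewrite -(mul0mx _ (gradmx F x)) => /(row_free_inj fJ) /rowP /(_ i).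
  by rewrite !mxE.
apply: inj_row_free => c cJ; apply/rowP => i; rewrite [RHS]mxE.
apply: (ind (fun i => c 0 i)) => v.
rewrite E (_ : \row_i c 0 i = c); last by apply/rowP => l; rewrite mxE.
by rewrite cJ trmx0 mulmx0 mxE.
Qed.

Lemma smooth_gradmx k (O : set V) (F : 'I_k -> V -> R) : open O ->
  (forall i, smooth O (F i)) -> smooth O (gradmx F).
Proof.
move=> oO sF; apply: smooth_mx => // i j.
by apply: (smooth_ext oO _ (smooth_derive (delta_mx 0 j) (sF i))) => x _; rewrite mxE.
Qed.

Lemma independent_near k (O : set V) (F : 'I_k -> V -> R) m :
  open O -> O m -> (forall i, smooth O (F i)) ->
  (forall a : 'I_k -> R, (forall v, \sum_i a i * 'd (F i) m v = 0) -> forall i, a i = 0) ->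
  exists O' : set V, [/\ open O', O' m, O' `<=` O & independent O' F].
Proof.
move=> oO Om sF indm.
have dF x i : O x -> differentiable (F i) x by move=> Ox; exact: smooth_diff (sF i) Ox.
have fJ : row_free (gradmx F m) by apply/row_free_gradmx => // i; exact: dF.
have [N [oN Nm NO fN]] := row_free_near oO Om (smooth_gradmx oO sF) fJ.
exists N; split=> // x Nx; apply/row_free_gradmx; last exact: fN.
by move=> i; apply: dF; exact: NO.
Qed.

(** The map F given by the straightening is constant along P and has at m a
    differential of corank r; k suitable coordinates of it are independent. *)
Theorem frobenius (O : set V) (P : Defs.distribution R n) m r k :
  open O -> O m -> (k + r = n.+1)%N -> (forall x, O x -> has_rank (P x) r) ->
  extends_locally O P m -> integrable_distribution O P ->
  exists (N : set V) (F : 'I_k -> V -> R),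
    [/\ open N, N m, N `<=` O, forall i, first_integral N P (F i) & independent N F].
Proof.
move=> oO Om krn rkP Hext intP.
have [N [F [A [[oN Nm] NO sF F0 [rA Fm]]]]] := frobenius_straightening oO Om rkP Hext intP.
have rk : \rank (kermx A) = k by rewrite mxrank_ker rA -krn addnK.
move: (row_base (kermx A)) (row_base_free (kermx A)) (eq_row_base (kermx A)).
rewrite rk => Bs fB eqB.
have /row_freeP[C BC] := fB.
(* C is a right inverse of a basis of ker A, on which dF_m is the identity:
   the gradients of the G i at m are dual to this basis. *)
pose G (i : 'I_k) x := (F x *m C) 0 i.
have sG i : smooth N (G i).
  exact: (@smooth_linear_comp _ _ _ _ N F (rv_coord i \o mulmxr C) (@findim_rV R _)).
have dG i x v : N x -> 'd (G i) x v = ('d F x v *m C) 0 i.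
  move=> Nx; have dF := differentiableP (smooth_diff sF Nx).
  have [_ e] := is_diff_comp dF (linear_is_diff (rv_coord i \o mulmxr C) (F x) (@findim_rV R _)).
  exact: (congr1 (fun F => F v) e).
have [|N1 [op2 N1m N1N indep]] := independent_near oN Nm sG.
  move=> a a0 i; have := a0 (row i Bs).
  have rB : row i Bs *m A = 0.
    apply/eqP; rewrite -sub_kermx; apply: submx_trans (row_sub i Bs) _.
    by rewrite eqB.
  under eq_bigr do rewrite dG// Fm// -row_mul BC mxE.
  rewrite (bigD1 i)//= big1 ?addr0; last first.
    by move=> j ji; rewrite mxE eq_sym (negbTE ji) mulr0.
  by rewrite mxE eqxx mulr1.
exists N1, G; split=> //.
- by move=> x /N1N /NO.
move=> i; split; first exact: smooth_sub (sG i).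
by move=> x v N1x Pv; rewrite dG ?F0 ?mul0mx ?mxE//; exact: N1N.
Qed.

End Frobenius.

(** * Symmetry of second derivatives *)

Section Schwarz.
Context {R : realType}.

(** The second difference of f with sides t u and t v is symmetric in u and v.
    Two applications of the mean value theorem show that it is
    t^2 (D_v D_u f + o(1)), and exchanging the roles t^2 (D_u D_v f + o(1)). *)
Lemma schwarz_scalar (V : normedModType R) (O : set V) (f : V -> R) x u v :
  findim V -> open O -> O x -> smooth O f ->
  'D_u ('D_v f) x = 'D_v ('D_u f) x.
Proof.
move=> fV oO Ox sf.
have key (a b : V) (e : R) : 0 < e -> exists2 d, 0 < d & forall t : R, 0 < t -> t < d ->
    `|f (x + t *: a + t *: b) - f (x + t *: a) - (f (x + t *: b) - f x)
       - t ^+ 2 * 'D_b ('D_a f) x| <= t ^+ 2 * e.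
  move=> e0.
  have sa := smooth_derive a sf.
  have sb := smooth_derive b sa.
  have cb : {for x, continuous ('D_b ('D_a f))} by exact: smooth_continuous sb Ox.
  have nO : nbhs x O by exact: open_nbhs_nbhs.
  have nb : \forall y \near x, `|'D_b ('D_a f) x - 'D_b ('D_a f) y| < e.
    by have /cvgrPdist_lt := cb; apply.
  have nOb : nbhs x (fun y => O y /\ `|'D_b ('D_a f) x - 'D_b ('D_a f) y| < e).
    by move: nO nb; exact: filterI.
  have /nbhs_ballP[d /= d0 dP] := nOb.
  have ab0 : 0 < `|a| + `|b| + 1 by rewrite ltr_wpDl// addr_ge0.
  exists (d / (`|a| + `|b| + 1)); first by rewrite divr_gt0.
  move=> t t0; rewrite ltr_pdivlMr// => td.
  have near p q : 0 <= p <= 1 -> 0 <= q <= 1 ->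
      ball x d (x + (p * t) *: a + (q * t) *: b).
    move=> /andP[p0 p1] /andP[q0 q1].
    rewrite -ball_normE /= -addrA opprD addNKr normrN (le_lt_trans _ td)//.
    rewrite (le_trans (ler_normD _ _))// !normrZ (ger0_norm p0) (ger0_norm q0).
    rewrite (gtr0_norm t0).
    have h1 : p * t * `|a| <= t * `|a| by rewrite ler_wpM2r// ler_piMl// ltW.
    have h2 : q * t * `|b| <= t * `|b| by rewrite ler_wpM2r// ler_piMl// ltW.
    by rewrite !mulrDr mulr1; have := ltW t0; lra.
  pose g y := f (y + t *: b) - f y.
  have dg s : 0 <= s <= 1 ->
      is_diff (x + s *: (t *: a)) g (fun w => 'd f (x + s *: (t *: a) + t *: b) w - 'd f (x + s *: (t *: a)) w).
    move=> s01; set y := x + s *: (t *: a).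
    have Oyb : O (y + t *: b).
      have s11 : 0 <= (1 : R) <= 1 by rewrite ler01 lexx.
      have := near s 1 s01 s11; rewrite mul1r -scalerA => H.
      by have [] := dP _ H.
    have Oy : O y.
      have s00 : 0 <= (0 : R) <= 1 by rewrite ler01 lexx.
      have := near s 0 s01 s00; rewrite mul0r scale0r addr0 -scalerA => H.
      by have [] := dP _ H.
    have d1 : is_diff y (fun y => y + t *: b) id.
      rewrite (_ : (fun y : V => y + t *: b) = id + cst (t *: b))//.
      by apply: is_diff_eq; rewrite addr0.
    have d2 := is_diff_comp d1 (differentiableP (smooth_diff sf Oyb)).
    exact: (is_diffB d2 (differentiableP (smooth_diff sf Oy))).
  have [s s01 Es] : exists2 s : R, 0 <= s <= 1 &
      g (x + t *: a) - g x = 'd g (x + s *: (t *: a)) (t *: a).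
    apply: mean_value_direction => s s01; by case: (dg s s01).
  have Oys q : 0 <= q <= 1 -> O (x + s *: (t *: a) + q *: (t *: b)) /\
      `|'D_b ('D_a f) x - 'D_b ('D_a f) (x + s *: (t *: a) + q *: (t *: b))| < e.
    by move=> q01; rewrite !scalerA; apply: dP; exact: near.
  have E2 : 'd g (x + s *: (t *: a)) (t *: a) =
     t * ('D_a f (x + s *: (t *: a) + t *: b) - 'D_a f (x + s *: (t *: a))).
    have s11 : 0 <= (1 : R) <= 1 by rewrite ler01 lexx.
    have s00 : 0 <= (0 : R) <= 1 by rewrite ler01 lexx.
    have := (Oys 1 s11).1; rewrite scale1r => o1.
    have := (Oys 0 s00).1; rewrite scale0r addr0 => o2.
    case: (dg s s01) => _ ->.
    rewrite (deriveE _ (smooth_diff sf o1)) (deriveE _ (smooth_diff sf o2)).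
    rewrite mulrBr; congr (_ - _); exact: linearZ.
  have [q q01 Eq] : exists2 q : R, 0 <= q <= 1 &
      'D_a f (x + s *: (t *: a) + t *: b) - 'D_a f (x + s *: (t *: a)) =
      'd ('D_a f) (x + s *: (t *: a) + q *: (t *: b)) (t *: b).
    apply: (@mean_value_direction R V ('D_a f) (x + s *: (t *: a)) (t *: b)) => q q01.
    exact: smooth_diff sa (Oys q q01).1.
  have E3 : 'd ('D_a f) (x + s *: (t *: a) + q *: (t *: b)) (t *: b) =
      t * 'D_b ('D_a f) (x + s *: (t *: a) + q *: (t *: b)).
    rewrite (deriveE _ (smooth_diff sa (Oys q q01).1)); exact: linearZ.
  have [_ He] := Oys q q01.
  have -> : f (x + t *: a + t *: b) - f (x + t *: a) - (f (x + t *: b) - f x) =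
     t ^+ 2 * 'D_b ('D_a f) (x + s *: (t *: a) + q *: (t *: b)).
    by rewrite -[LHS]/(g (x + t *: a) - g x) Es E2 Eq E3 expr2 mulrA.
  rewrite -mulrBr normrM ger0_norm ?exprn_ge0 ?(ltW t0)//.
  apply: ler_wpM2l; first exact: exprn_ge0 (ltW t0).
  by rewrite distrC; exact: ltW.
apply/eqP; rewrite -subr_eq0 -normr_le0; apply/ler_addgt0Pr => e e0.
have e2 : 0 < e / 2 by rewrite divr_gt0.
have [d d0 dP] := key u v _ e2.
have [d' d'0 d'P] := key v u _ e2.
pose t := Num.min d d' / 2.
have m0 : 0 < Num.min d d' by rewrite lt_min d0.
have t0 : 0 < t by rewrite divr_gt0.
have tm : t < Num.min d d' by rewrite /t gtr_pMr// invf_lt1// ltr1n.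
move: tm; rewrite lt_min => /andP[td td'].
have := dP t t0 td; have := d'P t t0 td'.
rewrite [x + t *: v + t *: u]addrAC.
have t2 : 0 < t ^+ 2 by rewrite exprn_gt0.
set Q := f (x + t *: u + t *: v); set a1 := f (x + t *: u); set a2 := f (x + t *: v).
set p := 'D_u _ x; set q := 'D_v _ x.
clearbody Q a1 a2 p q; move=> h1 h2.
rewrite add0r -(ler_pM2l t2) -{1}(ger0_norm (ltW t2)) -normrM.
have -> : t ^+ 2 * (p - q) = (Q - a1 - (a2 - f x) - t ^+ 2 * q) - (Q - a2 - (a1 - f x) - t ^+ 2 * p) by ring.
apply: le_trans (ler_normB _ _) _; apply: le_trans (lerD h2 h1) _.
by rewrite -mulrDr -splitr.
Qed.

Lemma schwarz (V W : normedModType R) (O : set V) (f : V -> W) x u v :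
  findim V -> findim W -> open O -> O x -> smooth O f ->
  'D_u ('D_v f) x = 'D_v ('D_u f) x.
Proof.
move=> fV fW oO Ox sf; have [n [e [c [cc ce]]]] := fW.
have dc i (g : V -> W) w y : smooth O g -> O y -> 'D_w (c i \o g) y = c i ('D_w g y).
  move=> sg Oy; have dg := differentiableP (smooth_diff sg Oy).
  have [d1 e1] := is_diff_comp dg (linear_is_diff (c i) (g y) fW).
  rewrite (deriveE _ (smooth_diff sg Oy)) (deriveE _ d1).
  exact: (congr1 (fun F => F w) e1).
have ddc i a b : 'D_a ('D_b (c i \o f)) x = c i ('D_a ('D_b f) x).
  rewrite -(dc i _ _ _ (smooth_derive b sf) Ox); apply: near_eq_derive.
  near=> y; rewrite (dc i f b y sf)//; near: y; exact: open_nbhs_nbhs.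
refine (etrans (ce _) (etrans _ (esym (ce _)))).
apply: eq_bigr => i _; apply: (congr1 (fun r => r *: e i)).
rewrite -!ddc; apply: (schwarz_scalar _ _ fV oO Ox).
exact: (smooth_linear_comp (c i) fW oO sf).
Unshelve. all: by end_near. Qed.

End Schwarz.

(** * Local flow of a vector field *)

Section LocalFlow.
Context {R : realType}.

Lemma is_diff_flow_field (V : normedModType R) (O : set V) (X : V -> V) (x : V) (t : R) :
  findim V -> O x -> smooth O X ->
  is_diff (x, t) (fun s : V * R => s.2 *: X s.1)
    (fun u => t *: 'd X x u.1 + u.2 *: X x).
Proof.
move=> fV Ox sX.
have dX := smooth_diff sX Ox.
have fVR := findim_prod fV (@findim_R R).
have i1 := linear_is_diff (fst : V * R -> V) (x, t) fVR.
have i2 := linear_is_diff (snd : V * R -> R) (x, t) fVR.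
have [d3 e3] := is_diff_comp i1 (differentiableP dX : is_diff (fst (x, t)) X _).
have [d2 e2] := i2.
have [d e] := is_diff_scale d2 d3.
apply: DiffDef; first exact: d.
apply/funext => u; rewrite [LHS](congr1 (fun F => F u) e) e2 addrC.
by congr (_ *: _ + _); exact: (congr1 (fun F => F u) e3).
Qed.

(** The rescaled field t X, with t as part of the state, has a zero at t = 0,
    and its time-one map is the flow of X at time t. The last clause transfers
    [time1_invariant] to the linearized flow: a condition w(x, u) = 0 on tangent
    vectors is preserved provided that w varies along the linearized field by
    a multiple of itself. *)
Theorem local_flow (V : normedModType R) (O : set V) (X : V -> V) (m : V) :
  findim V -> open O -> O m -> smooth O X ->
  exists (N : set (V * R)) (phi : V * R -> V),
    [/\ open N /\ N (m, 0), smooth N phi, forall p, N p -> O (phi p),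
        [/\ phi (m, 0) = m, forall u, 'd phi (m, 0) (u, 0) = u
          & forall p, N p -> 'd phi p (0, 1) = X (phi p)]
      & forall (V' : normedModType R) (w : V * V -> V') (c : V -> R),
          findim V' -> smooth (O `*` [set: V]) w ->
          (forall x, O x -> {for x, continuous c}) ->
          (forall x u, O x -> `|'d w (x, u) (X x, 'd X x u)| <= c x * `|w (x, u)|) ->
          forall p u, N p -> w (p.1, u) = 0 -> w (phi p, 'd phi p (u, 0)) = 0].
Proof.
move=> fV oO Om sX.
have fVR := findim_prod fV (@findim_R R).
pose S := (V * R * R)%type.
have fS : findim S by exact: findim_prod fVR (@findim_R R).
have fSS := findim_prod fS fS.
pose OS : set S := (O `*` setT) `*` setT.
have oOS : open OS by do 2 apply: open_setXT.
(* The last component measures the time elapsed; its variation q is used to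
   compare the derivative in t with X. *)
pose Z (s : S) : S := ((s.1.2 *: X s.1.1, 0), s.1.2).
have s11 : smooth OS (fun s : S => s.1.1) by apply: (smooth_linearP fS).
have s12 : smooth OS (fun s : S => s.1.2) by apply: (smooth_linearP fS).
have sZ : smooth OS Z.
  apply: smooth_pair => //; apply: smooth_pair => //; last exact: smooth_cst.
  apply: smoothZ => //.
  by apply: (@smooth_comp _ _ _ _ OS O (fun s : S => s.1.1) X) => // s [[]].
have dZ x t r : O x -> is_diff ((x, t), r) Z
    (fun u => ((t *: 'd X x u.1.1 + u.1.2 *: X x, 0), u.1.2)).
  move=> Ox.
  have i1 := linear_is_diff (fst : S -> _) ((x, t), r) fS.
  have i2 := linear_is_diff (snd \o fst : S -> R) ((x, t), r) fS.
  have i3 := is_diff_comp i1 (is_diff_flow_field t fV Ox sX).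
  exact: (is_diff_pair (is_diff_pair i3 (is_diff_cst 0 _)) i2).
have Z0 : Z ((m, 0), 0) = 0 by rewrite /Z /= scale0r.
have OSm : OS ((m, 0), 0) by [].
have [K [D [FD Dm]]] := equilibrium_flow_dom fS oOS OSm sZ Z0.
pose j (p : V * R) : S := (p, 0).
have dj p : is_diff p j (fun u => (u, 0)).
  exact: (is_diff_pair (is_diff_id p) (is_diff_cst 0 p)).
have sj : smooth setT j.
  apply: smooth_pair; [exact: openT|exact: smooth_id|exact: smooth_cst].
pose N := j @^-1` D.
have oN : open N.
  by apply: open_comp; [move=> y _; exact: (smooth_continuous sj)|exact: fd_openW FD].
pose phi p := (time1 Z (j p)).1.1.
have sphi : smooth N phi.
  apply: (@smooth_linear_comp _ _ _ _ N (fun p => time1 Z (j p)) (fst \o fst)) => //.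
  apply: (@smooth_comp _ _ _ _ N D j (time1 Z)) => //; first exact: smooth_sub sj.
  exact: time1_smooth FD.
have Ophi p : N p -> O (phi p).
  by move=> Np; have /(fd_sub FD) [[]] := time1_in fS FD Np.
have dphi p u : N p -> 'd phi p u = (time1 (tangent_field Z) (j p, (u, 0))).2.1.1.
  move=> Np; have [d1 ->] := time1_tangent fS FD Np.
  have [_ e] := is_diff_comp (is_diff_comp (dj p) (differentiableP d1))
     (linear_is_diff (fst \o fst : S -> V) (time1 Z (j p)) fS).
  exact: (congr1 (fun F => F u) e).
have phiE p u : N p -> phi p = (time1 (tangent_field Z) (j p, (u, 0))).1.1.1.
  by move=> Np; have [d1 ->] := time1_tangent fS FD Np.
have TZE x t r u a q : O x -> tangent_field Z (((x, t), r), ((u, a), q)) =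
    (((t *: X x, 0), t), ((t *: 'd X x u + a *: X x, 0), a)).
  move=> Ox; rewrite /tangent_field /=; congr (_, _).
  by have [_ e] := dZ x t r Ox; exact: (congr1 (fun F => F ((u, a), q)) e).
have cK := fd_compact FD.
have KO (s : S) : K s -> O s.1.1 by move=> /(fd_sub FD) [[]].
have Tdom (u0 : S) : exists r, flow_dom (tangent_field Z) (OS `*` [set: S])
     (K `*` [set v | `|v| <= r]) (D `*` ball 0 (`|u0| + 1)).
  by apply: tangent_flow_dom => //; rewrite ltr_wpDl.
have Din (u0 : S) p : N p -> (D `*` ball 0 (`|u0| + 1)) (j p, u0).
  by move=> Np; split=> //; exact: ball_norm_succ.
have oOT : open (OS `*` [set: S]) by exact: open_setXT.
have s111 : smooth (OS `*` [set: S]) (fun s : S * S => s.1.1.1).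
  by apply: (smooth_linearP fSS).
have O111 (s : S * S) : (OS `*` [set: S]) s -> O s.1.1.1 by move=> [[[]]].
have sX1 : smooth (OS `*` [set: S]) (fun s : S * S => X s.1.1.1).
  exact: (@smooth_comp _ _ _ _ _ O (fun s : S * S => s.1.1.1) X fV oOT O111 s111 sX).
exists N, phi; split=> //.
- split; first by rewrite /phi time1_equilibrium.
    move=> u; rewrite dphi// time1_equilibrium// TZE//.
    by rewrite !scale0r addr0.
  move=> p Np; rewrite dphi// (phiE p (0, 1) Np).
  pose u0 : S := ((0, 1), 0).
  have [r DT] := Tdom u0.
  pose s0 : S * S := (j p, u0); rewrite -/s0.
  have Ds0 : (D `*` ball 0 (`|u0| + 1)) s0 := Din u0 p Np.
  have [_ q1] : (time1 (tangent_field Z) s0).2.1.2 = s0.2.1.2 /\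
      (time1 (tangent_field Z) s0).2.2 = s0.2.2 + s0.2.1.2.
    apply: (@time1_linear _ _ _ _ (tangent_field Z) _ _ _ (snd \o (fst \o snd))
      (snd \o snd) id s0 fSS DT _ _ Ds0).
      move=> [[[x t] z] [[u a] q]] [/= /KO Ox _].
      exact: (congr1 (fun T : S * S => T.2.1.2) (TZE x t z u a q Ox)).
    move=> [[[x t] z] [[u a] q]] [/= /KO Ox _].
    exact: (congr1 (fun T : S * S => T.2.2) (TZE x t z u a q Ox)).
  (* The variation of x in the direction of t is q X, where q grows from 0 to 1. *)
  pose w (s : S * S) : V := s.2.1.1 - s.2.2 *: X s.1.1.1.
  have sw : smooth (OS `*` [set: S]) w.
    apply: smoothB => //; first by apply: (smooth_linearP fSS).
    apply: smoothZ => //.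
    by apply: (smooth_linearP fSS).
  have dw x t z u a q v : O x -> 'd w (((x, t), z), ((u, a), q)) v =
      v.2.1.1 - (q *: 'd X x v.1.1.1 + v.2.2 *: X x).
    move=> Ox; set s := (_, _).
    pose g (s : S * S) : V * R := (s.1.1.1, s.2.2).
    have lg : linear g by move=> k x1 x2; rewrite /g /= -[RHS]/(_, _).
    pose gL : {linear (S * S)%type -> (V * R)%type} := HB.pack g (GRing.isLinear.Build _ _ _ _ _ lg).
    have i1 := is_diff_comp (linear_is_diff gL s fSS) (is_diff_flow_field q fV Ox sX).
    have [_ e] := is_diffB (linear_is_diff (fst \o (fst \o snd) : S * S -> V) s fSS) i1.
    exact: (congr1 (fun F => F v) e).
  have [C C0 CP] : exists2 C, 0 < C & forall s v, K s -> `|'d Z s v| <= C * `|v|.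
    apply: (@diff_bound _ _ _ OS) => //; last exact: fd_sub FD.
    by have /smoothP := sZ; exact.
  have wf : w (time1 (tangent_field Z) s0) = 0.
    apply: (time1_invariant fSS DT fV sw (ltW C0)) => //; last first.
      by rewrite /w /s0 /u0 /= scale0r subrr.
    move=> [[[x t] z] [[u a] q]] [/= Ks _].
    have Ox := KO _ Ks; rewrite TZE// dw//=.
    have -> : t *: 'd X x u + a *: X x - (q *: 'd X x (t *: X x) + a *: X x) =
        t *: 'd X x (u - q *: X x).
      have e1 : 'd X x (t *: X x) = t *: 'd X x (X x) by rewrite linearZ.
      have e2 : 'd X x (u - q *: X x) = 'd X x u - q *: 'd X x (X x).
        by rewrite linearB linearZ.
      rewrite e1 e2 opprD addrACA subrr addr0 scalerBr !scalerA.
      by rewrite [q * t]mulrC.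
    have := CP _ ((u - q *: X x, 0), 0) Ks.
    have [_ e] := dZ x t z Ox; rewrite e /= scale0r addr0.
    rewrite !prod_normE /= !normr0.
    by rewrite !(max_l (normr_ge0 _)) /w.
  move/eqP: wf; rewrite /w q1 /= add0r scale1r subr_eq0 => /eqP.
  exact.
move=> V' w c fV' sw cc wP p u Np wp0; rewrite dphi// (phiE p (u, 0) Np).
pose u0 : S := ((u, 0), 0).
have [r DT] := Tdom u0.
pose s0 : S * S := (j p, u0); rewrite -/s0.
have Ds0 : (D `*` ball 0 (`|u0| + 1)) s0 := Din u0 p Np.
have fVV := findim_prod fV fV.
pose q (s : S * S) : V * V := (s.1.1.1, s.2.1.1).
have lq : linear q by move=> k x1 x2; rewrite /q /= -[RHS]/(_, _).
pose qL : {linear (S * S)%type -> (V * V)%type} := HB.pack q (GRing.isLinear.Build _ _ _ _ _ lq).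
(* The variation of t is constantly 0; including it in the invariant bounds
   the term it contributes to the derivative of w. *)
pose wh (s : S * S) : V' * R := (w (q s), s.2.1.2).
have oOV : open (O `*` [set: V]) by exact: open_setXT.
have sq : smooth (OS `*` [set: S]) q by exact: (@smooth_linear _ _ _ _ qL fSS).
have Oq s : (OS `*` [set: S]) s -> (O `*` [set: V]) (q s) by move=> [[[]]].
have swh : smooth (OS `*` [set: S]) wh.
  apply: smooth_pair => //.
    exact: (@smooth_comp _ _ _ _ _ (O `*` setT) q w fVV oOT Oq sq sw).
  by apply: (smooth_linearP fSS).
pose KK : set (S * S) := K `*` [set v | `|v| <= r].
have cKK : compact KK := fd_compact DT.
have KKO s : KK s -> O s.1.1.1 by move=> [/KO].
have [B1 B10 B1P] : exists2 B, 0 < B & forall s, KK s -> `|s.1.1.2| <= B.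
  apply: (@compact_norm_bound _ _ _ KK (fun s => s.1.1.2 : R) cKK) => s _.
  have c1 := @findim_linear_continuous _ _ _ (snd \o (fst \o fst) : S * S -> R) fSS.
  exact: c1.
have [B2 B20 B2P] : exists2 B, 0 < B & forall s, KK s -> `|c s.1.1.1| <= B.
  apply: (@compact_norm_bound _ _ _ KK (fun s => c s.1.1.1 : R) cKK) => s Ks.
  have c1 := @findim_linear_continuous _ _ _ (fst \o (fst \o fst) : S * S -> V) fSS.
  apply: (continuous_comp (c1 s)); apply: cc; exact: KKO.
have [B3 B30 B3P] : exists2 B, 0 < B & forall s, KK s -> `|'d w (q s) (0, X s.1.1.1)| <= B.
  apply: (@compact_norm_bound _ _ _ KK (fun s => 'd w (q s) (0, X s.1.1.1)) cKK) => s Ks.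
  pose g (s : S * S) : (V * V) * (V * V) := (q s, (0, X s.1.1.1)).
  have sg : smooth (OS `*` [set: S]) g.
    apply: (smooth_pair oOT sq); apply: (smooth_pair oOT _ sX1).
    exact: smooth_cst.
  have stw := smooth_tangent fVV oOV sw.
  have sgw : smooth (OS `*` [set: S]) (fun s => 'd w (q s) (0, X s.1.1.1)).
    apply: (@smooth_comp _ _ _ _ _ ((O `*` setT) `*` setT) g
      (fun z : (V * V) * (V * V) => 'd w (z.1) z.2) (findim_prod fVV fVV) oOT _ sg stw).
    by move=> z Oz; split=> //; exact: Oq.
  apply: (smooth_continuous sgw); split=> //=; split; last by [].
  by split=> //; exact: KKO Ks.
have wf : wh (time1 (tangent_field Z) s0) = 0.
  have B0 : 0 <= B1 * B2 + B3 by rewrite addr_ge0 ?mulr_ge0// ltW.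
  apply: (time1_invariant fSS DT (findim_prod fV' (@findim_R R)) swh B0) => //; last first.
    by rewrite /wh /q /s0 /u0 /= wp0.
  move=> [[[x t] z] [[v a] k]] Ks.
  have Ox := KKO _ Ks; rewrite TZE//=.
  have dwxv : differentiable w (x, v) by apply: smooth_diff sw _.
  set s : S * S := (_, (v, a, k)).
  have i1 := is_diff_comp (linear_is_diff qL s fSS) (differentiableP dwxv : is_diff (qL s) w _).
  have [_ e] := is_diff_pair i1 (linear_is_diff (snd \o (fst \o snd) : S * S -> R) s fSS).
  rewrite [X in `|X|](congr1 (fun F => F (((t *: X x, 0), t), ((t *: 'd X x v + a *: X x, 0), a))) e) /=.
  have -> : 'd w (x, v) (q (t *: X x, 0, t, (t *: 'd X x v + a *: X x, 0, a))) =
      t *: 'd w (x, v) (X x, 'd X x v) + a *: 'd w (x, v) (0, X x).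
    rewrite /q /=.
    have -> : (t *: X x, t *: 'd X x v + a *: X x) = t *: (X x, 'd X x v) + a *: (0, X x).
      by rewrite -[RHS]/(_ + _, _ + _) /= scaler0 addr0.
    by rewrite linearD !linearZ.
  have wle : `|w (x, v)| <= `|wh s| by rewrite prod_normE /= le_max lexx.
  have ale : `|a| <= `|wh s| by rewrite prod_normE /= le_max lexx orbT.
  rewrite [X in X <= _]prod_normE /= normr0 max_l//.
  rewrite (le_trans (ler_normD _ _))// mulrDl lerD//.
    rewrite normrZ -mulrA; apply: ler_pM => //; first exact: (B1P s Ks).
    apply: (le_trans (wP x v Ox)); apply: (le_trans (ler_wpM2r _ (ler_norm _))) => //.
    by apply: ler_pM => //; exact: (B2P s Ks).
  rewrite normrZ mulrC; apply: ler_pM => //.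
  exact: (B3P s Ks).
exact: (congr1 fst wf).
Qed.

End LocalFlow.

(** * Linear algebra of the contact hyperplane *)

Section ContactAlgebra.
Context {R : realType}.
Notation V := 'rV[R]_5.
Implicit Types (m u v w : V) (E : @monge_ampere R).

Definition vec5 (x y z p q : R) : V := \row_i nth 0 [:: x; y; z; p; q] i.

Lemma row5P v w : v 0 ix = w 0 ix -> v 0 iy = w 0 iy -> v 0 iz = w 0 iz ->
  v 0 ip = w 0 ip -> v 0 iq = w 0 iq -> v = w.
Proof.
move=> hx hy hz hp hq; apply/rowP => -[[|[|[|[|[|//]]]]] Hi].
- by rewrite (_ : Ordinal Hi = ix)//; exact: val_inj.
- by rewrite (_ : Ordinal Hi = iy)//; exact: val_inj.
- by rewrite (_ : Ordinal Hi = iz)//; exact: val_inj.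
- by rewrite (_ : Ordinal Hi = ip)//; exact: val_inj.
- by rewrite (_ : Ordinal Hi = iq)//; exact: val_inj.
Qed.

(** The form dU = dx /\ dp + dy /\ dq. *)
Definition symp v w : R := wedge ix ip v w + wedge iy iq v w.

(** Contact vectors are determined by their components along x, y, p, q. *)
Definition clift m (a b c d : R) : V := vec5 a b (m 0 ip * a + m 0 iq * b) c d.

(** The endomorphism A of the contact hyperplane that represents omega with
    respect to dU; it factors through the projection forgetting dz. *)
Definition charop E m v : V :=
  clift m (cB E m / 2 * v 0 ix - cA E m * v 0 iy - cN E m * v 0 iq)
         (cC E m * v 0 ix - cB E m / 2 * v 0 iy + cN E m * v 0 ip)
         (cD E m * v 0 iy + cB E m / 2 * v 0 ip + cC E m * v 0 iq)
         (- cD E m * v 0 ix - cA E m * v 0 ip - cB E m / 2 * v 0 iq).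

Lemma contact_clift m a b c d : contact m (clift m a b c d).
Proof. by rewrite /contact /= /contact_form !mxE /=; ring. Qed.

Lemma contact_charop E m v : contact m (charop E m v).
Proof. exact: contact_clift. Qed.

Lemma omega_charop E m v w : omega E m v w = symp (charop E m v) w.
Proof. by rewrite /omega /symp /charop /wedge !mxE /=; field. Qed.

Lemma omega_skew E m v w : omega E m v w = - omega E m w v.
Proof. by rewrite /omega /wedge; ring. Qed.

Lemma omega_line E m v a : omega E m v (a *: v) = 0.
Proof. by rewrite /omega /wedge !mxE; ring. Qed.

Lemma symp_skew v w : symp v w = - symp w v.
Proof. by rewrite /symp /wedge; ring. Qed.

Lemma sympDl u v w : symp (u + v) w = symp u w + symp v w.
Proof. by rewrite /symp /wedge !mxE; ring. Qed.

Lemma sympZl a v w : symp (a *: v) w = a * symp v w.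
Proof. by rewrite /symp /wedge !mxE; ring. Qed.

Lemma symp0 w : symp 0 w = 0.
Proof. by rewrite /symp /wedge !mxE; ring. Qed.

Lemma contactD m v w : contact m v -> contact m w -> contact m (v + w).
Proof. by rewrite /contact /= /contact_form !mxE => h1 h2; lra. Qed.

Lemma contactZ m a v : contact m v -> contact m (a *: v).
Proof.
rewrite /contact /= /contact_form !mxE => h.
have -> : a * v 0 iz - m 0 ip * (a * v 0 ix) - m 0 iq * (a * v 0 iy) =
  a * (v 0 iz - m 0 ip * v 0 ix - m 0 iq * v 0 iy) by ring.
by rewrite h mulr0.
Qed.

Lemma contact_vec m v : contact m v ->
  v = clift m (v 0 ix) (v 0 iy) (v 0 ip) (v 0 iq).
Proof.
rewrite /contact /= /contact_form => h.
by apply: row5P; rewrite !mxE //=; lra.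
Qed.

Lemma symp_nondegenerate m v : contact m v ->
  (forall w, contact m w -> symp v w = 0) -> v = 0.
Proof.
move=> cv v0; rewrite (contact_vec cv).
have h1 := v0 _ (contact_clift m 1 0 0 0); have h2 := v0 _ (contact_clift m 0 1 0 0).
have h3 := v0 _ (contact_clift m 0 0 1 0); have h4 := v0 _ (contact_clift m 0 0 0 1).
move: h1 h2 h3 h4; rewrite /symp /wedge !mxE /= => h1 h2 h3 h4.
have e1 : v 0 ip = 0 by lra.
have e2 : v 0 iq = 0 by lra.
have e3 : v 0 ix = 0 by lra.
have e4 : v 0 iy = 0 by lra.
by apply: row5P; rewrite !mxE /= ?e1 ?e2 ?e3 ?e4; ring.
Qed.

Lemma characteristicP E m v :
  characteristic E m v <-> contact m v /\ charop E m v = 0.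
Proof.
split=> [[cv Ov]|[cv Av]]; split=> //.
  apply: symp_nondegenerate (contact_charop E m v) _ => w cw.
  by rewrite -omega_charop; exact: Ov.
by move=> w cw; rewrite omega_charop Av symp0.
Qed.

Lemma omega_characteristic E m v w : characteristic E m v -> omega E m v w = 0.
Proof.
by move=> /characteristicP[_ Av]; rewrite omega_charop Av symp0.
Qed.

(** The contraction of omega /\ dU = 0 with four vectors. *)
Lemma effective E m v a b c :
  symp v a * omega E m b c + symp v b * omega E m c a + symp v c * omega E m a b
  + omega E m v a * symp b c + omega E m v b * symp c a + omega E m v c * symp a b = 0.
Proof. by rewrite /omega /symp /wedge; field. Qed.

(** On C, A^2 is the multiplication by a quarter of the discriminant. *)
Lemma charop_sq E m v :
  cB E m ^+ 2 - 4 * cA E m * cC E m + 4 * cN E m * cD E m = 0 ->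
  charop E m (charop E m v) = 0.
Proof.
move=> par.
have sq : [/\ charop E m (charop E m v) 0 ix = 0, charop E m (charop E m v) 0 iy = 0,
    charop E m (charop E m v) 0 ip = 0 & charop E m (charop E m v) 0 iq = 0].
  pose disc := (cB E m ^+ 2 - 4 * cA E m * cC E m + 4 * cN E m * cD E m) / 4.
  have d0 : disc = 0 by rewrite /disc par mul0r.
  split; [rewrite -(mul0r (v 0 ix))|rewrite -(mul0r (v 0 iy))|rewrite -(mul0r (v 0 ip))
    |rewrite -(mul0r (v 0 iq))]; by rewrite -d0 /disc !mxE /=; field.
rewrite (contact_vec (contact_charop E m (charop E m v))); case: sq => -> -> -> ->.
by apply: row5P; rewrite !mxE /=; ring.
Qed.

Lemma omega_neq0 E m :
  ~ [/\ cN E m = 0, cA E m = 0, cB E m = 0, cC E m = 0 & cD E m = 0] ->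
  exists a b, omega E m a b != 0.
Proof.
move=> nz; apply: contrapT => /forallNP h; apply: nz.
have h0 a b : omega E m a b = 0.
  by have /forallNP/(_ b)/negP := h a; rewrite negbK => /eqP.
pose ex := vec5 1 0 0 0 0; pose ey := vec5 0 1 0 0 0.
pose ep := vec5 0 0 0 1 0; pose eq := vec5 0 0 0 0 1.
have := h0 ex ey; have := h0 ex ep; have := h0 ex eq; have := h0 ey ep; have := h0 ep eq.
rewrite /omega /wedge !mxE /= => h1 h2 h3 h4 h5.
by split; lra.
Qed.

Section Point.
Variables (E : @monge_ampere R) (m : V).
Hypothesis par : cB E m ^+ 2 - 4 * cA E m * cC E m + 4 * cN E m * cD E m = 0.
Hypothesis nz : ~ [/\ cN E m = 0, cA E m = 0, cB E m = 0, cC E m = 0 & cD E m = 0].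

Lemma charop_characteristic v : characteristic E m (charop E m v).
Proof. by apply/characteristicP; split; [exact: contact_charop|exact: charop_sq]. Qed.

(** For v in D the terms omega(v, _) of [effective] drop out, and what remains
    is this identity paired with an arbitrary c under dU. *)
Lemma characteristic_formula a b v : characteristic E m v ->
  omega E m a b *: v = symp v b *: charop E m a - symp v a *: charop E m b.
Proof.
move=> Dv; have [cv Av] := (characteristicP E m v).1 Dv.
apply/eqP; rewrite -subr_eq0; apply/eqP.
apply: (@symp_nondegenerate m).
  rewrite -!scaleNr; apply: contactD; first exact: contactZ.
  rewrite -scaleN1r; apply: contactZ.
  by apply: contactD; apply: contactZ; exact: contact_charop.
move=> c _; have := effective E m v a b c.
rewrite !(omega_characteristic _ Dv) !mul0r !addr0.
rewrite -!scaleNr -scaleN1r !sympDl !sympZl sympDl !sympZl -!omega_charop => h.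
by rewrite (omega_skew E m a c); lra.
Qed.

(** The inclusion of ker A in im A. *)
Lemma characteristic_charop v : characteristic E m v -> exists e, v = charop E m e.
Proof.
move=> Dv; have [a [b ab]] := omega_neq0 nz.
have F := characteristic_formula a b Dv.
exists ((omega E m a b)^-1 *: (symp v b *: a - symp v a *: b)).
rewrite -[LHS]scale1r -(mulVf ab) -scalerA F.
by apply: row5P; rewrite !mxE /=; ring.
Qed.

(** If omega(a, b) is nonzero, A a and A b are independent, and
    [characteristic_formula] shows that they span D. *)
Lemma has_rank_characteristic : has_rank (characteristic E m) 2.
Proof.
have [a [b ab]] := omega_neq0 nz.
have aa c : omega E m c c = 0 by rewrite /omega /wedge; ring.
have fX : free [:: charop E m a; charop E m b].
  apply/freeP => k; rewrite !big_ord_recl big_ord0 /= addr0 => k0.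
  have k1 : k 0 = 0.
    have := congr1 (fun z => symp z b) k0.
    rewrite sympDl !sympZl -!omega_charop aa symp0 mulr0 addr0 => /eqP.
    by rewrite mulf_eq0 (negbTE ab) orbF => /eqP.
  have k2 : k (lift ord0 ord0) = 0.
    have := congr1 (fun z => symp z a) k0.
    rewrite sympDl !sympZl -!omega_charop aa symp0 mulr0 add0r omega_skew => /eqP.
    by rewrite mulrN oppr_eq0 mulf_eq0 (negbTE ab) orbF => /eqP.
  move=> -[[|[|//]] Hi].
    by rewrite -[RHS]k1; congr (k _); exact: val_inj.
  by rewrite -[RHS]k2; congr (k _); exact: val_inj.
exists <<[:: charop E m a; charop E m b]>>%VS; split.
  by move: fX; rewrite /free => /eqP.
move=> v; rewrite span_cons span_seq1; split.
  move=> /memv_addP[_ /vlineP[k ->] [_ /vlineP[l ->] ->]].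
  apply/characteristicP; split.
    by apply: contactD; apply: contactZ; exact: contact_charop.
  have -> : k *: charop E m a + l *: charop E m b = charop E m (k *: a + l *: b).
    by apply: row5P; rewrite !mxE /=; ring.
  exact: charop_sq.
move=> Dv; have F := characteristic_formula a b Dv.
have -> : v = (omega E m a b)^-1 *: (symp v b *: charop E m a - symp v a *: charop E m b).
  by rewrite -F scalerA mulVf// scale1r.
apply: memvZ; rewrite -scaleNr; apply: memv_add; apply: memvZ; exact: memv_line.
Qed.

Lemma characteristic_isotropic v w :
  characteristic E m v -> characteristic E m w -> symp v w = 0.
Proof.
move=> /characteristic_charop[e ->] Dw.
by rewrite -omega_charop omega_skew (omega_characteristic _ Dw) oppr0.
Qed.

(** The orthogonal of im A is ker A, since dU(A v, w) = dU(v, A w). *)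
Lemma characteristic_maximal s : contact m s ->
  (forall e, symp s (charop E m e) = 0) -> characteristic E m s.
Proof.
move=> cs s0; split=> // e _.
by rewrite omega_skew omega_charop -symp_skew s0.
Qed.

(** For x in D, a and b orthogonal to x, [effective] is reduced to
    dU(x, c) omega(a, b) = 0 for all c. *)
Lemma omega_eq0_perp x a b : characteristic E m x -> x != 0 ->
  symp x a = 0 -> symp x b = 0 -> omega E m a b = 0.
Proof.
move=> Dx x0 xa xb; apply: contrapT => /eqP ab; move/eqP: x0; apply.
apply: (@symp_nondegenerate m); first by case: Dx.
move=> c _; have := effective E m x a b c.
rewrite !(omega_characteristic _ Dx) xa xb !mul0r !addr0 !add0r => /eqP.
by rewrite mulf_eq0 (negbTE ab) orbF => /eqP.
Qed.

(** The hypothesis says that A x is orthogonal to the orthogonal of x, so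
    that x is an eigenvector of A; and A is nilpotent. *)
Lemma characteristic_of_perp x : contact m x -> x != 0 ->
  (forall w, contact m w -> symp x w = 0 -> omega E m x w = 0) -> characteristic E m x.
Proof.
move=> cx x0 xw.
have [w0 cw0 sw0] : exists2 w0, contact m w0 & symp x w0 != 0.
  apply: contrapT => /forall2NP h; move/eqP: x0; apply.
  apply: (@symp_nondegenerate m) => // w cw; apply: contrapT => /eqP xw0.
  by have [] := h w.
pose c := omega E m x w0 / symp x w0.
have Ax : charop E m x = c *: x.
  apply/eqP; rewrite -subr_eq0; apply/eqP; apply: (@symp_nondegenerate m).
    by rewrite -scaleNr; apply: contactD; [exact: contact_charop|exact: contactZ].
  move=> w cw; rewrite -scaleNr sympDl sympZl -omega_charop.
  pose r := symp x w / symp x w0.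
  have cz : contact m (w - r *: w0) by rewrite -scaleNr; apply: contactD => //; exact: contactZ.
  have sympBr y : symp y (w - r *: w0) = symp y w - r * symp y w0.
    by rewrite symp_skew -scaleNr sympDl sympZl [symp y w]symp_skew [symp y w0]symp_skew; ring.
  have sz : symp x (w - r *: w0) = 0 by rewrite sympBr /r divfK// subrr.
  have := xw _ cz sz; rewrite !omega_charop sympBr /r => h.
  by rewrite -[RHS]h /c omega_charop; ring.
have c0 : c *: (c *: x) = 0.
  have := charop_sq x par; rewrite Ax.
  have -> : charop E m (c *: x) = c *: charop E m x by apply: row5P; rewrite !mxE /=; ring.
  by rewrite Ax.
move/eqP: c0; rewrite scalerA scaler_eq0 (negbTE x0) orbF mulf_eq0 orbb => /eqP c0.
by apply/characteristicP; split=> //; rewrite Ax c0 scale0r.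
Qed.

End Point.
End ContactAlgebra.

(** * Differential calculus of the contact form *)

Section ContactCalculus.
Context {R : realType}.

Lemma diff_tangent (V : normedModType R) (O : set V) (f : V -> R) x v u w :
  findim V -> open O -> O x -> smooth O f ->
  'd (fun p : V * V => 'd f (p.1) p.2) (x, v) (u, w) = 'D_u ('D_v f) x + 'd f x w.
Proof.
move=> fV oO Ox sf.
have sT := smooth_tangent fV oO sf.
have oT : open (O `*` [set: V]) := open_setXT oO.
have dT : differentiable (fun p : V * V => 'd f (p.1) p.2) (x, v).
  by apply: smooth_diff sT _.
have E1 : 'd (fun p : V * V => 'd f (p.1) p.2) (x, v) (u, 0) = 'D_u ('D_v f) x.
  have i1 : is_diff x (fun y : V => (y, v)) (fun u => (u, 0)).
    exact: (is_diff_pair (is_diff_id x) (is_diff_cst v x)).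
  have [d1 e1] := is_diff_comp i1 (differentiableP dT).
  have dv : differentiable ('D_v f) x := smooth_diff (smooth_derive v sf) Ox.
  have nE : \near x, 'D_v f x = ((fun p : V * V => 'd f (p.1) p.2) \o (fun y => (y, v))) x.
    by near=> y; rewrite /= deriveE//; apply: smooth_diff sf _; near: y; exact: open_nbhs_nbhs.
  have [_ e2] := near_eq_diff nE dv.
  pose T (p : V * V) := 'd f (p.1) p.2.
  have h1 : 'd (T \o (fun y => (y, v))) x u = 'd T (x, v) (u, 0) := congr1 (fun F => F u) e1.
  have h2 : 'd (T \o (fun y => (y, v))) x u = 'd ('D_v f) x u := congr1 (fun F => F u) e2.
  rewrite (deriveE _ dv); exact: etrans (esym h1) h2.
have E2 : 'd (fun p : V * V => 'd f (p.1) p.2) (x, v) (0, w) = 'd f x w.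
  have i1 : is_diff v (fun y : V => (x, y)) (fun u => (0, u)).
    exact: (is_diff_pair (is_diff_cst x v) (is_diff_id v)).
  have [_ e1] := is_diff_comp i1 (differentiableP dT).
  have [_ e2] := linear_is_diff ('d f x) v fV.
  exact: etrans (esym (congr1 (fun F => F w) e1)) (congr1 (fun F => F w) e2).
have -> : (u, w) = (u, 0) + (0, w) by rewrite -[RHS]/(_ + _, _ + _) addr0 add0r.
by rewrite [LHS]linearD E1 E2.
Unshelve. all: by end_near. Qed.

Lemma smooth_diff_along (V W : normedModType R) (O : set V) (f : V -> W) (X : V -> V) :
  findim V -> open O -> smooth O f -> smooth O X -> smooth O (fun x => 'd f x (X x)).
Proof.
move=> fV oO sf sX; have sT := smooth_tangent fV oO sf.
have sp : smooth O (fun x => (x, X x)).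
  by apply: smooth_pair => //; exact: smooth_id.
by apply: (@smooth_comp _ _ _ _ O (O `*` setT) (fun x => (x, X x))
  (fun p : V * V => 'd f (p.1) p.2) (findim_prod fV fV) oO _ sp sT).
Qed.

Lemma diff_along (V : normedModType R) (O : set V) (f : V -> R) (X : V -> V) x u :
  findim V -> open O -> O x -> smooth O f -> smooth O X ->
  'd (fun y => 'd f y (X y)) x u = 'D_u ('D_(X x) f) x + 'd f x ('d X x u).
Proof.
move=> fV oO Ox sf sX.
have sT := smooth_tangent fV oO sf.
have dT : differentiable (fun p : V * V => 'd f (p.1) p.2) (x, X x).
  by apply: smooth_diff sT _.
have i1 := is_diff_pair (is_diff_id x) (differentiableP (smooth_diff sX Ox)).
have [_ e] := is_diff_comp i1 (differentiableP dT).
by rewrite [LHS](congr1 (fun F => F u) e) /= (diff_tangent _ _ _ fV oO Ox sf).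
Qed.

(** d/dX (df(Y)) and d/dY (df(X)) vanish, and their difference is df([X, Y]) by
    the symmetry of second derivatives. *)
Lemma bracket_first_integral n (O : set 'rV[R]_n.+1) (f : 'rV[R]_n.+1 -> R) X Y x :
  open O -> O x -> smooth O f -> smooth O X -> smooth O Y ->
  (forall y, O y -> 'd f y (X y) = 0) -> (forall y, O y -> 'd f y (Y y) = 0) ->
  'd f x (lie_bracket X Y x) = 0.
Proof.
move=> oO Ox sf sX sY fX fY.
have fV := @findim_rV R n.+1.
have h1 := diff_along (X x) fV oO Ox sf sY.
have h2 := diff_along (Y x) fV oO Ox sf sX.
rewrite (diff_eq0_near _ oO Ox fY) in h1.
rewrite (diff_eq0_near _ oO Ox fX) in h2.
rewrite (schwarz _ _ fV (@findim_R R) oO Ox sf) in h1.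
have -> : 'd f x (lie_bracket X Y x) = 'd f x ('d Y x (X x)) - 'd f x ('d X x (Y x)).
  exact: linearB.
by move: h1 h2; set a := 'D_ _ _ x => h1 h2; apply/eqP; rewrite subr_eq0; apply/eqP;
  apply: (addrI a); rewrite -h1 -h2.
Qed.

Notation V := 'rV[R]_5.

Lemma is_diff_coord n (i : 'I_n) (v : 'rV[R]_n) :
  is_diff v (fun v : 'rV[R]_n => v 0 i) (fun v => v 0 i).
Proof. exact: (linear_is_diff (rv_coord i) v (@findim_rV R n)). Qed.

Lemma is_diff_contact (m v : V) :
  is_diff (m, v) (fun s : V * V => contact_form s.1 s.2)
    (fun u => contact_form m u.2 - (u.1 0 ip * v 0 ix + u.1 0 iq * v 0 iy)).
Proof.
have fVV := findim_prod (@findim_rV R 5) (@findim_rV R 5).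
have c1 i := is_diff_comp (linear_is_diff (fst : V * V -> V) (m, v) fVV) (is_diff_coord i _).
have c2 i := is_diff_comp (linear_is_diff (snd : V * V -> V) (m, v) fVV) (is_diff_coord i _).
have [d e] := is_diffB (is_diffB (c2 iz) (is_diffM (c1 ip) (c2 ix))) (is_diffM (c1 iq) (c2 iy)).
apply: DiffDef; first exact: d.
rewrite [LHS]e; apply/funext => -[a b].
rewrite /contact_form /= !fctE /=.
rewrite -![_ *: _]/(_ * _); ring.
Qed.

Lemma smooth_coord (O : set V) k : smooth O (fun m : V => m 0 k).
Proof. exact: (@smooth_linear _ _ _ O (rv_coord k) (@findim_rV R 5)). Qed.

Lemma smooth_contact (O : set (V * V)) : open O ->
  smooth O (fun s : V * V => contact_form s.1 s.2).
Proof.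
move=> oO.
have fVV := findim_prod (@findim_rV R 5) (@findim_rV R 5).
have c1 i : smooth O (fun s : V * V => s.1 0 i).
  exact: (@smooth_linear _ _ _ O (rv_coord i \o fst) fVV).
have c2 i : smooth O (fun s : V * V => s.2 0 i).
  exact: (@smooth_linear _ _ _ O (rv_coord i \o snd) fVV).
apply: smoothB => //; last exact: smoothM.
by apply: smoothB => //; exact: smoothM.
Qed.

Lemma diff_contact_along (O : set V) (X : V -> V) x u : open O -> O x -> smooth O X ->
  (forall y, O y -> contact y (X y)) ->
  contact_form x ('d X x u) = u 0 ip * X x 0 ix + u 0 iq * X x 0 iy.
Proof.
move=> oO Ox sX cX.
have i1 := is_diff_pair (is_diff_id x) (differentiableP (smooth_diff sX Ox)).
have [_ e] := is_diff_comp i1 (is_diff_contact x (X x)).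
have := @diff_eq0_near R V R O (fun y => contact_form y (X y)) 0 x u oO Ox cX.
rewrite [LHS](congr1 (fun F => F u) e) /= => /eqP.
by rewrite subr_eq0 => /eqP.
Qed.

(** Cartan's formula dU(X, Y) = X U(Y) - Y U(X) - U([X, Y]) for sections of C. *)
Lemma contact_bracket (O : set V) (X Y : V -> V) x : open O -> O x ->
  smooth O X -> smooth O Y ->
  (forall y, O y -> contact y (X y)) -> (forall y, O y -> contact y (Y y)) ->
  contact_form x (lie_bracket X Y x) = - symp (X x) (Y x).
Proof.
move=> oO Ox sX sY cX cY.
have -> : contact_form x (lie_bracket X Y x) =
   contact_form x ('d Y x (X x)) - contact_form x ('d X x (Y x)).
  by rewrite /lie_bracket /contact_form !mxE; ring.
rewrite (diff_contact_along _ oO Ox sY cY) (diff_contact_along _ oO Ox sX cX).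
by rewrite /symp /wedge; ring.
Qed.

Lemma smooth_clift (O : set V) (a b c d : V -> R) : open O ->
  smooth O a -> smooth O b -> smooth O c -> smooth O d ->
  smooth O (fun m => clift m (a m) (b m) (c m) (d m)).
Proof.
move=> oO sa sb sc sd; apply: smooth_mx => // i j.
have sp := @smooth_coord O.
have sz : smooth O (fun m => m 0 ip * a m + m 0 iq * b m).
  by apply: smoothD => //; exact: smoothM.
case: j => -[|[|[|[|[|//]]]]] Hj.
- by apply: (smooth_ext oO _ sa) => x _; rewrite mxE.
- by apply: (smooth_ext oO _ sb) => x _; rewrite mxE.
- by apply: (smooth_ext oO _ sz) => x _; rewrite mxE.
- by apply: (smooth_ext oO _ sc) => x _; rewrite mxE.
- by apply: (smooth_ext oO _ sd) => x _; rewrite mxE.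
Qed.

Lemma sum_ord5 (F : 'I_5 -> R) :
  \sum_i F i = F ix + F iy + F iz + F ip + F iq.
Proof.
rewrite !big_ord_recl big_ord0 addr0 !addrA.
by congr (F _ + F _ + F _ + F _ + F _); exact: val_inj.
Qed.

Lemma diff5 (f : V -> R) m u : differentiable f m -> 'd f m u =
  u 0 ix * 'D_(delta_mx 0 ix) f m + u 0 iy * 'D_(delta_mx 0 iy) f m
  + u 0 iz * 'D_(delta_mx 0 iz) f m + u 0 ip * 'D_(delta_mx 0 ip) f m
  + u 0 iq * 'D_(delta_mx 0 iq) f m.
Proof.
move=> df; rewrite {1}(row_sum_delta u) linear_sum.
have E i : 'd f m (u 0 i *: delta_mx 0 i) = u 0 i * 'D_(delta_mx 0 i) f m.
  by rewrite deriveE//; exact: linearZ.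
under eq_bigr do rewrite E.
exact: sum_ord5.
Qed.

(** The characteristic field X_f of the equations f = k: the section
    of C dual to df with respect to dU. *)
Definition hamiltonian (f : V -> R) (m : V) : V :=
  clift m ('D_(delta_mx 0 ip) f m) ('D_(delta_mx 0 iq) f m)
    (- ('D_(delta_mx 0 ix) f m + m 0 ip * 'D_(delta_mx 0 iz) f m))
    (- ('D_(delta_mx 0 iy) f m + m 0 iq * 'D_(delta_mx 0 iz) f m)).

Lemma symp_hamiltonian f m u : differentiable f m ->
  symp (hamiltonian f m) u = 'd f m u - 'D_(delta_mx 0 iz) f m * contact_form m u.
Proof.
move=> df; rewrite diff5// /hamiltonian.
move: ('D_(delta_mx 0 ix) f m) ('D_(delta_mx 0 iy) f m) ('D_(delta_mx 0 iz) f m)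
  ('D_(delta_mx 0 ip) f m) ('D_(delta_mx 0 iq) f m) => a b c d e.
by rewrite /symp /wedge /contact_form !mxE /=; ring.
Qed.

Lemma hamiltonian_eq0 f m u : differentiable f m -> hamiltonian f m = 0 ->
  'd f m u = 'D_(delta_mx 0 iz) f m * contact_form m u.
Proof.
move=> df h0; have := symp_hamiltonian u df; rewrite h0 symp0.
by move=> /esym/eqP; rewrite subr_eq0 => /eqP.
Qed.

Lemma smooth_hamiltonian (O : set V) f : open O -> smooth O f -> smooth O (hamiltonian f).
Proof.
move=> oO sf.
have sp := @smooth_coord O.
have sd i : smooth O (fun m => 'D_(delta_mx 0 i) f m) := smooth_derive _ sf.
apply: smooth_clift => //.
- by apply: smoothN => //; apply: smoothD => //; apply: smoothM.
- by apply: smoothN => //; apply: smoothD => //; apply: smoothM.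
Qed.

Lemma hamiltonian_neq0 (O : set V) f m : O m -> differentiable f m ->
  regular_function O f -> hamiltonian f m != 0.
Proof.
move=> Om df reg; apply/eqP => h0.
have [] := reg m Om 1 (- 'D_(delta_mx 0 iz) f m).
  by move=> v; have := symp_hamiltonian v df; rewrite h0 symp0 mul1r mulNr.
by move=> /eqP; rewrite oner_eq0.
Qed.

(** X_f is orthogonal to D because df vanishes on D, so it lies in D; the
    tangent planes of a solution of f = k are orthogonal to X_f. *)
Lemma intermediate_of_first_integral (O : set V) (E : @monge_ampere R) f :
  open O -> parabolic_on O E -> smooth O f -> regular_function O f ->
  first_integral O (characteristic E) f -> intermediate_integral O E f.
Proof.
move=> oO par sf reg [_ fD]; split=> // k S s [[oS sS SO inj cS] fk]; split; first by split.
move=> t u1 u2 St; have Ot := SO t St.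
have df := smooth_diff sf Ot.
have fs u : 'd f (s t) ('d s t u) = 0.
  have [_ e] := is_diff_comp (differentiableP (smooth_diff sS St)) (differentiableP df).
  rewrite -[LHS](congr1 (fun F => F u) e).
  exact: (@diff_eq0_near R _ _ S (f \o s) k t u oS St fk).
have hs u : symp (hamiltonian f (s t)) ('d s t u) = 0.
  by rewrite symp_hamiltonian// fs (cS t u St) mulr0 subr0.
apply: (omega_eq0_perp (x := hamiltonian f (s t))) => //; last first.
  exact: hamiltonian_neq0 Ot df reg.
apply: characteristic_maximal; first exact: contact_clift.
move=> e; rewrite symp_hamiltonian// (contact_charop E (s t) e) mulr0 subr0.
by apply: fD => //; apply: charop_characteristic; exact: par.
Qed.

End ContactCalculus.

(** * The method of characteristics *)

Section CharacteristicSurface.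
Context {R : realType}.
Notation V := 'rV[R]_5.

Lemma hamiltonian_first_integral (f : V -> R) x : differentiable f x ->
  'd f x (hamiltonian f x) = 0.
Proof.
move=> df; have := symp_hamiltonian (hamiltonian f x) df.
rewrite (contact_clift x) mulr0 subr0 => <-.
by rewrite /symp /wedge; ring.
Qed.

(** X_f is not a symmetry of the contact form but satisfies
    L_X U = df - f_z U, and X f = 0. So df and U, seen as functions of tangent
    vectors, vary along the linearized flow by combinations of themselves: it
    preserves the planes df = U = 0. *)
Lemma hamiltonian_variation (O : set V) (f : V -> R) :
  open O -> smooth O f ->
  let w := fun s : V * V => ('d f (s.1) s.2, contact_form s.1 s.2) in
  smooth (O `*` [set: V]) w /\
  forall x u, O x ->
    `|'d w (x, u) (hamiltonian f x, 'd (hamiltonian f) x u)| <=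
       (1 + `|'D_(delta_mx 0 iz) f x|) * `|w (x, u)|.
Proof.
move=> oO sf w.
have fV := @findim_rV R 5.
have oOV : open (O `*` [set: V]) := open_setXT oO.
have sT := smooth_tangent fV oO sf.
have sw : smooth (O `*` [set: V]) w.
  by apply: smooth_pair => //; exact: smooth_contact.
split=> // x u Ox.
pose X := hamiltonian f.
have sX : smooth O X := smooth_hamiltonian oO sf.
have cX y : O y -> contact y (X y) by move=> _; exact: contact_clift.
have fX y : O y -> 'd f y (X y) = 0.
  by move=> Oy; apply: hamiltonian_first_integral; exact: smooth_diff sf Oy.
have df := smooth_diff sf Ox.
have dT : differentiable (fun p : V * V => 'd f (p.1) p.2) (x, u).
  by apply: smooth_diff sT _.
have [_ e] := is_diff_pair (differentiableP dT) (is_diff_contact x u).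
have E : 'd w (x, u) (X x, 'd X x u) = (0, symp (X x) u).
  rewrite [LHS](congr1 (fun F => F (X x, 'd X x u)) e) /=; congr (_, _).
    rewrite (diff_tangent _ _ _ fV oO Ox sf).
    rewrite (schwarz _ _ fV (@findim_R R) oO Ox sf).
    rewrite -(diff_along u fV oO Ox sf sX).
    exact: (diff_eq0_near _ oO Ox fX).
  by rewrite (diff_contact_along _ oO Ox sX cX) /symp /wedge; ring.
have n0 (a : R) : `|(0, a) : R * R| = `|a| by rewrite prod_normE /= normr0 max_r.
rewrite E n0 symp_hamiltonian// [in leRHS]prod_normE /=.
rewrite (le_trans (ler_normB _ _))// mulrDl mul1r lerD//.
  by rewrite le_max lexx.
by rewrite normrM ler_wpM2l// le_max lexx orbT.
Qed.

Lemma contact_direction (O : set V) f m : O m -> smooth O f -> regular_function O f ->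
  exists2 g, contact m g & 'd f m g = 1.
Proof.
move=> Om sf reg; have df := smooth_diff sf Om.
have X0 := hamiltonian_neq0 Om df reg.
have [g cg sg] : exists2 g, contact m g & 'd f m g != 0.
  apply: contrapT => /forall2NP h; move/eqP: X0; apply.
  apply: (@symp_nondegenerate _ m) => [|w cw]; first exact: contact_clift.
  rewrite symp_hamiltonian// cw mulr0 subr0; apply: contrapT => /eqP xw0.
  by have [] := h w.
exists (('d f m g)^-1 *: g); first exact: contactZ.
have -> : 'd f m (('d f m g)^-1 *: g) = ('d f m g)^-1 * 'd f m g by exact: linearZ.
by rewrite mulVf.
Qed.

(** The projection along g of the constant extension of w, corrected to remain
    in C, onto ker df; multiplying by df(g) avoids a division. *)
Lemma contact_field (O : set V) f m w : open O -> O m -> smooth O f ->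
  regular_function O f -> contact m w -> 'd f m w = 0 ->
  exists Y : V -> V, [/\ smooth O Y, Y m = w, forall x, O x -> contact x (Y x)
    & forall x, O x -> 'd f x (Y x) = 0].
Proof.
move=> oO Om sf reg cw fw.
have fV := @findim_rV R 5.
have [g cg fg] := contact_direction Om sf reg.
pose C (v x : V) := clift x (v 0 ix) (v 0 iy) (v 0 ip) (v 0 iq).
have sC v : smooth O (C v) by apply: smooth_clift => //; exact: smooth_cst.
have sfC v : smooth O (fun x => 'd f x (C v x)) by exact: smooth_diff_along.
exists (fun x => 'd f x (C g x) *: C w x - 'd f x (C w x) *: C g x); split.
- by apply: smoothB => //; exact: smoothZ.
- by rewrite /C -!contact_vec// fg fw scale1r scale0r subr0.
- move=> x Ox; rewrite -scaleNr.
  by apply: contactD; apply: contactZ; exact: contact_clift.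
move=> x Ox; rewrite linearB /=.
have lz a v : 'd f x (a *: v) = a * 'd f x v by exact: linearZ.
by rewrite !lz mulrC subrr.
Qed.

(** The union of the characteristics of f through a curve tangent to w and
    contained in C and in a level set of f. By [hamiltonian_variation] its
    tangent planes are still contained in C and in ker df. *)
Theorem characteristic_surface (O : set V) f m w :
  open O -> O m -> smooth O f -> regular_function O f ->
  contact m w -> 'd f m w = 0 ->
  (forall a b : R, a *: w + b *: hamiltonian f m = 0 -> a = 0 /\ b = 0) ->
  exists (S : set 'rV[R]_2) (s : 'rV[R]_2 -> V),
    [/\ first_order_solution O f (f m) S s, S 0, s 0 = m
      & exists u1 u2, 'd s 0 u1 = w /\ 'd s 0 u2 = hamiltonian f m].
Proof.
move=> oO Om sf reg cw fw ind.
have fV := @findim_rV R 5; have fV2 := @findim_rV R 2.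
have fVR := findim_prod fV (@findim_R R).
pose X := hamiltonian f.
have sX : smooth O X := smooth_hamiltonian oO sf.
have [Y [sY Ym cY fY]] := contact_field oO Om sf reg cw fw.
have [N1 [phi1 [[oN1 N1m] s1 O1 [p1m _ d1] _]]] := local_flow fV oO Om sY.
have [N2 [phi2 [[oN2 N2m] s2 O2 [p2m p2x d2] inv2]]] := local_flow fV oO Om sX.
have [swt wtP] := hamiltonian_variation oO sf.
(* phi1 is the flow of Y and phi2 that of X_f. *)
pose gam (t : R) := phi1 (m, t).
pose jj (u : 'rV[R]_2) : V * R := (gam (u 0 0), u 0 1).
pose s u := phi2 (jj u).
pose SA : set 'rV[R]_2 := [set u | N1 (m, u 0 0)].
have sm1 A : open A -> smooth A (fun u : 'rV[R]_2 => (m, u 0 0) : V * R).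
  move=> oA; apply: smooth_pair => //; first exact: smooth_cst.
  exact: (@smooth_linear _ _ _ _ (rv_coord 0) fV2).
have oSA : open SA.
  by apply: open_comp oN1 => u _; exact: (smooth_continuous (sm1 setT openT)).
have sjj : smooth SA jj.
  apply: smooth_pair => //; last exact: (@smooth_linear _ _ _ _ (rv_coord 1) fV2).
  exact: (@smooth_comp _ _ _ _ SA N1 _ phi1 fVR oSA (fun u h => h) (sm1 SA oSA) s1).
pose SB : set 'rV[R]_2 := [set u | SA u /\ N2 (jj u)].
have oSB : open SB.
  by apply: (@open_preimage_in _ _ _ SA N2 jj oSA oN2) => u Su; exact: smooth_continuous sjj Su.
have gam0 : gam 0 = m by rewrite /gam p1m.
have jj0 : jj 0 = (m, 0) by rewrite /jj !mxE gam0.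
have SB0 : SB 0 by split; rewrite /SA /= ?mxE// jj0.
have SBA : SB `<=` SA by move=> u [].
have ss : smooth SB s.
  apply: (@smooth_comp _ _ _ _ SB N2 jj phi2 fVR oSB _ _ s2); first by move=> u [].
  exact: smooth_sub SBA sjj.
have s0 : s 0 = m by rewrite /s jj0.
have dgam (t : R) (a : R) : N1 (m, t) -> is_diff t gam (fun a => a *: Y (gam t)).
  move=> Nt.
  have i1 : is_diff t (fun t : R => (m, t)) (fun a => (0, a)).
    exact: (is_diff_pair (is_diff_cst m t) (is_diff_id t)).
  have [dg e] := is_diff_comp i1 (differentiableP (smooth_diff s1 Nt)).
  apply: DiffDef; first exact: dg.
  apply/funext => b; rewrite [LHS](congr1 (fun F => F b) e) /=.
  have -> : (0, b) = b *: ((0, 1) : V * R).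
    by rewrite -[RHS]/(_, _) scaler0 -[b *: 1]/(b * 1) mulr1.
  by rewrite linearZ d1.
have ds u v : SB u -> 'd s u v =
    v 0 0 *: 'd phi2 (jj u) (Y (gam (u 0 0)), 0) + v 0 1 *: X (s u).
  move=> [Au Nu].
  have i1 := is_diff_comp (is_diff_coord 0 u) (dgam (u 0 0) 0 Au).
  have i2 := is_diff_pair i1 (is_diff_coord 1 u).
  have [_ e] := is_diff_comp i2 (differentiableP (smooth_diff s2 Nu)).
  rewrite [LHS](congr1 (fun F => F v) e) /=.
  have -> : (v 0 0 *: Y (gam (u 0 0)), v 0 1) =
     v 0 0 *: ((Y (gam (u 0 0)), 0) : V * R) + v 0 1 *: (0, 1).
    rewrite -[RHS]/(_ + _, _ + _) /= !scaler0 addr0 add0r.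
    by rewrite -[v 0 1 *: 1]/(v 0 1 * 1) mulr1.
  by rewrite linearD !linearZ d2.
(* The variation z of the curve is transported by the linearized flow of X_f
   and remains in df = U = 0; the other tangent vector is X_f itself. *)
have tan u v : SB u -> 'd f (s u) ('d s u v) = 0 /\ contact_form (s u) ('d s u v) = 0.
  move=> Su; have [Au Nu] := Su.
  have Ogam : O (gam (u 0 0)) := O1 _ Au.
  have Os : O (s u) := O2 _ Nu.
  have cc (x : V) : O x -> {for x, continuous (fun x => 1 + `|'D_(delta_mx 0 iz) f x|)}.
    move=> Ox.
    have c1 : {for x, continuous (fun x => `|'D_(delta_mx 0 iz) f x|)}.
      apply: (@continuous_comp _ _ _ ('D_(delta_mx 0 iz) f) (fun r : R => `|r|)).
        exact: (smooth_continuous (smooth_derive _ sf) Ox).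
      exact: norm_continuous.
    by apply: (@continuousD R R _ (fun=> 1) _ x) c1; exact: cst_continuous.
  pose z := 'd phi2 (jj u) (Y (gam (u 0 0)), 0).
  have wz := inv2 _ _ _ (findim_prod (@findim_R R) (@findim_R R)) swt cc wtP (jj u)
     (Y (gam (u 0 0))) Nu (congr2 pair (fY _ Ogam) (cY _ Ogam)).
  have fz : 'd f (s u) z = 0 := congr1 fst wz.
  have cz : contact_form (s u) z = 0 := congr1 snd wz.
  have dfs := smooth_diff sf Os.
  have lf a b p q : 'd f (s u) (a *: p + b *: q) = a * 'd f (s u) p + b * 'd f (s u) q.
    by rewrite linearD; congr (_ + _); exact: linearZ.
  have lc a b p q : contact_form (s u) (a *: p + b *: q) =
      a * contact_form (s u) p + b * contact_form (s u) q.
    by rewrite /contact_form !mxE; ring.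
  rewrite ds// -/z lf lc fz cz (hamiltonian_first_integral dfs) (contact_clift (s u)).
  by rewrite !mulr0 addr0.
pose J u : 'M[R]_(2, 5) := \matrix_(i < 2) 'D_(delta_mx 0 i) s u.
have sJ : smooth SB J.
  apply: smooth_mx => // i j.
  have := smooth_mx_entry 0 j oSB (smooth_derive (delta_mx 0 i) ss).
  by apply: (smooth_ext oSB) => u _; rewrite mxE.
have dJ u v : SB u -> 'd s u v = v *m J u.
  move=> Su; rewrite {1}(row_sum_delta v) linear_sum mulmx_sum_row.
  apply: eq_bigr => i _; rewrite rowK (deriveE _ (smooth_diff ss Su)).
  exact: linearZ.
have d00 : 'd s 0 (delta_mx 0 0) = w.
  by rewrite ds// jj0 !mxE /= gam0 Ym p2x scale1r scale0r addr0.
have d01 : 'd s 0 (delta_mx 0 1) = hamiltonian f m.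
  by rewrite ds// !mxE /= scale0r add0r scale1r s0.
(* s is an immersion at 0, hence near 0. *)
have fJ : row_free (J 0).
  apply: inj_row_free => c; rewrite mulmx_sum_row big_ord_recl big_ord_recl big_ord0 addr0.
  rewrite !rowK !(deriveE _ (smooth_diff ss SB0)).
  have -> : ord0 = 0 :> 'I_2 by [].
  have -> : lift ord0 ord0 = 1 :> 'I_2 by exact: val_inj.
  rewrite d00 d01 => /ind [c0 c1].
  apply/rowP => -[[|[|//]] Hi]; rewrite [RHS]mxE.
    by rewrite -[RHS]c0; congr (c _ _); exact: val_inj.
  by rewrite -[RHS]c1; congr (c _ _); exact: val_inj.
have [N [oN Nm0 NSB fN]] := row_free_near oSB SB0 sJ fJ.
have := oN; rewrite openE => /(_ _ Nm0) /nbhs_ballP[r /= r0 bN].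
pose S : set 'rV[R]_2 := ball 0 r.
have SSB : S `<=` SB by move=> u /bN /NSB.
exists S, s; split=> //; last by exists (delta_mx 0 0), (delta_mx 0 1).
  split; last first.
    move=> u Su.
    have [C C0 CP] := mean_value_inequality (@findim_R R).
    have seg (t : R) : 0 <= t <= 1 -> SB (0 + t *: u).
      move=> t01; apply: SSB.
      have S0 : S 0 by exact: ballxx.
      have := ball_convex S0 Su t01; rewrite subr0; exact.
    have dfs y : SB y -> is_diff y (f \o s) ('d f (s y) \o 'd s y).
      move=> Sy; apply: is_diff_comp.
        by apply: differentiableP; exact: smooth_diff ss Sy.
      by apply: differentiableP; apply: smooth_diff sf _; apply: O2; case: Sy.
    have : `|(f \o s) (0 + u) - (f \o s) 0| <= C * 0.
      apply: CP => t t01; have [e1 e2] := dfs _ (seg t t01) => //.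
      by rewrite e2 /= (tan _ u (seg t t01)).1 normr0.
    by rewrite mulr0 normr_le0 subr_eq0 add0r /= s0 => /eqP.
  split.
  - exact: ball_open.
  - exact: smooth_sub SSB ss.
  - by move=> u /SSB [_ Nu]; exact: O2.
  - move=> u Su v1 v2; rewrite !dJ; [|exact: SSB|exact: SSB].
    by apply: row_free_inj; apply: fN; exact: bN.
  - by move=> u v /SSB Su; exact: (tan u v Su).2.
exact: ballxx.
Qed.

(** omega(X_f, w) = 0 for w tangent to the surfaces of [characteristic_surface],
    that is for all w in C orthogonal to X_f: so X_f is in D, and df = dU(X_f, _)
    vanishes on D, which is isotropic. *)
Theorem first_integral_of_intermediate (O : set V) (E : @monge_ampere R) f :
  open O -> monge_ampere_on O E -> parabolic_on O E ->
  intermediate_integral O E f -> first_integral O (characteristic E) f.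
Proof.
move=> oO [_ nz] par [sf reg sol]; split=> // m v Om Dv.
have df := smooth_diff sf Om.
pose x := hamiltonian f m.
have x0 : x != 0 := hamiltonian_neq0 Om df reg.
have Dx : characteristic E m x.
  apply: characteristic_of_perp => //; first exact: par.
    exact: contact_clift.
  move=> w cw sxw.
  have fw : 'd f m w = 0 by rewrite -sxw symp_hamiltonian// cw mulr0 subr0.
  have [[a ->]|ind] := pselect (exists a, w = a *: x).
    exact: omega_line.
  have [|S [s [fos S0 s0 [u1 [u2 [e1 e2]]]]]] := characteristic_surface oO Om sf reg cw fw.
    move=> a b ab.
    have a0 : a = 0.
      apply: contrapT => /eqP a0; apply: ind; exists (- (a^-1 * b)).
      apply: (scalerI a0); rewrite scalerA mulrN mulrA mulfV// mul1r scaleNr.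
      by apply/eqP; rewrite -addr_eq0 ab.
    split=> //; move/eqP: ab; rewrite a0 scale0r add0r scaler_eq0 (negbTE x0) orbF.
    by move/eqP.
  have [_ /(_ 0 u1 u2 S0)] := sol _ _ _ fos.
  by rewrite s0 e1 e2 -/x [LHS]omega_skew => /eqP; rewrite oppr_eq0 => /eqP.
have := symp_hamiltonian v df; rewrite (Dv.1 : contact_form m v = 0) mulr0 subr0 => <-.
exact: (characteristic_isotropic (nz m Om) Dx Dv).
Qed.

End CharacteristicSurface.

(** * Derived distributions *)

Section DerivedDistributions.
Context {R : realType} {n : nat}.
Notation V := 'rV[R]_n.+1.
Implicit Types (P : Defs.distribution R n) (O : set V).

Lemma has_rank_le (A B : set V) r s : has_rank A r -> has_rank B s -> A `<=` B -> (r <= s)%N.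
Proof.
move=> [E [<- EA]] [F [<- FB]] AB; apply: dimvS.
by apply/subvP => v /EA /AB /FB.
Qed.

Lemma has_rank_sub_eq (A B : set V) r : has_rank A r -> has_rank B r -> A `<=` B -> B `<=` A.
Proof.
move=> [E [dE EA]] [F [dF FB]] AB v /FB vF; apply/EA.
suff -> : E = F by [].
apply/eqP; rewrite eqEdim dE dF leqnn andbT.
by apply/subvP => u /EA /AB /FB.
Qed.

Lemma has_rank_lt (A B : set V) r s v : has_rank A r -> has_rank B s -> A `<=` B ->
  B v -> ~ A v -> (r < s)%N.
Proof.
move=> rA rB AB Bv nA; rewrite ltn_neqAle (has_rank_le rA rB AB) andbT.
apply/eqP => rs; apply: nA; rewrite -rs in rB.
exact: (has_rank_sub_eq rA rB AB).
Qed.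

Lemma has_rank_setT : has_rank [set: V] n.+1.
Proof. by exists fullv; split; [rewrite dimvf /dim /= mul1n|move=> v; rewrite memvf]. Qed.

Definition linear_closed (Q : set V) := forall k (a : 'I_k -> R) (w : 'I_k -> V),
  (forall i, Q (w i)) -> Q (\sum_(i < k) a i *: w i).

Lemma has_rank_closed (Q : set V) r : has_rank Q r -> linear_closed Q.
Proof.
move=> [E [_ EQ]] k a w Qw; apply/EQ; apply: memv_suml => i _.
by apply: memvZ; apply/EQ.
Qed.

Lemma kernel_closed (L : {linear V -> R}) : linear_closed [set v | L v = 0].
Proof.
move=> k a w w0 /=; rewrite linear_sum big1// => i _.
by rewrite linearZ [L _]w0; exact: mulr0.
Qed.

Lemma derived_sub O P x : P x `<=` derived O P x.
Proof.
move=> v Pv; exists 1%N, (fun=> 1), (fun=> v); split; first by left.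
by rewrite big_ord1 scale1r.
Qed.

Lemma bracket_derived O P x : bracket_values O P x `<=` derived O P x.
Proof.
move=> v Pv; exists 1%N, (fun=> 1), (fun=> v); split; first by right.
by rewrite big_ord1 scale1r.
Qed.

Lemma derived_ind O P x (Q : set V) : linear_closed Q -> P x `<=` Q ->
  bracket_values O P x `<=` Q -> derived O P x `<=` Q.
Proof.
move=> cQ PQ bQ v [k [a [w [wP ->]]]]; apply: cQ => i.
by case: (wP i) => [/PQ|/bQ].
Qed.

Lemma smooth_bracket O (X Y : V -> V) : open O -> smooth O X -> smooth O Y ->
  smooth O (lie_bracket X Y).
Proof.
move=> oO sX sY; apply: smoothB => //; apply: smooth_diff_along => //; exact: findim_rV.
Qed.

Lemma extends_derived O P m r : open O -> O m ->
  (forall x, O x -> has_rank (derived O P x) r) ->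
  extends_locally O P m -> extends_locally O (derived O P) m.
Proof.
move=> oO Om rk extP v [k [a [w [wP ->]]]].
have /choice[F FP] : forall i, exists F : set V * (V -> V),
    [/\ open F.1 /\ F.1 m, F.1 `<=` O, vector_field_in F.1 (derived O P) F.2 & F.2 m = w i].
  move=> i; case: (wP i) => [/extP[N [X [oN NO [sX PX] Xm]]]|[N [X [Y [[oN Nm] NO [sX PX] [sY PY] ->]]]]].
    by exists (N, X); split=> //; split=> // x Nx; apply: derived_sub; exact: PX.
  exists (N, lie_bracket X Y); split=> //; split; first exact: smooth_bracket.
  move=> x Nx; apply: bracket_derived; exists N, X, Y; split=> //.
pose N : set V := O `&` [set x | forall i, (F i).1 x].
have oN : open N.
  by apply: openI => //; apply: open_forall_ord => i; have [[]] := FP i.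
exists N, (fun x => \sum_i a i *: (F i).2 x); split.
- by split=> //; split=> // i; have [[]] := FP i.
- by move=> x [].
- split.
    apply: smooth_sum => // i; apply: smoothZ => //; first exact: smooth_cst.
    have [_ _ [sF _] _] := FP i.
    by apply: smooth_sub sF => x [_]; exact.
  move=> x [Ox Fx]; apply: (has_rank_closed (rk x Ox)) => i.
  have [_ _ [_ PF] _] := FP i; exact: PF.
by apply: eq_bigr => i _; have [_ _ _ ->] := FP i.
Qed.

Lemma first_integral_derived (U : set V) O P (f : V -> R) : open U ->
  first_integral U P f -> first_integral U (derived O P) f.
Proof.
move=> oU [sf fP]; split=> // x v Ux.
apply: (@derived_ind O P x [set v | 'd f x v = 0]).
- exact: kernel_closed.
- by move=> u Pu /=; exact: fP.
move=> u [N [X [Y [[oN Nx] NO [sX PX] [sY PY] ->]]]] /=.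
have oNU : open (N `&` U) by exact: openI.
apply: (bracket_first_integral oNU).
- by split.
- by apply: smooth_sub sf => y [].
- by apply: smooth_sub sX => y [].
- by apply: smooth_sub sY => y [].
- by move=> y [Ny Uy]; apply: fP => //; exact: PX.
- by move=> y [Ny Uy]; apply: fP => //; exact: PY.
Qed.

Lemma has_rank_kernel (f : V -> R) x v : differentiable f x -> 'd f x v != 0 ->
  has_rank [set v | 'd f x v = 0] n.
Proof.
move=> df fv.
have dF (i : 'I_1) : differentiable ((fun=> f) i) x by [].
have fJ : row_free (gradmx (fun _ : 'I_1 => f) x).
  apply/row_free_gradmx => // a a0 i; have := a0 v.
  by rewrite big_ord1 (ord1 i) => /eqP; rewrite mulf_eq0 (negbTE fv) orbF => /eqP.
have E u : 'd f x u = (u *m (gradmx (fun _ : 'I_1 => f) x)^T) 0 0.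
  exact: (diff_gradmx u (dF 0)).
have := has_rank_annihilator (erefl : (1 + n = n.+1)%N) fJ.
congr (has_rank _ _); apply/seteqP; split=> u /= h; first by rewrite E h mxE.
by apply/rowP => i; rewrite (ord1 i) [RHS]mxE -E.
Qed.

Lemma kernel_neq0 (f : V -> R) x (Q : set V) r : has_rank Q r -> (r < n.+1)%N ->
  Q = [set v | 'd f x v = 0] -> exists v, 'd f x v != 0.
Proof.
move=> rQ rn EQ; apply: contrapT => /forallNP h.
have QT : [set: V] `<=` Q.
  by move=> v _; rewrite EQ /=; apply: contrapT => /eqP; exact: h.
by have := has_rank_le has_rank_setT rQ QT; rewrite leqNgt rn.
Qed.

End DerivedDistributions.

(** * Intermediate integrals as first integrals of the characteristic distribution *)

Section IntermediateIntegrals.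
Context {R : realType}.
Notation V := 'rV[R]_5.

Lemma smooth_charop (O : set V) (E : @monge_ampere R) e : open O -> monge_ampere_on O E ->
  smooth O (fun x => charop E x e).
Proof.
move=> oO [[sN sA sB sC sD] _].
have sB2 : smooth O (fun m => cB E m / 2) by apply: smoothM => //; exact: smooth_cst.
have sc (g : V -> R) c : smooth O g -> smooth O (fun m => g m * c).
  by move=> sg; apply: smoothM => //; exact: smooth_cst.
apply: smooth_clift => //.
- apply: smoothB (oO) _ (sc _ _ sN); exact: smoothB oO (sc _ _ sB2) (sc _ _ sA).
- apply: smoothD (oO) _ (sc _ _ sN); exact: smoothB oO (sc _ _ sC) (sc _ _ sB2).
- apply: smoothD (oO) _ (sc _ _ sC); exact: smoothD oO (sc _ _ sD) (sc _ _ sB2).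
- apply: smoothB (oO) _ (sc _ _ sB2).
  exact: smoothB oO (sc _ _ (smoothN oO sD)) (sc _ _ sA).
Qed.

Lemma regular_of_hamiltonian (O : set V) f :
  (forall x, O x -> differentiable f x) -> (forall x, O x -> hamiltonian f x != 0) ->
  regular_function O f.
Proof.
move=> df h0 x Ox a b ab.
have a0 : a = 0.
  apply: contrapT => /eqP a0; move/eqP: (h0 x Ox); apply.
  apply: (@symp_nondegenerate _ x); first exact: contact_clift.
  move=> v cv; rewrite symp_hamiltonian ?cv ?mulr0 ?subr0; last exact: df.
  have := ab v; rewrite cv mulr0 addr0 => /eqP.
  by rewrite mulf_eq0 (negbTE a0) => /eqP.
split=> //; have := ab (vec5 0 0 1 0 0).
by rewrite a0 mul0r add0r /contact_form !mxE /= => h; rewrite -[RHS]h; ring.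
Qed.

Variables (O : set V) (E : @monge_ampere R).
Hypotheses (oO : open O) (ma : monge_ampere_on O E) (par : parabolic_on O E).
Let D := characteristic E.

Lemma monge_ampere_sub (U : set V) : U `<=` O -> monge_ampere_on U E.
Proof.
case: ma => [[sN sA sB sC sD] nz] UO; split; last by move=> x /UO; exact: nz.
by split; apply: smooth_sub UO _.
Qed.

Lemma parabolic_sub (U : set V) : U `<=` O -> parabolic_on U E.
Proof. by move=> UO x /UO; exact: par. Qed.

Lemma rank_D x : O x -> has_rank (D x) 2.
Proof. by move=> Ox; apply: has_rank_characteristic; [exact: par|exact: ma.2]. Qed.

Lemma charop_section e : vector_field_in O D (fun x => charop E x e).
Proof.
split; first exact: smooth_charop.
by move=> x Ox; apply: charop_characteristic; exact: par.
Qed.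

Lemma extends_D m : O m -> extends_locally O D m.
Proof.
move=> Om v /(characteristic_charop (ma.2 m Om))[e ->].
by exists O, (fun x => charop E x e); split=> //; exact: charop_section.
Qed.

Lemma intermediateP (U : set V) f : open U -> U `<=` O ->
  intermediate_integral U E f <-> regular_function U f /\ first_integral U D f.
Proof.
move=> oU UO; split=> [h|[reg fi]].
  split; first by case: h.
  by apply: first_integral_of_intermediate h => //; [exact: monge_ampere_sub|exact: parabolic_sub].
by apply: intermediate_of_first_integral => //; [exact: parabolic_sub|case: fi].
Qed.

(** U([X, Y]) = - dU(X, Y) = 0 for sections of D, which is isotropic. *)
Lemma derived_contact x : O x -> derived O D x `<=` contact x.
Proof.
move=> Ox; apply: derived_ind.
- move=> k a w cw; elim/big_ind: _ => [|u v cu cv|i _].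
  + by rewrite /contact /= /contact_form !mxE; ring.
  + exact: contactD.
  + exact: contactZ.
- by move=> v [].
move=> v [N [X [Y [[oN Nx] NO [sX PX] [sY PY] ->]]]].
rewrite /contact /= (contact_bracket oN Nx sX sY).
- by rewrite (characteristic_isotropic (ma.2 x Ox) (PX x Nx) (PY x Nx)) oppr0.
- by move=> y Ny; case: (PX y Ny).
- by move=> y Ny; case: (PY y Ny).
Qed.

(** If D'' were contained in C, then dU(S, Z) = - U([S, Z]) would vanish for
    S = [X, Y] in D' and all sections Z of D; D being its own orthogonal, this
    gives S in D. The sections A e, for constant e, suffice as Z. *)
Lemma derived2_not_contact x b : O x -> bracket_values O D x b -> ~ D x b ->
  exists2 v, derived O (derived O D) x v & ~ contact x v.
Proof.
move=> Ox bb nDb; apply: contrapT => /forall2NP h; apply: nDb.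
have cc v : derived O (derived O D) x v -> contact x v.
  by move=> dv; apply: contrapT => nc; have [] := h v.
have cb : contact x b by apply: derived_contact => //; exact: bracket_derived.
apply: characteristic_maximal => // e.
case: bb => N [X [Y [[oN Nx] NO [sX PX] [sY PY] bE]]].
have sS := smooth_bracket oN sX sY.
have PS y : N y -> derived O D y (lie_bracket X Y y).
  by move=> Ny; apply: bracket_derived; exists N, X, Y.
have [sG PG] := charop_section e.
have sGN := smooth_sub NO sG.
have PGN y : N y -> derived O D y (charop E y e).
  by move=> Ny; apply: derived_sub; apply: PG; exact: NO.
have /cc : derived O (derived O D) x (lie_bracket (lie_bracket X Y) (fun y => charop E y e) x).
  by apply: bracket_derived; exists N, (lie_bracket X Y), (fun y => charop E y e).
rewrite /contact /= (contact_bracket oN Nx sS sGN) -?bE.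
- by move/eqP; rewrite oppr_eq0 => /eqP.
- by move=> y Ny; apply: derived_contact; [exact: NO|exact: PS].
- by move=> y Ny; apply: contact_charop.
Qed.

Hypothesis rank_D' : constant_rank O (derived O D).

Lemma rank_derived_gt2 r x b : O x -> has_rank (derived O D x) r ->
  bracket_values O D x b -> ~ D x b -> (2 < r)%N.
Proof.
move=> Ox rk bb nb.
apply: has_rank_lt (rank_D Ox) rk (@derived_sub _ _ O D x) _ nb.
exact: bracket_derived.
Qed.

(** A bracket leaves D at one point, so rank D' > 2 there, hence everywhere. *)
Lemma nonintegrable_everywhere x0 b0 : O x0 -> bracket_values O D x0 b0 -> ~ D x0 b0 ->
  forall x, O x -> exists2 b, bracket_values O D x b & ~ D x b.
Proof.
move=> Ox0 bb0 nb0 x Ox; have [r rP] := rank_D'.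
have r2 := rank_derived_gt2 Ox0 (rP x0 Ox0) bb0 nb0.
apply: contrapT => /forall2NP h.
have sub : derived O D x `<=` D x.
  apply: derived_ind => //; first exact: has_rank_closed (rank_D Ox).
  by move=> v bv; apply: contrapT => nv; have [] := h v.
by have := has_rank_le (rP x Ox) (rank_D Ox) sub; rewrite leqNgt r2.
Qed.

(** If all brackets at x remain in D, then rank D' = 2 at x, hence everywhere;
    so D' = D, and D'' = D would have rank 2. *)
Lemma rank4_nonintegrable x : O x -> has_rank (derived O (derived O D) x) 4 ->
  exists2 b, bracket_values O D x b & ~ D x b.
Proof.
move=> Ox rk4; apply: contrapT => /forall2NP h.
have bD v : bracket_values O D x v -> D x v.
  by move=> bv; apply: contrapT => nv; have [] := h v.
have [r rP] := rank_D'.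
have sub : derived O D x `<=` D x.
  by apply: derived_ind => //; exact: has_rank_closed (rank_D Ox).
have r2 : r = 2%N.
  apply/eqP; rewrite eqn_leq (has_rank_le (rP x Ox) (rank_D Ox) sub).
  exact: has_rank_le (rank_D Ox) (rP x Ox) (@derived_sub _ _ O D x).
rewrite r2 in rP.
have subO y : O y -> derived O D y `<=` D y.
  by move=> Oy; exact: has_rank_sub_eq (rank_D Oy) (rP y Oy) (@derived_sub _ _ O D y).
have sub2 : derived O (derived O D) x `<=` D x.
  apply: derived_ind => //; first exact: has_rank_closed (rank_D Ox).
  move=> v [N [X [Y [oN NO [sX PX] [sY PY] ->]]]]; apply: bD.
  exists N, X, Y; split=> //; split=> // y Ny; apply: subO; try exact: NO.
    exact: PX.
  exact: PY.
by have := has_rank_le rk4 (rank_D Ox) sub2.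
Qed.

(** If df were proportional to U at a point, its kernel D'' would be C, contrary
    to [derived2_not_contact]. *)
Lemma regular_kernel_derived2 (U : set V) f : U `<=` O -> smooth U f ->
  (forall x, U x -> has_rank (derived O (derived O D) x) 4) ->
  (forall x, U x -> derived O (derived O D) x = [set v | 'd f x v = 0]) ->
  regular_function U f /\ first_integral U D f.
Proof.
move=> UO sf rk4 kf; split; last first.
  split=> // x v Ux Dv.
  have : derived O (derived O D) x v by do 2 apply: derived_sub.
  by rewrite kf.
apply: regular_of_hamiltonian => x Ux; first exact: smooth_diff sf Ux.
have df := smooth_diff sf Ux.
apply/eqP => h0.
have [b bb nb] := rank4_nonintegrable (UO x Ux) (rk4 x Ux).
have [v dv ncv] := derived2_not_contact (UO x Ux) bb nb.
have dfE u := hamiltonian_eq0 u df h0.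
have [u] := kernel_neq0 (rk4 x Ux) isT (kf x Ux).
rewrite dfE => /eqP; apply; move: dv; rewrite kf//= dfE => /eqP.
rewrite mulf_eq0 => /orP[/eqP ->|/eqP //]; by rewrite mul0r.
Qed.

End IntermediateIntegrals.

(** * Functions of given functions *)

Section LocalFunctions.
Context {R : realType}.

Lemma smooth_row (V : normedModType R) k (F : 'I_k -> V -> R) (O : set V) :
  open O -> (forall i, smooth O (F i)) -> smooth O (fun m => \row_(i < k) F i m).
Proof.
move=> oO sF; apply: smooth_mx => // a b.
by apply: (smooth_ext oO _ (sF b)) => y _; rewrite mxE.
Qed.

Lemma is_diff_row (V : normedModType R) k (F : 'I_k -> V -> R) (O : set V) x v i :
  open O -> (forall i, smooth O (F i)) -> O x ->
  ('d (fun m => \row_(i < k) F i m) x v) 0 i = 'd (F i) x v.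
Proof.
move=> oO sF Ox.
have [_ e] := is_diff_comp (differentiableP (smooth_diff (smooth_row oO sF) Ox)) (is_diff_coord i _).
have E : (fun v : 'rV[R]_k => v 0 i) \o (fun m => \row_(i < k) F i m) = F i.
  by apply/funext => y; rewrite /= mxE.
by rewrite -E; exact: (esym (congr1 (fun G => G v) e)).
Qed.

Lemma locally_function_row n k (U : set 'rV[R]_n.+1) (F : 'I_k -> 'rV[R]_n.+1 -> R) f :
  open U -> (forall i, smooth U (F i)) -> independent U F -> smooth U f ->
  (forall x v, U x -> (forall i, 'd (F i) x v = 0) -> 'd f x v = 0) ->
  locally_function_of U (fun m => \row_(i < k) F i m) f.
Proof.
move=> oU sF indF sf kerF.
apply: functional_dependence => //; first exact: findim_rV.
- exact: smooth_row.
- move=> m Um.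
  have dF i : differentiable (F i) m by exact: smooth_diff (sF i) Um.
  have /row_freeP[C JC] : row_free (gradmx F m).
    by apply/row_free_gradmx => //; exact: indF.
  exists (mulmxr C^T) => t; apply/rowP => i.
  rewrite (is_diff_row _ _ oU sF Um) (diff_gradmx _ (dF i)).
  by rewrite /= -mulmxA -trmx_mul JC trmx1 mulmx1.
move=> x v Ux FF0; apply: kerF => // i.
by rewrite -(is_diff_row v i oU sF Ux) FF0 mxE.
Qed.

Lemma locally_function_smooth (V T : normedModType R) (U : set V) (F : V -> T) (f : V -> R) :
  findim V -> findim T -> smooth U F -> locally_function_of U F f ->
  smooth U f /\ forall x v, U x -> 'd F x v = 0 -> 'd f x v = 0.
Proof.
move=> fV fT sF lf.
have loc x : U x -> exists N Q phi, [/\ open N, N x, smooth N F, smooth Q (phi : T -> R) &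
    (forall y, N y -> Q (F y)) /\ (forall y, N y -> phi (F y) = f y)].
  move=> /lf[N [Q [phi [[oN Nx] NU oQ sphi NP]]]]; exists N, Q, phi; split=> //.
    exact: smooth_sub sF.
  by split=> y /NP[].
split=> [s x Ux|x v Ux Fv].
  have [N [Q [phi [oN Nx sNF sphi [NQ fE]]]]] := loc x Ux.
  have sf : smooth N f by apply: (smooth_ext oN fE); exact: smooth_comp NQ sNF sphi.
  exact: sf.
have [N [Q [phi [oN Nx sNF sphi [NQ fE]]]]] := loc x Ux.
have [dc e] := is_diff_comp (differentiableP (smooth_diff sNF Nx))
   (differentiableP (smooth_diff sphi (NQ x Nx))).
have nE : \near x, (phi \o F) x = f x.
  by near=> y; apply: fE; near: y; exact: open_nbhs_nbhs.
have [_ e2] := near_eq_diff nE dc.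
rewrite [LHS](congr1 (fun G => G v) e2) [LHS](congr1 (fun G => G v) e) /= Fv.
exact: linear0.
Unshelve. all: by end_near. Qed.

Lemma locally_function_scalar n (U : set 'rV[R]_n) (f g : 'rV[R]_n -> R) :
  open U -> smooth U f -> smooth U g -> (forall x, U x -> exists v, 'd f x v != 0) ->
  (forall x v, U x -> 'd f x v = 0 -> 'd g x v = 0) -> locally_function_of U f g.
Proof.
move=> oU sf sg f0 kfg; apply: functional_dependence => //; first exact: findim_R.
move=> m Um; have [v fv] := f0 m Um.
pose sig (t : R) := (t * ('d f m v)^-1) *: v.
have ls : linear sig.
  by move=> a s t; rewrite /sig mulrDl scalerDl scalerA -[a *: s]/(a * s) -mulrA.
exists (HB.pack_for {linear R -> 'rV[R]_n} sig (GRing.isLinear.Build _ _ _ _ _ ls)) => t.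
have -> : 'd f m (sig t) = (t * ('d f m v)^-1) * 'd f m v by exact: linearZ.
by rewrite mulfVK.
Qed.

End LocalFunctions.

(** * The two cases *)

Section Cases.
Context {R : realType}.
Notation V := 'rV[R]_5.
Variables (O : set V) (E : @monge_ampere R).
Hypotheses (oO : open O) (ma : monge_ampere_on O E) (par : parabolic_on O E).
Let D := characteristic E.
Let D2 := derived O (derived O D).
Hypothesis rank_D' : constant_rank O (derived O D).
Hypothesis rank_D'' : constant_rank O D2.

Lemma integrable_first_integrals m : integrable_distribution O D -> O m ->
  exists (U : set V) (F : 'I_3 -> V -> R),
    [/\ open U, U m, U `<=` O, forall i, first_integral U D (F i) & independent U F].
Proof.
move=> intD Om.
by apply: (frobenius oO Om (erefl : (3 + 2 = 5)%N) _ _ intD); [exact: rank_D|exact: extends_D].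
Qed.

(** The common kernel of three independent first integrals contains D and has
    the same rank. *)
Lemma first_integrals_kernel (U : set V) (F : 'I_3 -> V -> R) x v : U `<=` O ->
  (forall i, first_integral U D (F i)) -> independent U F -> U x ->
  (forall i, 'd (F i) x v = 0) -> D x v.
Proof.
move=> UO fiF indF Ux Fv.
have dF i : differentiable (F i) x by case: (fiF i) => sF _; exact: smooth_diff sF Ux.
have fJ : row_free (gradmx F x) by apply/row_free_gradmx => //; exact: indF.
have rA := has_rank_annihilator (erefl : (3 + 2 = 5)%N) fJ.
have sub : D x `<=` [set v | v *m (gradmx F x)^T = 0].
  move=> u Du /=; apply/rowP => i; rewrite -diff_gradmx// [RHS]mxE.
  by case: (fiF i) => _; apply.
apply: (has_rank_sub_eq (rank_D ma par (UO x Ux)) rA sub) => /=.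
by apply/rowP => i; rewrite -diff_gradmx// Fv mxE.
Qed.

Lemma intermediate_function (U : set V) (F : 'I_3 -> V -> R) (f : V -> R) :
  open U -> U `<=` O -> (forall i, first_integral U D (F i)) -> independent U F ->
  intermediate_integral U E f <->
  regular_function U f /\ locally_function_of U (fun m => \row_(i < 3) F i m) f.
Proof.
move=> oU UO fiF indF.
have sF i : smooth U (F i) by case: (fiF i).
rewrite (intermediateP ma par f oU UO).
split=> [[reg [sf fD]]|[reg lf]]; split=> //.
  apply: locally_function_row => // x v Ux Fv; apply: fD => //.
  exact: (first_integrals_kernel UO fiF indF Ux Fv).
have [sf ker] := locally_function_smooth (@findim_rV R 5) (@findim_rV R 3) (smooth_row oU sF) lf.
split=> // x v Ux Dv; apply: ker => //; apply/rowP => i.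
by rewrite (is_diff_row v i oU sF Ux) mxE; case: (fiF i) => _; apply.
Qed.

(** Three independent differentials are not all proportional to U, so one of
    the three first integrals has X_f nonzero, and is regular. *)
Lemma integrable_admits : integrable_distribution O D -> admits_intermediate_integrals O E.
Proof.
move=> intD m Om.
have [U [F [oU Um UO fiF indF]]] := integrable_first_integrals intD Om.
have sF i : smooth U (F i) by case: (fiF i).
have dF i x : U x -> differentiable (F i) x by exact: smooth_diff (sF i).
have [i hi] : exists i, hamiltonian (F i) m != 0.
  apply: contrapT => /forallNP h.
  pose z i := 'D_(delta_mx 0 iz) (F i) m.
  have dFE i u : 'd (F i) m u = z i * contact_form m u.
    by apply: hamiltonian_eq0; [exact: dF|have /negP := h i; rewrite negbK => /eqP].
  (* dF j = z j U for each j, so z 1 dF 0 - z 0 dF 1 = 0; independence gives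
     z 0 = 0, which contradicts the independence of dF 0 alone. *)
  pose a (j : 'I_3) : R := if j == 0 then z 1 else if j == 1 then - z 0 else 0.
  have a0 j : a j = 0.
    apply: (indF m Um) => v; rewrite !big_ord_recl big_ord0 /a !dFE /=.
    have -> : lift ord0 ord0 = 1 :> 'I_3 by exact: val_inj.
    have -> : ord0 = 0 :> 'I_3 by [].
    by rewrite /=; ring.
  have z0 : z 0 = 0 by have /eqP := a0 1; rewrite /a /= oppr_eq0 => /eqP.
  pose b (j : 'I_3) : R := if j == 0 then 1 else 0.
  have b0 : b 0 = 0.
    apply: (indF m Um) => v; rewrite !big_ord_recl big_ord0 /b !dFE /=.
    by have -> : ord0 = 0 :> 'I_3 by []; rewrite z0; ring.
  by move/eqP: b0; rewrite /b /= oner_eq0.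
have sh := smooth_hamiltonian oU (sF i).
pose N : set V := [set x | U x /\ hamiltonian (F i) x != 0].
have oN : open N by apply: open_neq0 => // x Ux; exact: smooth_continuous sh Ux.
have NU : N `<=` U by move=> x [].
exists N, (F i); split=> //; first by move=> x /NU /UO.
apply/(intermediateP ma par) => //; first by move=> x /NU /UO.
split.
  by apply: regular_of_hamiltonian => x [Ux ?] //; exact: dF.
split; first exact: smooth_sub (sF i).
by move=> x v /NU Ux Dv; case: (fiF i) => _; apply.
Qed.

(** A first integral of D'' with nonzero differential has a kernel of the rank
    of D'' that contains D''. *)
Lemma derived2_integral_exists m : (forall x, O x -> has_rank (D2 x) 4) ->
  integrable_distribution O D2 -> O m ->
  exists (U : set V) (f : V -> R),
    [/\ open U, U m, U `<=` O, smooth U f & forall x, U x -> D2 x = [set v | 'd f x v = 0]].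
Proof.
move=> rk4 int2 Om; have [r rP] := rank_D'.
have ext : extends_locally O D2 m.
  apply: (extends_derived oO Om rk4); apply: (extends_derived oO Om rP).
  exact: extends_D.
have [U [F [oU Um UO fiF indF]]] := frobenius oO Om (erefl : (1 + 4 = 5)%N) rk4 ext int2.
exists U, (F 0); split=> //; first by case: (fiF 0).
move=> x Ux; have [sF FD] := fiF 0.
have sub : D2 x `<=` [set v | 'd (F 0) x v = 0] by move=> v; exact: FD.
have [v Fv] : exists v, 'd (F 0) x v != 0.
  apply: contrapT => /forallNP h.
  have b0 : (fun=> 1 : R) (0 : 'I_1) = 0.
    apply: (indF x Ux (fun=> 1) _ 0) => v; rewrite big_ord1 mul1r (ord1 ord0).
    by apply/eqP; have /negP := h v; rewrite negbK.
  by move/eqP: b0; rewrite oner_eq0.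
apply/seteqP; split=> //.
exact: has_rank_sub_eq (rk4 x (UO x Ux)) (has_rank_kernel (smooth_diff sF Ux) Fv) sub.
Qed.

(** Two functions with dg vanishing on ker df are functionally dependent, and
    first integrals of D are first integrals of D''. *)
Lemma derived2_intermediate (U : set V) (f : V -> R) :
  (forall x, O x -> has_rank (D2 x) 4) -> open U -> U `<=` O -> smooth U f ->
  (forall x, U x -> D2 x = [set v | 'd f x v = 0]) ->
  intermediate_integral U E f /\
  forall g : V -> R, intermediate_integral U E g -> locally_function_of U f g.
Proof.
move=> rk4 oU UO sf kf.
have rkU x : U x -> has_rank (D2 x) 4 by move=> Ux; exact: rk4 (UO x Ux).
split.
  apply/(intermediateP ma par) => //.
  exact: (regular_kernel_derived2 oO ma par rank_D' UO sf rkU kf).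
move=> g /(intermediateP ma par g oU UO) [_ fig].
have [sg g2] := first_integral_derived O oU (first_integral_derived O oU fig).
apply: locally_function_scalar => //.
  by move=> x Ux; exact: (kernel_neq0 (rkU x Ux) isT (kf x Ux)).
by move=> x v Ux fv; apply: g2 => //; rewrite -/D2 kf.
Qed.

(** If D is not integrable, then D' lies in C and D'' does not, so
    3 <= rank D' < rank D'' <= rank ker df = 4 for an intermediate integral f,
    and D'' is the kernel of df. *)
Lemma admits_cases : admits_intermediate_integrals O E ->
  integrable_distribution O D \/
  ((forall x, O x -> has_rank (D2 x) 4) /\ integrable_distribution O D2).
Proof.
move=> adm; have [intD|nint] := pselect (integrable_distribution O D); first by left.
right.
have [x0 [b0 [Ox0 bb0 nb0]]] : exists x b, [/\ O x, bracket_values O D x b & ~ D x b].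
  apply: contrapT => h; apply: nint => x Ox b bb; apply: contrapT => nb.
  by apply: h; exists x, b.
have nonint := nonintegrable_everywhere ma par rank_D' Ox0 bb0 nb0.
have [r' r'P] := rank_D'; have [r'' r''P] := rank_D''.
have loc m : O m -> exists (U : set V) (f : V -> R), [/\ open U, U m, U `<=` O,
    smooth U f & forall x, U x -> has_rank (D2 x) 4 /\ D2 x = [set v | 'd f x v = 0]].
  move=> Om; have [U [f [oU Um UO /(intermediateP ma par f oU UO) [reg fi]]]] := adm m Om.
  have [sf f2] := first_integral_derived O oU (first_integral_derived O oU fi).
  exists U, f; split=> // x Ux; have Ox := UO x Ux.
  have sub : D2 x `<=` [set v | 'd f x v = 0] by move=> v; exact: f2.
  have [v fv] : exists v, 'd f x v != 0.
    by have [v _ fv] := contact_direction Ux sf reg; exists v; rewrite fv oner_neq0.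
  have rker := has_rank_kernel (smooth_diff sf Ux) fv.
  have [b bb nb] := nonint x Ox.
  have [u du ncu] := derived2_not_contact oO ma par Ox bb nb.
  have r'3 := rank_derived_gt2 ma par Ox (r'P x Ox) bb nb.
  have r'r'' : (r' < r'')%N.
    apply: has_rank_lt (r'P x Ox) (r''P x Ox) (@derived_sub _ _ O _ x) du _ => d'u.
    exact: ncu (derived_contact ma Ox d'u).
  have r''4 := has_rank_le (r''P x Ox) rker sub.
  have r4 : r'' = 4%N by apply/eqP; rewrite eqn_leq r''4 (leq_ltn_trans r'3 r'r'').
  have rk4 : has_rank (D2 x) 4 by have := r''P x Ox; rewrite r4.
  split=> //; apply/seteqP; split=> //; exact: has_rank_sub_eq rk4 rker sub.
split.
  by move=> m Om; have [U [f [_ Um _ _ UP]]] := loc m Om; have [] := UP m Um.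
move=> m Om w [N [X [Y [[oN Nm] NO [sX PX] [sY PY] ->]]]].
have [U [f [oU Um UO sf UP]]] := loc m Om.
have [_ ->] := UP m Um; rewrite /=.
have oNU : open (N `&` U) by exact: openI.
have kerD2 y v : U y -> D2 y v -> 'd f y v = 0 by move=> Uy; have [_ ->] := UP y Uy.
apply: (bracket_first_integral oNU).
- by split.
- by apply: smooth_sub sf => y [].
- by apply: smooth_sub sX => y [].
- by apply: smooth_sub sY => y [].
- by move=> y [Ny Uy]; apply: kerD2 => //; exact: PX.
- by move=> y [Ny Uy]; apply: kerD2 => //; exact: PY.
Qed.

End Cases.

Theorem theorem4p4 (R : realType) (O : set 'rV[R]_5) (E : @monge_ampere R)
    (O_open : open O) (E_ma : monge_ampere_on O E) (E_par : parabolic_on O E)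
    (rank_D : constant_rank O (characteristic E))
    (rank_D' : constant_rank O (derived O (characteristic E)))
    (rank_D'' : constant_rank O (derived O (derived O (characteristic E)))) :
  let D := characteristic E in
  let D'' := derived O (derived O D) in
  let case1 := integrable_distribution O D in
  let case2 := (forall m, O m -> has_rank (D'' m) 4) /\
               integrable_distribution O D'' in
  [/\ admits_intermediate_integrals O E <-> case1 \/ case2,
      case1 ->
        (forall m, O m -> exists (V : set 'rV[R]_5) (F : 'I_3 -> 'rV[R]_5 -> R),
           [/\ open V, V m, V `<=` O, forall i, first_integral V D (F i)
             & independent V F]) /\
        (forall (V : set 'rV[R]_5) (F : 'I_3 -> 'rV[R]_5 -> R),
           open V -> V `<=` O ->
           (forall i, first_integral V D (F i)) -> independent V F ->
           forall f : 'rV[R]_5 -> R,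
             intermediate_integral V E f <->
             regular_function V f /\
             locally_function_of V (fun m => \row_(i < 3) F i m) f)
    & case2 ->
        (forall m, O m -> exists (V : set 'rV[R]_5) (f : 'rV[R]_5 -> R),
           [/\ open V, V m, V `<=` O, smooth V f
             & forall x, V x -> D'' x = [set v | 'd f x v = 0]]) /\
        (forall (V : set 'rV[R]_5) (f : 'rV[R]_5 -> R),
           open V -> V `<=` O -> smooth V f ->
           (forall x, V x -> D'' x = [set v | 'd f x v = 0]) ->
           intermediate_integral V E f /\
           forall g : 'rV[R]_5 -> R,
             intermediate_integral V E g -> locally_function_of V f g)].
Proof.
move=> D D'' case1 case2; split.
- split; first exact: admits_cases.
  case=> [intD|[rk4 int2]]; first exact: integrable_admits.
  move=> m Om.
  have [U [f [oU Um UO sf kf]]] := derived2_integral_exists O_open E_ma E_par rank_D' rk4 int2 Om.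
  exists U, f; split=> //.
  exact: (derived2_intermediate O_open E_ma E_par rank_D' rk4 oU UO sf kf).1.
- move=> intD; split=> [m Om|V F oV VO fiF indF f].
    exact: integrable_first_integrals.
  exact: (intermediate_function E_ma E_par f oV VO fiF indF).
move=> [rk4 int2]; split=> [m Om|V f oV VO sf kf].
  exact: (derived2_integral_exists O_open E_ma E_par rank_D' rk4 int2 Om).
exact: (derived2_intermediate O_open E_ma E_par rank_D' rk4 oV VO sf kf).
Qed.
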